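(* Let $n \geq 2$ and $f \in C_0^{\infty}(\mathbb{R}^n\setminus\{0\})$. Then \[ \left\|\sum_{j=1}^n L_j^2 f \right\|_{2}^2=\sum_{k = 1}^\infty\mu_k^2\left\| \frac{P_k f}{|x|^2} \right\|_{2}^2 \qquad\text{and}\qquad \sum_{j=1}^n \left\|\frac{L_j f}{|x|} \right\|_{2}^2 =\sum_{k = 1}^\infty\mu_k\left\| \frac{P_k f}{|x|^2} \right\|_{2}^2 . \]
   Context: $\|\cdot\|_2$ denotes the norm of $L^2(\mathbb{R}^n)$ (Lebesgue measure). The radial derivative is $\partial_r = \frac{x}{|x|}\cdot\nabla$, and the spherical-type derivatives are $L_j = \partial_j - \frac{x_j}{|x|}\partial_r$ for $j=1,\ldots,n$. For $k\ge 0$, $\mu_k = k(k+n-2)$, and $P_k$ is the orthogonal projection of $L^2(\mathbb{R}^n)$ onto the closed subspace $\mathcal{H}_k(\mathbb{R}^n)$ spanned by spherical harmonics of degree $k$ (as functions of $x/|x|$) multiplied by radial functions. *)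

(* Defs.v *)
(* Complex scalars are the [R[i]] of real-closed. multinomials is required but
   not imported, because its notations clash with those of MathComp-Analysis. *)
From HB Require Import structures.
From mathcomp Require Import all_boot all_order all_algebra.
From mathcomp Require Import all_classical all_reals all_analysis.
From mathcomp Require Import complex.
From mathcomp Require mpoly.

Set Implicit Arguments.
Unset Strict Implicit.
Unset Printing Implicit Defensive.

Import Order.TTheory GRing.Theory Num.Theory.
Import numFieldNormedType.Exports.

Local Open Scope classical_set_scope.
Local Open Scope ring_scope.
Local Open Scope complex_scope.

(* R^n is ['rV[R]_n]. Its sigma-algebra is generated by the coordinates, i.e. it
   is the Borel sigma-algebra. *)
Definition rV_coord (R : realType) (n : nat) (i : 'I_n) (x : 'rV[R]_n) : R :=
  x ord0 i.

Section measurable_rV.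
Context (R : realType) (n : nat).

Let rV_set0 : g_sigma_preimage (@rV_coord R n) set0.
Proof. exact: sigma_algebra0. Qed.

Let rV_setC A : g_sigma_preimage (@rV_coord R n) A ->
  g_sigma_preimage (@rV_coord R n) (~` A).
Proof. exact: sigma_algebraC. Qed.

Let rV_bigcup (F : (set 'rV[R]_n)^nat) :
  (forall i, g_sigma_preimage (@rV_coord R n) (F i)) ->
  g_sigma_preimage (@rV_coord R n) (\bigcup_i (F i)).
Proof. exact: sigma_algebra_bigcup. Qed.

HB.instance Definition _ :=
  @isMeasurable.Build (measure_tuple_display default_measure_display)
    'rV[R]_n (g_sigma_preimage (@rV_coord R n)) rV_set0 rV_setC rV_bigcup.

End measurable_rV.

Lemma measurable_rV_coord (R : realType) (n : nat) (i : 'I_n) :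
  measurable_fun [set: 'rV[R]_n] (@rV_coord R n i).
Proof.
move=> _ Y mY; rewrite setTI; apply: sub_sigma_algebra => /=.
rewrite -bigcup_seq/=; exists i => /=; first by rewrite mem_index_enum.
by exists Y => //; rewrite setTI.
Qed.

Lemma measurable_fun_rVP d (T : measurableType d) (R : realType) (n : nat)
    (f : T -> 'rV[R]_n) :
  (forall i, measurable_fun [set: T] (@rV_coord R n i \o f)) ->
  measurable_fun [set: T] f.
Proof.
move=> mf.
suff prefS : g_sigma_preimage (fun i => @rV_coord R n i \o f) `<=` measurable.
  by rewrite g_sigma_preimage_comp in prefS => _ A mA; apply: prefS; exists A.
apply: smallest_sub; first exact: sigma_algebra_measurable.
case: n => [|n] in f mf *; first by rewrite big_ord0.
rewrite -bigcup_mkord_ord; apply: bigcup_sub => i Ii.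
by move=> A [B mB <-]; exact: mf.
Qed.

Section lebesgue_rV.
Context (R : realType).

Definition rV_cons (n : nat) (p : measurableTypeR R * 'rV[R]_n) : 'rV[R]_n.+1 :=
  row_mx (p.1)%:M p.2.

Definition rV_uncons (n : nat) (x : 'rV[R]_n.+1) :
    measurableTypeR R * 'rV[R]_n :=
  (x ord0 ord0, rsubmx (x : 'rV[R]_(1 + n))).

Lemma rV_consK n : cancel (@rV_cons n) (@rV_uncons n).
Proof.
move=> [a v]; rewrite /rV_uncons /rV_cons/= row_mxKr; congr pair.
have e : ord0 = lshift n (ord0 : 'I_1) by exact/val_inj.
by rewrite [LHS](congr1 (row_mx a%:M v ord0) e) row_mxEl mxE.
Qed.

Lemma rV_unconsK n : cancel (@rV_uncons n) (@rV_cons n).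
Proof.
move=> x; rewrite -[RHS](@hsubmxK R 1 1 n x) /rV_cons/=.
suff -> : (x ord0 ord0)%:M = lsubmx (x : 'rV_(1 + n)) by [].
apply/matrixP => i j; rewrite !mxE !ord1 eqxx mulr1n; congr (x _ _).
exact/val_inj.
Qed.

Lemma measurable_rV_cons n : measurable_fun setT (@rV_cons n).
Proof.
suff mi (i : 'I_(1 + n)) : measurable_fun setT
    (fun p : measurableTypeR R * 'rV[R]_n => row_mx (p.1)%:M p.2 ord0 i : R).
  by apply: measurable_fun_rVP => i; exact: mi.
have [j ->|j ->] := split_ordP i.
  rewrite [X in measurable_fun _ X](_ : _ = fst) //.
  by apply/funext => p; rewrite row_mxEl mxE !ord1.
rewrite [X in measurable_fun _ X](_ : _ = @rV_coord R n j \o snd).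
  by apply: measurableT_comp => //; exact: measurable_rV_coord.
by apply/funext => p; rewrite row_mxEr.
Qed.

Lemma measurable_rV_uncons n : measurable_fun setT (@rV_uncons n).
Proof.
apply: measurable_fun_pair; first exact: (@measurable_rV_coord R n.+1 ord0).
apply: measurable_fun_rVP => i.
rewrite [X in measurable_fun _ X](_ : _ = @rV_coord R n.+1 (rshift 1 i)).
  exact: measurable_rV_coord.
by apply/funext => x; rewrite /= /rV_coord mxE.
Qed.

Section step.
Context (n : nat) (m : {sigma_finite_measure set 'rV[R]_n -> \bar R}).

Definition lebesgue_rV_step : set 'rV[R]_n.+1 -> \bar R :=
  pushforward (product_measure1 (@lebesgue_measure R) m) (@rV_cons n).

Let preim (A : set 'rV[R]_n.+1) :
  measurable A -> measurable (@rV_cons n @^-1` A).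
Proof.
by move=> mA; rewrite -[X in measurable X]setTI; exact: measurable_rV_cons.
Qed.

Let step0 : lebesgue_rV_step set0 = 0%E.
Proof. by rewrite /lebesgue_rV_step /pushforward preimage_set0 measure0. Qed.

Let step_ge0 A : (0 <= lebesgue_rV_step A)%E.
Proof. by rewrite /lebesgue_rV_step /pushforward; exact: measure_ge0. Qed.

Let step_sigma_additive : semi_sigma_additive lebesgue_rV_step.
Proof.
move=> F mF tF mUF; rewrite /lebesgue_rV_step /pushforward preimage_bigcup.
apply: measure_semi_sigma_additive.
- by move=> k; exact: preim.
- apply/trivIsetP => /= i j _ _ ij; rewrite -preimage_setI.
  by move/trivIsetP : tF => /(_ _ _ _ _ ij) ->//; rewrite preimage_set0.
- by rewrite -preimage_bigcup; exact: preim.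
Qed.

HB.instance Definition _ := isMeasure.Build _ _ _ lebesgue_rV_step
  step0 step_ge0 step_sigma_additive.

Let step_sigma_finite : sigma_finite setT lebesgue_rV_step.
Proof.
have /sigma_finiteP[F [TF ndF Foo]] := sigma_finiteT (@lebesgue_measure R).
have /sigma_finiteP[G [TG ndG Goo]] := sigma_finiteT m.
exists (fun k => @rV_uncons n @^-1` (F k `*` G k)).
  rewrite -preimage_bigcup; apply/esym; rewrite -subTset => x _ /=.
  have [i _ Fi] : (\bigcup_i F i) (rV_uncons x).1 by rewrite -TF.
  have [j _ Gj] : (\bigcup_i G i) (rV_uncons x).2 by rewrite -TG.
  exists (maxn i j) => //; split.
    by move: Fi; exact/subsetPset/ndF/leq_maxl.
  by move: Gj; exact/subsetPset/ndG/leq_maxr.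
move=> k; have [mF Fk] := Foo k; have [mG Gk] := Goo k; split.
  rewrite -[X in measurable X]setTI; apply: measurable_rV_uncons => //.
  exact: measurableX.
rewrite /lebesgue_rV_step /pushforward -comp_preimage.
rewrite (_ : _ \o _ = id); last by apply/funext => p; rewrite /= rV_consK.
rewrite preimage_id product_measure1E//.
by rewrite lte_mul_pinfty// ge0_fin_numE.
Qed.

HB.instance Definition _ := Measure_isSigmaFinite.Build _ _ _ lebesgue_rV_step
  step_sigma_finite.

End step.

(* n-fold product of the one-dimensional Lebesgue measure; the unit point mass
   on R^0. *)
Fixpoint lebesgue_rV (n : nat) :
    {sigma_finite_measure set 'rV[R]_n -> \bar R} :=
  match n with
  | 0 => \d_(0 : 'rV[R]_0)
  | n'.+1 => lebesgue_rV_step (lebesgue_rV n')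
  end.

End lebesgue_rV.

Section differential_operators.
Context (R : realType) (n : nat).
Implicit Types (g : 'rV[R]_n -> R) (f : 'rV[R]_n -> R[i]) (x : 'rV[R]_n).

(* The library norm of ['rV[R]_n] is the sup norm, hence this definition. *)
Definition enorm x : R := Num.sqrt (\sum_(i < n) x ord0 i ^+ 2).

Fixpoint is_Ck (k : nat) g : Prop :=
  match k with
  | 0 => continuous g
  | k'.+1 => continuous g /\
      forall j : 'I_n, (forall x, derivable g x (delta_mx ord0 j)) /\
        is_Ck k' (fun x => 'D_(delta_mx ord0 j) g x)
  end.

Definition smooth f : Prop :=
  forall k, is_Ck k (fun x => complex.Re (f x)) /\
            is_Ck k (fun x => complex.Im (f x)).

Definition support_of f : set 'rV[R]_n := closure [set x | f x != 0].

(* Elements of C_0^oo(R^n \ {0}) are identified with their extension by 0. *)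
Definition test_function_off0 f : Prop :=
  [/\ smooth f, compact (support_of f) & ~ support_of f 0].

Definition partial (j : 'I_n) f x : R[i] :=
  'D_(delta_mx ord0 j) (fun y => complex.Re (f y)) x +i*
  'D_(delta_mx ord0 j) (fun y => complex.Im (f y)) x.

Definition radial_derivative f x : R[i] :=
  \sum_(j < n) (x ord0 j / enorm x)%:C * partial j f x.

(* L_j; here and above, x / |x| is 0 at the origin (x / 0 = 0). *)
Definition spherical_derivative (j : 'I_n) f x : R[i] :=
  partial j f x - (x ord0 j / enorm x)%:C * radial_derivative f x.

End differential_operators.

Section L2.
Context (R : realType) (n : nat).
Implicit Types (f g h : 'rV[R]_n -> R[i]) (S V : set ('rV[R]_n -> R[i])).

Definition L2norm f : \bar R :=
  Lnorm (lebesgue_rV R n) 2%:E (fun x => (Normc.normc (f x))%:E).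

(* Functions rather than classes modulo a.e. equality; the subspaces below are
   invariant under modification on a null set. *)
Definition L2 : set ('rV[R]_n -> R[i]) :=
  [set f | (fun x => complex.Re (f x)) \in Lfun (lebesgue_rV R n) 2%:E /\
           (fun x => complex.Im (f x)) \in Lfun (lebesgue_rV R n) 2%:E].

Definition L2dot f g : R[i] :=
  (\int[lebesgue_rV R n]_x complex.Re (f x * (g x)^*)) +i*
  (\int[lebesgue_rV R n]_x complex.Im (f x * (g x)^*)).

Definition linear_span S : set ('rV[R]_n -> R[i]) :=
  [set h | exists (m : nat) (c : 'I_m -> R[i]) (u : 'I_m -> 'rV[R]_n -> R[i]),
     (forall i, S (u i)) /\ h = (fun x => \sum_(i < m) c i * u i x)].

Definition L2_closed_span S : set ('rV[R]_n -> R[i]) :=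
  [set f | L2 f /\ forall e : R, 0 < e ->
     exists2 h, linear_span S h & (L2norm (fun x => f x - h x)%R < e%:E)%E].

(* By this property P f is determined up to a null set. *)
Definition orthogonal_projection V
    (P : ('rV[R]_n -> R[i]) -> ('rV[R]_n -> R[i])) : Prop :=
  forall f, L2 f ->
    V (P f) /\ forall h, V h -> L2dot (fun x => f x - P f x) h = 0.

(* Homogeneous harmonic polynomials of degree k; the spherical harmonics of
   degree k are their restrictions to the unit sphere. The first clause is
   [k.-homog] of multinomials, unfolded. *)
Definition solid_harmonic (k : nat) (p : mpoly.mpoly n R[i]) : Prop :=
  all [pred m | mpoly.mdeg m == k] (mpoly.msupp p) /\
  \sum_(i < n) mpoly.mderiv i (mpoly.mderiv i p) = 0.

Definition harmonic_times_radial (k : nat) : set ('rV[R]_n -> R[i]) :=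
  [set h | exists (p : mpoly.mpoly n R[i]) (g : R -> R[i]),
     solid_harmonic k p /\
     h = (fun x => g (enorm x) *
            mpoly.meval (fun i => (x ord0 i / enorm x)%:C) p)].

Definition harmonic_space (k : nat) : set ('rV[R]_n -> R[i]) :=
  L2_closed_span (harmonic_times_radial k `&` L2).

End L2.

Definition mu_sph (R : realType) (n k : nat) : R := (k * (k + n - 2))%:R.

(* Main.v *)
(** Put N_j = |x|^2 L_j, a field tangent to the spheres, and W = sum_j N_j^2, so
    that sum_j L_j^2 f = |x|^-4 W f for f supported off the origin.  Integrating by
    parts against a radial weight psi gives
      int psi (W u) v = - int psi sum_j (N_j u) (N_j v),
    so W is symmetric.  A harmonic polynomial p of degree k satisfies
    W p = - mu_k |x|^2 p.  Hence the spaces H_k are pairwise orthogonal and the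
    projection of F = sum_j L_j^2 f on H_k is - mu_k |x|^-2 P_k f.  By the
    Weierstrass theorem and the decomposition of polynomials into sums of
    |x|^(2 i) times harmonic ones, F is an L^2 limit of finite sums of elements of
    the H_k, which yields Parseval's identity for <F, G> with any G in L^2.
    Taking G = F gives the first formula, and G = |x|^-2 f the second one, as
    - <F, |x|^-2 f> = sum_j ||L_j f / |x| ||^2. *)

Require Import Defs.
From HB Require Import structures.
From mathcomp Require Import all_boot all_order all_algebra.
From mathcomp Require Import all_classical all_reals all_analysis.
From mathcomp Require Import complex measurable_realfun.
From mathcomp Require Import ring lra.
From mathcomp Require mpoly.
Import (canonicals, coercions) mpoly.

Set Implicit Arguments.
Unset Strict Implicit.
Unset Printing Implicit Defensive.

Import Order.TTheory GRing.Theory Num.Theory.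
Import numFieldNormedType.Exports.

Local Open Scope classical_set_scope.
Local Open Scope ring_scope.

(** * Lebesgue measure and integration by parts *)

(** The radial factors of the generators of H_k are arbitrary functions: their measurability has to
    be extracted from that of the product with a harmonic, and no bound or regularity comes with
    them. Orthogonality is therefore tested against weights that are merely bounded and measurable
    in |x|^2, and the integration by parts must hold for these. It is proved for C^1 weights, where
    no derivative of the weight survives because N_j annihilates radial functions, then for
    indicators of half-lines by dominated convergence, and finally for measurable weights by a
    pi-lambda argument. The factor |x|^2 in N_j makes the coefficients polynomial: the eigenvalue
    equation for W becomes an identity between polynomials, and nothing is singular at the origin.
    The function P_k f is an arbitrary representative, known neither to be smooth nor to vanish near
    the origin. Hence |x|^-2 P_k f is replaced by a product with a bounded radial function supported
    in the annulus that carries f, and the two are shown to agree almost everywhere. *)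

Section Euclidean_measure.
Context (R : realType) (n : nat).
Local Notation mu := (lebesgue_rV R n).
Implicit Types (x y : 'rV[R]_n) (u v : 'rV[R]_n -> R).

(** The sigma-algebra is generated by the coordinates, the topology by the sup norm. An open set is
    the union of the boxes [box q], of rational centre and radius 1/(m + 1), that it contains, and
    there are countably many of them. *)
Lemma open_measurable_rV (O : set 'rV[R]_n) : open O -> measurable O.
Proof.
move=> oO.
pose box (q : 'rV[rat]_n * nat) : set 'rV[R]_n :=
  [set x | forall i, ball (ratr (q.1 ord0 i) : R) (q.2.+1%:R^-1) (x ord0 i)].
have mbox q : measurable (box q).
  rewrite (_ : box q = \bigcap_(i in [set: 'I_n])
      (@rV_coord R n i @^-1` ball (ratr (q.1 ord0 i) : R) (q.2.+1%:R^-1))).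
    apply: fin_bigcap_measurable => //.
    move=> i _; rewrite -[X in measurable X]setTI.
    by apply: measurable_rV_coord => //; apply: open_measurable; exact: ball_open.
  by apply/seteqP; split=> x /= bx i; [move=> _|]; exact: bx.
rewrite (_ : O = \bigcup_q (if `[< box q `<=` O >] then box q else set0)).
  apply: countable_bigcupT_measurable; first exact: countableP.
  by move=> q; case: ifP.
apply/seteqP; split=> [x Ox|x [q _]]; last by case: asboolP => // bO; exact: bO.
have /nbhs_ballP[e /= e0 eO] : nbhs x O by exact: open_nbhs_nbhs.
(* With a radius below e / 2, a box that contains x lies in the ball of radius e about x. *)
have [m me] : exists m : nat, m.+1%:R^-1 < e / 2.
  have := near_infty_natSinv_lt (PosNum (divr_gt0 e0 (ltr0n R 2))).
  by move=> [m _ /(_ m)/= h]; exists m; exact: h.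
have d0 : 0 < m.+1%:R^-1 :> R by rewrite invr_gt0.
have qx i : exists q : rat, ball (ratr q : R) m.+1%:R^-1 (x ord0 i).
  have [q [qb [r _ rq]]] := @dense_rat R (ball (x ord0 i) m.+1%:R^-1)
     (ex_intro _ _ (ballxx _ d0)) (@ball_open R R (x ord0 i) _).
  by exists r; apply: ball_sym; rewrite rq.
have [q qP] := choice qx.
exists (\row_i q i, m) => //.
rewrite (_ : `[< _ >] = true); first by move=> i /=; rewrite mxE; exact: qP.
apply/asboolP => y /= yb; apply: eO; split=> // i j; rewrite (ord1 i).
apply: (le_ball (ltW (_ : m.+1%:R^-1 + m.+1%:R^-1 < e)));
    first by move: me; rewrite ltr_pdivlMr// mulr_natr mulr2n.
apply: ball_triangle; first by apply: ball_sym; exact: qP.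
by have := yb j; rewrite mxE.
Qed.

Lemma continuous_measurable_rV u : continuous u -> measurable_fun setT u.
Proof.
move=> /continuousP cu; apply: (measurability _ (RGenOpens.measurableE R)).
move=> _ [_ [a [b ->] <-]]; rewrite setTI; apply: open_measurable_rV.
exact/cu/interval_open.
Qed.

Definition cube (B : R) : set 'rV[R]_n :=
  [set x | forall i, `|x ord0 i| <= B].

Lemma measurable_cube (B : R) : measurable (cube B).
Proof.
rewrite (_ : cube B = \bigcap_(i in [set: 'I_n])
    (@rV_coord R n i @^-1` `[- B, B])).
  apply: fin_bigcap_measurable => //.
  move=> i _; rewrite -[X in measurable X]setTI.
  exact: measurable_rV_coord.
apply/seteqP; split=> x /= bx i.
  by move=> _; rewrite /rV_coord/= in_itv/= -ler_norml; exact: bx.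
by have := bx i I; rewrite /rV_coord/= in_itv/= -ler_norml.
Qed.

End Euclidean_measure.
Arguments cube {R n} B.

Lemma lebesgue_rVS (R : realType) n (A : set 'rV[R]_n.+1) :
  lebesgue_rV R n.+1 A =
  product_measure1 (@lebesgue_measure R) (lebesgue_rV R n) (@rV_cons R n @^-1` A).
Proof. by []. Qed.

Lemma rV_consE0 (R : realType) n (a : R) (v : 'rV[R]_n) :
  rV_cons (a, v) ord0 ord0 = a.
Proof. by have := congr1 fst (@rV_consK R n (a, v)). Qed.

Lemma rV_consES (R : realType) n (a : R) (v : 'rV[R]_n) i :
  rV_cons (a, v) ord0 (lift ord0 i) = v ord0 i.
Proof.
have /(congr1 (fun w : 'rV[R]_n => w ord0 i)) := congr1 snd (@rV_consK R n (a, v)).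
by rewrite /= mxE => <-; congr (rV_cons _ _ _); exact/val_inj.
Qed.

Lemma lebesgue_rV_cube (R : realType) n (B : R) :
  (lebesgue_rV R n (cube B) < +oo)%E.
Proof.
elim: n => [|n IH]; first by rewrite /= diracE; case: (_ \in _); rewrite ltry.
rewrite lebesgue_rVS (_ : _ @^-1` _ = `[- B, B] `*` cube B); last first.
  apply/seteqP; split=> [[a v]|[a v]] /=.
    move=> h; split; first by have := h ord0; rewrite rV_consE0 in_itv/= ler_norml.
    by move=> i; have := h (lift ord0 i); rewrite rV_consES.
  move=> [+ h] i; rewrite in_itv/= -ler_norml => aB.
  by have [j ->|->] := unliftP ord0 i; rewrite ?rV_consE0 ?rV_consES.
rewrite product_measure1E//; last exact: measurable_cube.
have := lebesgue_measure_itv `[- B, B]; rewrite /= => ->;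
    case: ifP => h; last by rewrite mul0e ltry.
by rewrite lte_fin in h; apply: lte_mul_pinfty => //; rewrite -?EFinD ?ltry// lee_fin; lra.
Qed.

(** The origin lies in the null hyperplane where the first coordinate is 0. Hence identities that
    involve x / |x| may be tested off the origin only. *)
Lemma lebesgue_rV0 (R : realType) n : lebesgue_rV R n.+1 [set 0] = 0%E.
Proof.
apply/eqP; rewrite -measure_le0.
rewrite [leRHS](_ : 0%E = product_measure1 (@lebesgue_measure R) (lebesgue_rV R n)
  ([set 0] `*` setT)); last by rewrite product_measure1E//= lebesgue_measure_set1 mul0e.
apply: (@le_measure _ _ _ (product_measure1 (@lebesgue_measure R) (lebesgue_rV R n))
    (@rV_cons R n @^-1` [set 0])); rewrite ?inE.
- rewrite -[X in measurable X]setTI; apply: measurable_rV_cons => //.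
  rewrite (_ : [set 0] = cube 0); first exact: measurable_cube.
  apply/seteqP; split=> [x -> i|x h]; first by rewrite mxE normr0.
  by apply/rowP => i; apply/eqP; rewrite mxE -normr_le0.
- exact: measurableX.
- by move=> [a v] /= h; split => //=; rewrite -(rV_consE0 a v) h mxE.
Qed.

Definition bounded_support (R : realType) n (u : 'rV[R]_n -> R) :=
  exists B, forall x, u x != 0 -> cube B x.

Section integrable_bounded_support.
Context (R : realType) (n : nat).
Local Notation mu := (lebesgue_rV R n).
Implicit Types (x y : 'rV[R]_n) (u v : 'rV[R]_n -> R).

Lemma integrable_bounded_support u (M : R) :
  measurable_fun setT u -> (forall x, `|u x| <= M) -> bounded_support u ->
  mu.-integrable setT (EFin \o u).
Proof.
move=> mf uM [B uB].
have -> : EFin \o u = (EFin \o u) \_ (cube B).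
  apply/funext => x; rewrite patchE; case: ifPn => // /negP xB.
  by have [/= ->//|/uB/mem_set//] := eqVneq (u x) 0.
apply/(integrable_mkcond _ _).1; first exact: measurable_cube.
apply: measurable_bounded_integrable.
- exact: measurable_cube.
- exact: lebesgue_rV_cube.
- exact: measurable_funTS.
- exists M; split; first exact: num_real.
  by move=> t Mt x _ /=; exact: le_trans (uM x) (ltW Mt).
Qed.

Lemma compact_cube (B : R) : compact (@cube R n B).
Proof.
rewrite (_ : cube B = [set x : 'rV[R]_n | forall i, `[- B, B]%classic (x ord0 i)]).
  by apply: (@rV_compact R n (fun=> `[- B, B]%classic)) => i; exact: segment_compact.
by apply/seteqP; split => x /= h i; have := h i; rewrite in_itv/= ler_norml.
Qed.

Lemma continuous_bounded_on_cube u (B : R) : continuous u ->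
  exists2 M, 0 < M & forall x, cube B x -> `|u x| <= M.
Proof.
move=> cu; have [M [_ hM]] : bounded_set (u @` cube B).
  apply: compact_bounded; apply: continuous_compact; last exact: compact_cube.
  exact: continuous_subspaceT.
exists (`|M| + 1) => [|x xB]; first by rewrite ltr_wpDl.
apply: (hM (`|M| + 1)); last by exists x.
by rewrite (le_lt_trans (ler_norm _))// ltrDl.
Qed.

Lemma integrable_continuous_bounded_support u :
  continuous u -> bounded_support u -> mu.-integrable setT (EFin \o u).
Proof.
move=> cu [B uB]; have [M M0 uM] := continuous_bounded_on_cube B cu.
apply: (@integrable_bounded_support _ M); last by exists B.
  exact: continuous_measurable_rV.
by move=> x; have [->|/uB/uM//] := eqVneq (u x) 0; rewrite normr0 ltW.
Qed.

End integrable_bounded_support.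

Section integral_rVS.
Context (R : realType) (n : nat).

(** The measure is by construction a pushforward under [rV_cons]. The two orders of integration
    derived from this serve an induction on the dimension: the first coordinate is the outer
    variable when the derivative is along a later one, the inner variable when it is along the
    first. *)
Lemma integral_rVS_prod (w : 'rV[R]_n.+1 -> R) :
  (lebesgue_rV R n.+1).-integrable setT (EFin \o w) ->
  (product_measure1 (@lebesgue_measure R) (lebesgue_rV R n)).-integrable setT
     (fun p => (w (rV_cons p))%:E) /\
  (\int[lebesgue_rV R n.+1]_x (w x)%:E =
   \int[product_measure1 (@lebesgue_measure R) (lebesgue_rV R n)]_p (w (rV_cons p))%:E)%E.
Proof.
move=> iw; have mw := measurable_int _ iw.
have mc := @measurable_rV_cons R n.
have ii : (product_measure1 (@lebesgue_measure R) (lebesgue_rV R n)).-integrable setT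
     (fun p => (w (rV_cons p))%:E).
  apply/integrableP; split; first exact: (measurableT_comp mw mc).
  move/integrableP : iw => [_]; apply: le_lt_trans.
  rewrite le_eqVlt; apply/orP; left; apply/eqP.
  have := @ge0_integral_pushforward _ _ _ _ R (@rV_cons R n) mc
    (product_measure1 (@lebesgue_measure R) (lebesgue_rV R n)) setT
    (fun x => `|(w x)%:E|)%E.
  rewrite preimage_setT => <- //.
  by apply: measurableT_comp.
split=> //.
have := @integral_pushforward _ _ _ _ R (@rV_cons R n) mc
    (product_measure1 (@lebesgue_measure R) (lebesgue_rV R n)) setT
    (EFin \o w) mw.
by rewrite preimage_setT => /(_ ii measurableT) <-.
Qed.

Lemma integral_rVS12 (w : 'rV[R]_n.+1 -> R) :
  (lebesgue_rV R n.+1).-integrable setT (EFin \o w) ->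
  (\int[lebesgue_rV R n.+1]_x (w x)%:E =
   \int[@lebesgue_measure R]_a \int[lebesgue_rV R n]_v (w (rV_cons (a, v)))%:E)%E.
Proof.
by move=> /integral_rVS_prod[iw ->]; rewrite -(integral12_prod_meas1 iw).
Qed.

Lemma integral_rVS21 (w : 'rV[R]_n.+1 -> R) :
  (lebesgue_rV R n.+1).-integrable setT (EFin \o w) ->
  (\int[lebesgue_rV R n.+1]_x (w x)%:E =
   \int[lebesgue_rV R n]_v \int[@lebesgue_measure R]_a (w (rV_cons (a, v)))%:E)%E.
Proof.
by move=> /integral_rVS_prod[iw ->]; rewrite -(integral21_prod_meas1 iw).
Qed.

End integral_rVS.

Lemma rVDE (R : realType) n (x y : 'rV[R]_n) i : (x + y) ord0 i = x ord0 i + y ord0 i.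
Proof. by rewrite mxE. Qed.

Lemma rVZE (R : realType) n (c : R) (x : 'rV[R]_n) i : (c *: x) ord0 i = c * x ord0 i.
Proof. by rewrite mxE. Qed.

Lemma rV_deltaE (R : realType) n i j :
  (delta_mx ord0 j : 'rV[R]_n) ord0 i = (i == j)%:R.
Proof. by rewrite mxE eqxx. Qed.

Section derive_local.
Context (R : realType) (n : nat).
Implicit Types (x y v : 'rV[R]_n) (u : 'rV[R]_n -> R).

Lemma near0_derive u x v : (\forall y \near x, u y = 0) -> 'D_v u x = 0.
Proof.
move=> u0; have [->|v0] := eqVneq v 0; first by rewrite derive0.
rewrite (@near_eq_derive _ _ _ u (cst 0)) ?derive_cst//.
Qed.

Lemma closed_cube (B : R) : closed (@cube R n B).
Proof. exact: compact_closed (@compact_cube R n B). Qed.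

Lemma bounded_support_derive u v : bounded_support u -> bounded_support ('D_v u).
Proof.
move=> [B uB]; exists B => x; apply: contraNP => xB; apply/eqP.
apply: near0_derive.
have : nbhs x (~` cube B) by apply: open_nbhs_nbhs; split=> //; exact/closed_openC/closed_cube.
by apply: filterS => y yB; apply: contrapT => /eqP/uB.
Qed.

End derive_local.

Section slices.
Context (R : realType) (n : nat).
Implicit Types (a : R) (v : 'rV[R]_n) (u : 'rV[R]_n.+1 -> R).

Lemma rV_cons_shift0 h a v :
  rV_cons (h + a, v) = h *: delta_mx ord0 ord0 + rV_cons (a, v).
Proof.
apply/rowP => i; rewrite rVDE rVZE rV_deltaE; have [j ->|->] := unliftP ord0 i.
  by rewrite !rV_consES eq_sym (negbTE (neq_lift _ _)) mulr0 add0r.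
by rewrite !rV_consE0 eqxx mulr1.
Qed.

Lemma rV_cons_shiftS h a v w :
  rV_cons (a, h *: w + v) = h *: rV_cons (0, w) + rV_cons (a, v).
Proof.
apply/rowP => i; rewrite rVDE rVZE; have [j ->|->] := unliftP ord0 i.
  by rewrite !rV_consES !mxE.
by rewrite !rV_consE0 mulr0 add0r.
Qed.

Lemma rV_cons_delta j :
  rV_cons (0 : R, delta_mx ord0 j : 'rV[R]_n) = delta_mx ord0 (lift ord0 j).
Proof.
apply/rowP => i; rewrite rV_deltaE; have [k ->|->] := unliftP ord0 i.
  by rewrite rV_consES rV_deltaE (inj_eq lift_inj).
by rewrite rV_consE0 (negbTE (neq_lift _ _)).
Qed.

Lemma continuous_slice0 u v : continuous u -> continuous (fun a => u (rV_cons (a, v))).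
Proof.
move=> cu a; apply: (@continuous_comp _ _ _ (fun a => rV_cons (a, v)) u); last exact: cu.
have -> : (fun a => rV_cons (a, v)) =
    fun b : R => b *: delta_mx ord0 ord0 + rV_cons (0, v); last first.
  by apply: cvgD; [apply: cvgZr_tmp; exact: cvg_id|exact: cvg_cst].
by apply/funext => b; rewrite -rV_cons_shift0 addr0.
Qed.

Lemma continuous_sliceS u a : continuous u -> continuous (fun v => u (rV_cons (a, v))).
Proof.
move=> cu v; apply: (@continuous_comp _ _ _ (fun v => rV_cons (a, v)) u); last exact: cu.
move=> A /nbhs_ballP[e /= e0 eA]; apply/nbhs_ballP; exists e => // w [_ vw].
apply: eA; split=> // i j; rewrite (ord1 i); have [k ->|->] := unliftP ord0 j.
  by rewrite !rV_consES; exact: vw.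
by rewrite !rV_consE0; exact: ballxx.
Qed.

Lemma derive_slice0 u a v :
  'D_1 (fun a => u (rV_cons (a, v))) a = 'D_(delta_mx ord0 ord0) u (rV_cons (a, v)) /\
  (derivable (fun a => u (rV_cons (a, v))) a 1 <->
   derivable u (rV_cons (a, v)) (delta_mx ord0 ord0)).
Proof.
rewrite /derive /derivable.
rewrite [X in X @ _](_ : _ = (fun h : R =>
  h^-1 *: ((u \o shift (rV_cons (a, v))) (h *: delta_mx ord0 ord0) - u (rV_cons (a, v))))) //.
by apply/funext => h /=; rewrite -rV_cons_shift0 [h%:A]mulr1.
Qed.

Lemma derive_sliceS u a v j :
  'D_(delta_mx ord0 j) (fun v => u (rV_cons (a, v))) v =
    'D_(delta_mx ord0 (lift ord0 j)) u (rV_cons (a, v)) /\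
  (derivable (fun v => u (rV_cons (a, v))) v (delta_mx ord0 j) <->
   derivable u (rV_cons (a, v)) (delta_mx ord0 (lift ord0 j))).
Proof.
rewrite /derive /derivable.
rewrite [X in X @ _](_ : _ = (fun h : R =>
  h^-1 *: ((u \o shift (rV_cons (a, v))) (h *: delta_mx ord0 (lift ord0 j))
           - u (rV_cons (a, v))))) //.
by apply/funext => h /=; rewrite -rV_cons_delta -rV_cons_shiftS.
Qed.

End slices.

Lemma integral_derive1_bounded_support (R : realType) (g : R -> R) (B : R) :
  (forall a, derivable g a 1) -> continuous ('D_1 g) ->
  (forall a, g a != 0 -> `|a| <= B) ->
  (\int[@lebesgue_measure R]_a ('D_1 g a)%:E = 0)%E.
Proof.
move=> dg cg gB.
have g0 a : B < `|a| -> g a = 0.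
  by move=> Ba; apply/eqP; apply: contraTT Ba => /gB; rewrite -leNgt.
have dg0 a : B < `|a| -> 'D_1 g a = 0.
  move=> Ba; rewrite (@near_eq_derive _ _ _ g (cst 0)) ?derive_cst ?oner_neq0//.
  near=> b; rewrite /cst; apply: g0.
  near: b; have := @norm_continuous _ R^o a; move=> /(_ [set t | B < t]) h.
  exact: h (lt_nbhsr Ba).
(* Positive and larger than B whatever the sign of B, so that g vanishes at both end points of
   [-C, C] and its derivative vanishes outside. *)
pose C : R := `|B| + 1.
have BC : B < C by rewrite (le_lt_trans (ler_norm _))// ltrDl.
have C0 : 0 < C by rewrite ltr_wpDl.
transitivity (\int[@lebesgue_measure R]_(a in `[(- C)%R, C]) ('D_1 g a)%:E)%E.
  rewrite [RHS]integral_mkcond/=; apply: eq_integral => a _.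
  rewrite patchE; case: ifPn => // /negP aC; rewrite dg0//.
  rewrite ltNge; apply/negP => aB; apply: aC; rewrite inE/= in_itv/= -ler_norml.
  by rewrite (le_trans aB)// ltW.
rewrite (@continuous_FTC2 _ _ g).
- by rewrite !g0 ?subee// ?normrN gtr0_norm.
- lra.
- exact: continuous_subspaceT.
- have cg' a : {for a, continuous g} by apply: differentiable_continuous; apply/derivable1_diffP.
  split.
  + by move=> a _.
  + by apply: cvg_at_right_filter; exact: cg'.
  + by apply: cvg_at_left_filter; exact: cg'.
- by move=> a _; rewrite derive1E.
Unshelve. all: by end_near. Qed.

(** Induction on the dimension by Fubini: a derivative along a later coordinate is one of the slice
    with the first coordinate frozen, and the derivative along the first is the one-dimensional
    case. *)
Lemma integral_derive_bounded_support (R : realType) n (u : 'rV[R]_n -> R) (j : 'I_n) :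
  is_Ck 1 u -> bounded_support u ->
  (\int[lebesgue_rV R n]_x ('D_(delta_mx ord0 j) u x)%:E = 0)%E.
Proof.
elim: n u j => [u []//|n IH u j [cu /= C1] su].
have [du cdu] := C1 j.
have idu : (lebesgue_rV R n.+1).-integrable setT (EFin \o 'D_(delta_mx ord0 j) u).
  by apply: integrable_continuous_bounded_support => //; exact: bounded_support_derive.
have [B uB] := su.
have [k jk|j0] := unliftP ord0 j.
  rewrite integral_rVS12//; apply: integral0_eq => a _.
  pose w v := u (rV_cons (a, v)).
  rewrite (eq_integral (fun v => ('D_(delta_mx ord0 k) w v)%:E)); last first.
    by move=> v _; rewrite jk -(derive_sliceS u a v k).1.
  apply: (IH w).
    split=> [|i]; first exact: continuous_sliceS.
    have [di cdi] := C1 (lift ord0 i); split=> [v|/=].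
      exact/(derive_sliceS u a v i).2.
    rewrite (_ : (fun v => _) = fun v => 'D_(delta_mx ord0 (lift ord0 i)) u (rV_cons (a, v))).
      exact: (@continuous_sliceS _ _ ('D_(delta_mx ord0 (lift ord0 i)) u)).
    by apply/funext => v; rewrite (derive_sliceS u a v i).1.
  by exists B => v /uB h i; have := h (lift ord0 i); rewrite rV_consES.
rewrite integral_rVS21//; apply: integral0_eq => v _.
rewrite (eq_integral (fun a : measurableTypeR R => 
    ('D_1 (fun b => u (rV_cons (b, v))) a)%:E)); last first.
  by move=> a _; rewrite j0 -(derive_slice0 u a v).1.
apply: (@integral_derive1_bounded_support _ _ B).
- by move=> a; apply/(derive_slice0 u a v).2; rewrite -j0.
- have -> : 'D_1 (fun b : R => u (rV_cons (b, v))) =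
      fun a => 'D_(delta_mx ord0 j) u (rV_cons (a, v)); last first.
    exact: (@continuous_slice0 _ _ ('D_(delta_mx ord0 j) u)).
  by apply/funext => a; rewrite (derive_slice0 u a v).1 j0.
- by move=> a /uB /(_ ord0); rewrite rV_consE0.
Qed.

Lemma derive_line (R : realType) (V : normedModType R) (u : V -> R) x v :
  'D_v u x = 'D_1 (fun h : R => u (h *: v + x)) 0.
Proof.
rewrite /derive [X in _ = lim (X @ _)](_ : _ =
  (fun h : R => h^-1 *: ((u \o shift x) (h *: v) - u x))) //.
by apply/funext => h /=; rewrite scale0r add0r addr0 [_%:A]mulr1.
Qed.

Lemma derivable_line (R : realType) (V : normedModType R) (u : V -> R) x v :
  derivable u x v <-> derivable (fun h : R => u (h *: v + x)) 0 1.
Proof.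
rewrite /derivable.
rewrite [X in _ <-> cvg (X @ _)](_ : _ =
  (fun h : R => h^-1 *: ((u \o shift x) (h *: v) - u x))) //.
by apply/funext => h /=; rewrite scale0r add0r addr0 [_%:A]mulr1.
Qed.

(** Restriction to the line x + h v reduces this to the chain rule in one variable, so derivability
    of s along v alone is enough; [is_Ck] speaks only of partial derivatives. *)
Lemma is_derive_comp_scalar (R : realType) (V : normedModType R) (s : V -> R)
    (psi : R -> R) x v (ds dpsi : R) :
  is_derive x v s ds -> is_derive (s x) (1 : R) psi dpsi ->
  is_derive x v (fun y => psi (s y)) (dpsi * ds).
Proof.
move=> hs hpsi.
have h0 : is_derive (0 : R) 1 (fun h : R => s (h *: v + x)) ds.
  split; first exact: (@derivable_line R V s x v).1 (@ex_derive _ _ _ _ _ _ _ hs).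
  by rewrite -derive_line derive_val.
have hpsi' : is_derive ((fun h : R => s (h *: v + x)) 0) (1 : R) psi dpsi.
  by rewrite scale0r add0r.
have hc := is_derive1_comp hpsi' h0.
split; first by apply/derivable_line; have := @ex_derive _ _ _ _ _ _ _ hc.
by rewrite derive_line; exact: derive_val.
Qed.

(** * Functions of class C^k on R^n and their partial derivatives *)

Section Ck.
Context (R : realType) (n : nat).
Implicit Types (x : 'rV[R]_n) (u v : 'rV[R]_n -> R) (i j : 'I_n) (k : nat).

Definition dpart j u := 'D_(delta_mx ord0 j : 'rV[R]_n) u.

Lemma CkS k u : is_Ck k.+1 u <-> continuous u /\
  forall j, (forall x, derivable u x (delta_mx ord0 j)) /\ is_Ck k (dpart j u).
Proof. by []. Qed.

Lemma Ck_continuous k u : is_Ck k u -> continuous u.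
Proof. by case: k => //= k []. Qed.

Lemma Ck_weaken k u : is_Ck k.+1 u -> is_Ck k u.
Proof.
elim: k u => [|k IH] u; first by case.
move=> /CkS[cu hu]; apply/CkS; split=> // j; have [du cdu] := hu j.
by split=> //; exact: IH.
Qed.

Lemma Ck_derivable k u x j : is_Ck k.+1 u -> derivable u x (delta_mx ord0 j).
Proof. by move=> /CkS[_ /(_ j)[]]. Qed.

Lemma Ck_is_derive k u x j : is_Ck k.+1 u ->
  is_derive x (delta_mx ord0 j) u (dpart j u x).
Proof. by move=> /Ck_derivable h; exact/derivableP. Qed.

Lemma Ck_dpart k u j : is_Ck k.+1 u -> is_Ck k (dpart j u).
Proof. by move=> /CkS[_ /(_ j)[]]. Qed.

Lemma Ck_intro k u (du : 'I_n -> 'rV[R]_n -> R) : continuous u ->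
  (forall j x, is_derive x (delta_mx ord0 j) u (du j x)) ->
  (forall j, is_Ck k (du j)) -> is_Ck k.+1 u.
Proof.
move=> cu hd hk; apply/CkS; split => // j; split; first by move=> x; case: (hd j x).
rewrite (_ : dpart j u = du j)//; apply/funext => x.
by rewrite /dpart; exact: derive_val.
Qed.

Lemma dpart_val u j x d : is_derive x (delta_mx ord0 j) u d -> dpart j u x = d.
Proof. by move=> h; rewrite /dpart; exact: derive_val. Qed.

Lemma Ck_cst k (c : R) : is_Ck k (fun _ : 'rV[R]_n => c).
Proof.
elim: k c => [|k IH] c; first exact: cst_continuous.
have h (j : 'I_n) (x : 'rV[R]_n) : is_derive x (delta_mx ord0 j) (fun _ : 'rV[R]_n => c) 0.
  exact: is_derive_cst.
apply: (Ck_intro _ h); first exact: cst_continuous.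
by move=> j; exact: IH.
Qed.

Lemma is_derive_coord i j x :
  is_derive x (delta_mx ord0 j) (fun y : 'rV[R]_n => y ord0 i) (i == j)%:R.
Proof.
have h : is_derive (0 : R) (1 : R) (fun h : R => h * (i == j)%:R + x ord0 i) (i == j)%:R.
  by apply: is_derive_eq; rewrite scaler0 add0r addr0 [LHS]mulr1.
have E : (fun t : R => (t *: (delta_mx ord0 j : 'rV[R]_n) + x) ord0 i) =
    (fun h : R => h * (i == j)%:R + x ord0 i).
  by apply/funext => t; rewrite rVDE rVZE rV_deltaE.
split; first by apply/derivable_line; rewrite E; exact: ex_derive.
by rewrite derive_line E; exact: derive_val.
Qed.

Lemma Ck_coord k i : is_Ck k (fun x : 'rV[R]_n => x ord0 i).
Proof.
case: k => [|k]; first exact: coord_continuous.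
apply: (@Ck_intro _ _ (fun j _ => (i == j)%:R)) => [|j x|j].
- exact: coord_continuous.
- exact: is_derive_coord.
- exact: Ck_cst.
Qed.

Lemma continuous_rV_add u v : continuous u -> continuous v -> continuous (fun x => u x + v x).
Proof. by move=> cu cv x; exact: (cvgD (cu x) (cv x)). Qed.

Lemma continuous_rV_mul u v : continuous u -> continuous v -> continuous (fun x => u x * v x).
Proof. by move=> cu cv x; exact: (cvgM (cu x) (cv x)). Qed.

Lemma Ck_add k u v : is_Ck k u -> is_Ck k v -> is_Ck k (fun x => u x + v x).
Proof.
elim: k u v => [|k IH] u v cu cv; first exact: continuous_rV_add.
apply: (@Ck_intro _ _ (fun j x => dpart j u x + dpart j v x)) => [x|j x|j].
- exact: (continuous_rV_add (Ck_continuous cu) (Ck_continuous cv)).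
- by apply: is_deriveD; apply: Ck_is_derive; eassumption.
- by apply: IH; exact: Ck_dpart.
Qed.

Lemma Ck_mul k u v : is_Ck k u -> is_Ck k v -> is_Ck k (fun x => u x * v x).
Proof.
elim: k u v => [|k IH] u v cu cv; first exact: continuous_rV_mul.
apply: (@Ck_intro _ _ (fun j x => u x * dpart j v x + v x * dpart j u x)) => [x|j x|j].
- exact: (continuous_rV_mul (Ck_continuous cu) (Ck_continuous cv)).
- by apply: is_deriveM; apply: Ck_is_derive; eassumption.
- by apply: Ck_add; apply: IH => //;
    [exact: Ck_weaken|exact: Ck_dpart|exact: Ck_weaken|exact: Ck_dpart].
Qed.

Lemma Ck_opp k u : is_Ck k u -> is_Ck k (fun x => - u x).
Proof.
move=> cu; rewrite (_ : (fun x => - u x) = (fun x => (-1) * u x)).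
  by apply: Ck_mul => //; exact: Ck_cst.
by apply/funext => x; rewrite mulN1r.
Qed.

Lemma Ck_sum k (I : Type) (r : seq I) (P : pred I) (F : I -> 'rV[R]_n -> R) :
  (forall a, is_Ck k (F a)) -> is_Ck k (fun x => \sum_(a <- r | P a) F a x).
Proof.
move=> cF; elim: r => [|a r IH].
  by rewrite (_ : (fun x => _) = fun=> 0) //; [exact: Ck_cst|apply/funext => x; rewrite big_nil].
rewrite (_ : (fun x => _) = fun x => (if P a then F a x else 0) + \sum_(a <- r | P a) F a x).
  by apply: Ck_add => //; case: (P a) => //; exact: Ck_cst.
by apply/funext => x; rewrite big_cons; case: ifP => // _; rewrite add0r.
Qed.

Lemma Ck_exp k u m : is_Ck k u -> is_Ck k (fun x => u x ^+ m).
Proof.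
move=> cu; elim: m => [|m IH]; first by exact: Ck_cst.
by under eq_fun do rewrite exprS; exact: Ck_mul.
Qed.

Definition nsq x : R := \sum_(i < n) x ord0 i ^+ 2.

Lemma Ck_nsq k : is_Ck k nsq.
Proof. by apply: Ck_sum => i; apply: Ck_exp; exact: Ck_coord. Qed.

Lemma dpart_mul u v j x : is_Ck 1 u -> is_Ck 1 v ->
  dpart j (fun y => u y * v y) x = u x * dpart j v x + v x * dpart j u x.
Proof.
by move=> cu cv; apply: dpart_val; apply: is_deriveM; apply: Ck_is_derive; eassumption.
Qed.

Lemma dpart_add u v j x : is_Ck 1 u -> is_Ck 1 v ->
  dpart j (fun y => u y + v y) x = dpart j u x + dpart j v x.
Proof.
by move=> cu cv; apply: dpart_val; apply: is_deriveD; apply: Ck_is_derive; eassumption.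
Qed.

Lemma dpart_opp u j x : is_Ck 1 u -> dpart j (fun y => - u y) x = - dpart j u x.
Proof.
by move=> cu; apply: dpart_val; apply: is_deriveN; apply: Ck_is_derive; eassumption.
Qed.

Lemma dpart_cst c j x : dpart j (fun=> c) x = 0.
Proof. by apply: dpart_val; exact: is_derive_cst. Qed.

Lemma dpart_coord i j x : dpart j (fun y => y ord0 i) x = (i == j)%:R.
Proof. by apply: dpart_val; exact: is_derive_coord. Qed.

Lemma dpart_sum (I : Type) (r : seq I) (F : I -> 'rV[R]_n -> R) j x :
  (forall a, is_Ck 1 (F a)) ->
  dpart j (fun y => \sum_(a <- r) F a y) x = \sum_(a <- r) dpart j (F a) x.
Proof.
move=> cF; elim: r => [|a r IH].
  by rewrite (_ : (fun x => _) = fun=> 0) ?dpart_cst ?big_nil//;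
     apply/funext => y; rewrite big_nil.
rewrite big_cons -IH -dpart_add//; last exact: Ck_sum.
by congr (dpart _ _ _); apply/funext => y; rewrite big_cons.
Qed.

Lemma is_derive_nsq x j : is_derive x (delta_mx ord0 j) nsq (2 * x ord0 j).
Proof.
have := Ck_is_derive x j (Ck_nsq 1); congr (is_derive _ _ _ _).
rewrite dpart_sum; last by move=> i; apply: Ck_exp; exact: Ck_coord.
rewrite (bigD1 j)//= big1 ?addr0 => [|i ij].
  under eq_fun do rewrite expr2.
  by rewrite dpart_mul; [rewrite dpart_coord eqxx mulr1; ring|exact: Ck_coord|exact: Ck_coord].
under eq_fun do rewrite expr2.
by rewrite dpart_mul; [rewrite dpart_coord (negbTE ij) mulr0 addr0|exact: Ck_coord|exact: Ck_coord].
Qed.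

Lemma dpart_nsq j x : dpart j nsq x = 2 * x ord0 j.
Proof. exact/dpart_val/is_derive_nsq. Qed.

Lemma Ck1_comp_nsq (psi dpsi : R -> R) :
  (forall t : R, is_derive t (1 : R) psi (dpsi t)) -> continuous dpsi ->
  is_Ck 1 (fun x => psi (nsq x)) /\
  forall j x, dpart j (fun x => psi (nsq x)) x = 2 * x ord0 j * dpsi (nsq x).
Proof.
move=> hpsi cdpsi.
have D j x : is_derive x (delta_mx ord0 j) (fun x => psi (nsq x)) (2 * x ord0 j * dpsi (nsq x)).
  by rewrite mulrC; apply: is_derive_comp_scalar; exact: is_derive_nsq.
have cpsi : continuous psi.
  by move=> t; apply: differentiable_continuous; apply/derivable1_diffP; exact: ex_derive.
have cn := Ck_continuous (Ck_nsq 0).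
split; last by move=> j x; exact/dpart_val.
apply: (@Ck_intro _ _ (fun j x => 2 * x ord0 j * dpsi (nsq x))) => //.
  by move=> x; apply: continuous_comp; [exact: cn|exact: cpsi].
move=> j; apply: Ck_mul; first by apply: Ck_mul; [exact: Ck_cst|exact: Ck_coord].
by move=> x; apply: continuous_comp; [exact: cn|exact: cdpsi].
Qed.

End Ck.

Lemma Rintegral_sum d (T : measurableType d) (R : realType)
    (mu : {measure set T -> \bar R}) (I : Type) (r : seq I) (F : I -> T -> R) :
  (forall i, mu.-integrable setT (EFin \o F i)) ->
  mu.-integrable setT (EFin \o (fun x => \sum_(i <- r) F i x)) /\
  \int[mu]_x (\sum_(i <- r) F i x) = \sum_(i <- r) \int[mu]_x F i x.
Proof.
move=> iF; elim: r => [|a r [IHi IH]].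
  under eq_Rintegral do rewrite big_nil.
  rewrite big_nil (_ : (EFin \o _) = cst 0%E); last first.
    by apply/funext => x /=; rewrite big_nil.
  by split; [exact: integrable0|rewrite /Rintegral integral0].
rewrite (_ : (EFin \o _) = ((EFin \o F a) \+ 
    (EFin \o (fun x => (\sum_(i <- r) F i x)%R)))%E); last first.
  by apply/funext => x /=; rewrite big_cons.
split; first exact: integrableD.
under eq_Rintegral do rewrite big_cons.
by rewrite RintegralD// big_cons IH.
Qed.

(** * The tangential operators *)

Section tangential.
Context (R : realType) (n : nat).
Local Notation mu := (lebesgue_rV R n).
Implicit Types (x : 'rV[R]_n) (u v : 'rV[R]_n -> R) (i j : 'I_n) (k : nat).

Lemma nsq_ge0 x : 0 <= nsq x.
Proof. by apply: sumr_ge0 => i _; exact: sqr_ge0. Qed.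

Lemma sqr_le_nsq x i : x ord0 i ^+ 2 <= nsq x.
Proof.
by rewrite /nsq (bigD1 i)//= lerDl; apply: sumr_ge0 => k _; exact: sqr_ge0.
Qed.

Lemma nsq_eq0 x : (nsq x == 0) = (x == 0).
Proof.
apply/idP/eqP => [/eqP x0|->]; last first.
  by rewrite /nsq big1// => i _; rewrite mxE expr0n.
apply/rowP => i; apply/eqP; rewrite mxE -sqrf_eq0 eq_le sqr_ge0 andbT -x0.
exact: sqr_le_nsq.
Qed.

Lemma nsq_gt0 x : (0 < nsq x) = (x != 0).
Proof. by rewrite lt0r nsq_ge0 andbT nsq_eq0. Qed.

Lemma nsq_le_cube (c : R) x : nsq x <= c -> cube (c + 1) x.
Proof.
move=> xc i; have := le_trans (sqr_le_nsq x i) xc.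
rewrite -real_normK ?num_real//; move: (normr_ge0 (x ord0 i)).
move: (`|x ord0 i|) => a a0 ac; rewrite leNgt; apply/negP => h; nra.
Qed.

Lemma bounded_support_nsq (g : R -> R) (c : R) u : (forall t, c < t -> g t = 0) ->
  bounded_support (fun x => g (nsq x) * u x).
Proof.
move=> g0; exists (c + 1) => x gu; apply: nsq_le_cube; rewrite leNgt.
by apply/negP => /g0 E; move: gu; rewrite E mul0r eqxx.
Qed.

(** The Euler operator x . grad, that is |x| times the radial derivative. *)
Definition euler u x := \sum_(i < n) x ord0 i * dpart i u x.

(* |x|^2 times the derivative L_j *)
Definition Nop j u x := nsq x * dpart j u x - x ord0 j * euler u x.

(** This is |x|^2 times the Laplace-Beltrami operator of the unit sphere, acting on the angular
    variable. *)
Definition Wop u x := \sum_(j < n) Nop j (Nop j u) x.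

Lemma Ck_euler k u : is_Ck k.+1 u -> is_Ck k (euler u).
Proof.
by move=> cu; apply: Ck_sum => i; apply: Ck_mul; [exact: Ck_coord|exact: Ck_dpart].
Qed.

Lemma Ck_Nop k u j : is_Ck k.+1 u -> is_Ck k (Nop j u).
Proof.
move=> cu; apply: Ck_add.
  by apply: Ck_mul; [exact: Ck_nsq|exact: Ck_dpart].
by apply: Ck_opp; apply: Ck_mul; [exact: Ck_coord|exact: Ck_euler].
Qed.

Lemma Ck_Wop k u : is_Ck k.+2 u -> is_Ck k (Wop u).
Proof. by move=> cu; apply: Ck_sum => j; do 2 apply: Ck_Nop. Qed.

(** The vector of the N_j u is orthogonal to x. This cancels the zero-order terms (n - 1) x_j that
    each single N_j leaves in an integration by parts. *)
Lemma sum_coord_Nop u x : \sum_(j < n) x ord0 j * Nop j u x = 0.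
Proof.
rewrite (eq_bigr (fun j => nsq x * (x ord0 j * dpart j u x) - x ord0 j ^+ 2 * euler u x)).
  by rewrite sumrB -mulr_sumr -mulr_suml subrr.
by move=> j _; rewrite /Nop; ring.
Qed.

Lemma Nop_mul u v j x : is_Ck 1 u -> is_Ck 1 v ->
  Nop j (fun y => u y * v y) x = u x * Nop j v x + v x * Nop j u x.
Proof.
move=> cu cv; rewrite /Nop (dpart_mul j x cu cv).
have -> : euler (fun y => u y * v y) x = u x * euler v x + v x * euler u x.
  rewrite /euler !mulr_sumr -big_split/=; apply: eq_bigr => i _.
  by rewrite (dpart_mul i x cu cv); ring.
ring.
Qed.

(** The integrand is the divergence d_j(psi |x|^2 u) - sum_i d_i(psi x_i x_j u), with psi taken at
    |x|^2: the terms in psi' cancel, N_j being tangent to the spheres, and the derivatives of the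
    coefficients add up to -(n - 1) x_j. *)
Lemma ibp_C1 u j (psi dpsi : R -> R) (c : R) : is_Ck 1 u ->
  (forall t : R, is_derive t (1 : R) psi (dpsi t)) -> continuous dpsi ->
  (forall t, c < t -> psi t = 0) ->
  \int[mu]_x (psi (nsq x) * (Nop j u x - (n%:R - 1) * x ord0 j * u x)) = 0.
Proof.
move=> cu hpsi cdpsi psi0.
have [cpsi dpsiE] := @Ck1_comp_nsq R n psi dpsi hpsi cdpsi.
pose w0 x := psi (nsq x) * (nsq x * u x).
pose w i x := psi (nsq x) * (x ord0 i * (x ord0 j * u x)).
have cnu := Ck_mul (Ck_nsq R n 1) cu.
have cx i : is_Ck 1 (fun x : 'rV[R]_n => x ord0 i) := Ck_coord R 1 i.
have cxxu i := Ck_mul (cx i) (Ck_mul (cx j) cu).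
have cw0 : is_Ck 1 w0 := Ck_mul cpsi cnu.
have cw i : is_Ck 1 (w i) := Ck_mul cpsi (cxxu i).
have sw0 : bounded_support w0 by exact: bounded_support_nsq psi0.
have sw i : bounded_support (w i) by exact: bounded_support_nsq psi0.
have E x : psi (nsq x) * (Nop j u x - (n%:R - 1) * x ord0 j * u x) =
    dpart j w0 x - \sum_(i < n) dpart i (w i) x.
  have w0E : dpart j w0 x = psi (nsq x) * (nsq x * dpart j u x + u x * (2 * x ord0 j))
       + (nsq x * u x) * (2 * x ord0 j * dpsi (nsq x)).
    rewrite (dpart_mul j x cpsi cnu) dpsiE (dpart_mul j x (Ck_nsq R n 1) cu).
    by rewrite dpart_nsq.
  have wE i : dpart i (w i) x = psi (nsq x) * (x ord0 j * (x ord0 i * dpart i u x))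
        + psi (nsq x) * (x ord0 i * u x * (j == i)%:R) + psi (nsq x) * (x ord0 j * u x) +
        (2 * (x ord0 j * u x) * dpsi (nsq x)) * x ord0 i ^+ 2.
    rewrite (dpart_mul i x cpsi (cxxu i)) dpsiE.
    rewrite (dpart_mul i x (cx i) (Ck_mul (cx j) cu)) (dpart_mul i x (cx j) cu).
    by rewrite !dpart_coord eqxx mulr1; ring.
  under eq_bigr do rewrite wE.
  rewrite !big_split/= -!mulr_sumr -/(euler u x) -/(nsq x) w0E.
  rewrite (bigD1 j)//= big1 ?eqxx => [|i /negbTE ij]; last by rewrite eq_sym ij mulr0.
  rewrite (_ : \sum_(i < n) u x = n%:R * u x); last by rewrite sumr_const card_ord mulr_natl.
  by rewrite /Nop mulr1; ring.
under eq_Rintegral do rewrite E.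
have idp (i : 'I_n) v : is_Ck 1 v -> bounded_support v ->
    mu.-integrable setT (EFin \o dpart i v) /\ \int[mu]_x dpart i v x = 0.
  move=> cv sv; split; last first.
    by rewrite /Rintegral integral_derive_bounded_support.
  apply: integrable_continuous_bounded_support; last exact: bounded_support_derive.
  exact: (Ck_continuous (Ck_dpart i cv)).
have [is0 s0] := Rintegral_sum (index_enum 'I_n) (fun i => (idp i _ (cw i) (sw i)).1).
rewrite RintegralB//; last exact: (idp _ _ cw0 sw0).1.
by rewrite (idp _ _ cw0 sw0).2 s0 big1 ?subr0// => i _; exact: (idp _ _ (cw i) (sw i)).2.
Qed.

End tangential.

Lemma Rintegral_dominated_cvg d (T : measurableType d) (R : realType)
    (mu : {measure set T -> \bar R}) (f_ : (T -> R)^nat) (f g : T -> R) :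
  (forall m, measurable_fun setT (f_ m)) ->
  (forall x, f_ ^~ x @ \oo --> f x) ->
  mu.-integrable setT (EFin \o g) -> (forall m x, `|f_ m x| <= g x) ->
  mu.-integrable setT (EFin \o f) /\
  (\int[mu]_x f_ m x) @[m --> \oo] --> \int[mu]_x f x.
Proof.
move=> mf_ f_f ig fg.
have mf : measurable_fun setT f by apply: measurable_fun_cvg => // x _; exact: f_f.
have f_fE x : EFin \o f_ ^~ x @ \oo --> (f x)%:E.
  by apply: cvg_EFin; [exact: nearW|exact: f_f].
have [ifx _ cv] := @dominated_convergence _ _ _ mu setT measurableT
  (fun m => EFin \o f_ m) (EFin \o f) (EFin \o g)
  (fun m => (measurable_EFinP _ _).2 (mf_ m)) ((measurable_EFinP _ _).2 mf)
  (aeW _ (fun x _ => f_fE x))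
  ig (aeW _ (fun x m _ => fg m x)).
split => //; apply: fine_cvg; rewrite /Rintegral fineK; first exact: cv.
exact: integrable_fin_num.
Qed.

Lemma Rintegral_lim_eq0 d (T : measurableType d) (R : realType)
    (mu : {measure set T -> \bar R}) (f_ : (T -> R)^nat) (f g : T -> R) :
  (forall m, measurable_fun setT (f_ m)) ->
  (forall x, f_ ^~ x @ \oo --> f x) ->
  mu.-integrable setT (EFin \o g) -> (forall m x, `|f_ m x| <= g x) ->
  (forall m, \int[mu]_x f_ m x = 0) -> \int[mu]_x f x = 0.
Proof.
move=> mf_ f_f ig fg f0; have [_ cv] := Rintegral_dominated_cvg mf_ f_f ig fg.
apply: cvg_unique cv _ => //.
by rewrite (_ : (fun m => _) = cst 0); [exact: cvg_cst|exact/funext].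
Qed.

(** * From half-lines to bounded measurable functions of s *)

Section pi_lambda.
Import HBNNSimple.
Context d (T : measurableType d) (R : realType) (mu : {measure set T -> \bar R}).
Variables (s : T -> R) (H : T -> R).
Hypotheses (ms : measurable_fun setT s) (iH : mu.-integrable setT (EFin \o H)).

Let mH : measurable_fun setT H.
Proof. exact/measurable_EFinP/(measurable_int _ iH). Qed.

Lemma integrable_bounded_mul (g : T -> R) (M : R) : measurable_fun setT g ->
  (forall x, `|g x| <= M) -> mu.-integrable setT (EFin \o (fun x => g x * H x)).
Proof.
move=> mg gM; apply: (@le_integrable _ _ _ mu setT measurableT _ (EFin \o (fun x => M * H x))).
- by apply/measurable_EFinP; exact: measurable_funM.
- move=> x _ /=; rewrite lee_fin !normrM ler_wpM2r// (le_trans (gM x))//.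
  exact: ler_norm.
- by have := @integrableZl _ _ _ mu setT measurableT M _ iH.
Qed.

Let indic_norm_le1 (A : set R) t : `|\1_A t| <= 1 :> R.
Proof. by rewrite indicE; case: (_ \in _); rewrite ?normr1 ?normr0. Qed.

Let mindic (A : set R) : measurable A -> measurable_fun setT (fun x => \1_A (s x) : R).
Proof. by move=> mA; apply: measurableT_comp => //; exact: measurable_indic. Qed.

Hypothesis H0 : forall c, \int[mu]_x (\1_`]-oo, c[ (s x) * H x) = 0.

(** The sets A with this property form a lambda-system. It contains the half-lines ]-oo, c[, which
    are stable under intersection and generate the Borel sets. *)
Lemma integral_indic_eq0 (A : set R) : measurable A ->
  \int[mu]_x (\1_A (s x) * H x) = 0.
Proof.
pose L := [set A : set R | measurable A /\ \int[mu]_x (\1_A (s x) * H x) = 0].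
have limL (F : (set R)^nat) : nondecreasing_seq F -> (forall i, L (F i)) ->
    L (\bigcup_i F i).
  move=> ndF LF; split; first by apply: bigcupT_measurable => i; case: (LF i).
  apply: (@Rintegral_lim_eq0 _ _ _ mu (fun m x => \1_(F m) (s x) * H x) _ (fun x => `|H x|)).
  - by move=> m; exact: measurable_funM (mindic (LF m).1) mH.
  - move=> x; apply: cvgMl; have [[i _ Fi]|nF] := pselect ((\bigcup_i F i) (s x)).
      rewrite indicE mem_set; last by exists i.
      apply: cvg_near_cst; exists i => // m /= im; rewrite indicE mem_set//.
      by have /subsetPset := ndF _ _ im; exact.
    rewrite indicE memNset//; apply: cvg_near_cst; exists 0%N => // m _ /=.
    by rewrite indicE memNset// => Fm; apply: nF; exists m.
  - by have := integrable_abse iH.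
  - by move=> m x; rewrite normrM ler_piMl.
  - by move=> m; exact: (LF m).2.
have rayL c : L `]-oo, c[%classic by split.
(* The hypothesis covers half-lines only, so the whole line is reached as an increasing union of
   them. *)
have LT : L setT.
  rewrite (_ : setT = \bigcup_(k : nat) `]-oo, (k%:R : R)[%classic).
    apply: limL => [k l kl|k]; last exact: rayL.
    apply/subsetPset => t /=; rewrite !in_itv/= => /lt_le_trans; apply.
    by rewrite ler_nat.
  apply/esym; rewrite -subTset => t _.
  exists (Num.trunc `|t|).+1 => //=; rewrite in_itv/=.
  by rewrite (le_lt_trans (ler_norm _))// truncnS_gt.
have lamL : lambda_system setT L.
  split => //.
  move=> {}A B BA [mA LA] [mB LB]; split; first exact: measurableD.
  rewrite (_ : (fun x => _) = (fun x => \1_A (s x) * H x - \1_B (s x) * H x)).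
    rewrite RintegralB// ?LA ?LB ?subr0//.
      exact: integrable_bounded_mul (mindic mA) (fun x => indic_norm_le1 A (s x)).
    exact: integrable_bounded_mul (mindic mB) (fun x => indic_norm_le1 B (s x)).
  apply/funext => x; rewrite -mulrBl; congr (_ * _); rewrite !indicE in_setD.
  have [Bx|Bx] := boolP (s x \in B); last by rewrite andbT subr0.
  by rewrite (mem_set (BA _ (set_mem Bx))) subrr.
move=> mA; suff [] : L A by [].
have : <<s @RGenInftyO.G R >> A by rewrite -[X in X A]RGenInftyO.measurableE.
apply: (lambda_system_subset _ lamL) => //.
- move=> _ _ [a ->] [b ->]; exists (Num.min a b).
  by apply/seteqP; split=> t /=; rewrite !in_itv/= lt_min => /andP.
- by move=> _ [c ->].
Qed.

(** Linearity passes from indicators to simple functions, and dominated convergence, with bound M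
    |H|, from these to phi. *)
Lemma integral_bounded_comp_eq0 (phi : R -> R) (M : R) : measurable_fun setT phi ->
  (forall t, `|phi t| <= M) -> \int[mu]_x (phi (s x) * H x) = 0.
Proof.
(* The approximation by simple functions is for nonnegative phi. Adding M achieves this, and the
   constant M subtracted afterwards is itself a nonnegative case. *)
wlog phi0 : phi M / forall t, 0 <= phi t.
  move=> h mphi phiM.
  have M0 : 0 <= M by exact: le_trans (normr_ge0 _) (phiM 0).
  have m1 : measurable_fun setT (fun t => phi t + M) by exact: measurable_funD.
  have b1 t : `|phi t + M| <= M + M.
    by rewrite (le_trans (ler_normD _ _))// lerD// ger0_norm.
  have p1 t : 0 <= phi t + M by have := phiM t; rewrite ler_norml => /andP[+ _]; lra.
  have h1 := h _ _ p1 m1 b1.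
  have h2 : \int[mu]_x (M * H x) = 0.
    by apply: (h (cst M) M) => // t; rewrite /cst ger0_norm.
  rewrite (_ : (fun x => _) = (fun x => (phi (s x) + M) * H x - M * H x)).
    rewrite RintegralB ?h1 ?h2 ?subr0//.
    - apply: (@integrable_bounded_mul (fun x => phi (s x) + M) (M + M)) => //.
      exact: (measurableT_comp m1 ms).
    - by apply: (@integrable_bounded_mul (cst M) M) => // x; rewrite /cst ger0_norm.
  by apply/funext => x; rewrite -mulrBl addrK.
move=> mphi phiM.
pose a0 := nnsfun_approx measurableT ((measurable_EFinP _ _).2 mphi).
pose a m : R -> R := a0 m.
have acv t : (fun m => a m t) @ \oo --> phi t.
  have h : EFin \o (fun m => a m t) @ \oo --> (phi t)%:E.
    by apply: (cvg_nnsfun_approx measurableT) => // y _; rewrite lee_fin.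
  exact: (fine_cvg h).
have nda t : nondecreasing_seq (fun m => a m t).
  move=> k l kl.
  by have /lefP := nd_nnsfun_approx measurableT ((measurable_EFinP _ _).2 mphi) kl; apply.
have a_le m t : `|a m t| <= M.
  rewrite ger0_norm//; apply: le_trans (le_trans (ler_norm _) (phiM t)).
  rewrite -(cvg_lim _ (acv t))//; apply: nondecreasing_cvgn_le => //.
  by apply/cvg_ex; exists (phi t).
have ma m : measurable_fun setT (fun x => a m (s x)) by exact: measurableT_comp.
apply: (@Rintegral_lim_eq0 _ _ _ mu (fun m x => a m (s x) * H x) _ (fun x => M * `|H x|)).
- by move=> m; exact: measurable_funM (ma m) mH.
- by move=> x; apply: cvgMl; exact: acv.
- by have := @integrableZl _ _ _ mu setT measurableT M _ (integrable_abse iH).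
- by move=> m x; rewrite normrM ler_wpM2r.
- move=> m.
  transitivity (\int[mu]_x (\sum_(y <- finmap.enum_fset (fset_set (range (a m))))
      y * (\1_(a m @^-1` [set y]) (s x) * H x))).
    apply: eq_Rintegral => x _; rewrite /a fimfunE fsbig_finite//= mulr_suml.
    by apply: eq_bigr => y _; rewrite mulrA.
  have mA y : measurable (a m @^-1` [set y]) by exact: measurable_sfunP.
  have i1 y := integrable_bounded_mul (mindic (mA y)) (fun x => indic_norm_le1 _ (s x)).
  rewrite (Rintegral_sum _ _).2 => [|y].
    apply: big1_seq => y _.
    by rewrite RintegralZl// integral_indic_eq0 ?mulr0.
  by have := @integrableZl _ _ _ mu setT measurableT y _ (i1 y).
Qed.

End pi_lambda.

(** * A step function of class C^1 *)

Section smooth_step.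
Context (R : realType).
Implicit Types (t c : R).

Let pos t : R := Num.max t 0.

Let continuous_pos : continuous pos.
Proof. by move=> t; apply: continuous_max; [exact: cvg_id|exact: cvg_cst]. Qed.

Let is_derive_sqpos t : is_derive t (1 : R) (fun t => pos t ^+ 2) (2 * pos t).
Proof.
have [t0|t0|->] := ltgtP t 0.
- have h : is_derive t (1 : R) (cst 0 : R -> R) (2 * pos t).
    by rewrite /pos max_r ?ltW// mulr0; exact: is_derive_cst.
  apply: (near_eq_is_derive _ h).
  near=> s; rewrite /cst /pos max_r ?expr0n//; apply/ltW.
  by near: s; exact: lt_nbhsl.
- have h : is_derive t (1 : R) (fun s : R => s ^+ 2) (2 * pos t).
    apply: is_derive_eq; rewrite /pos max_l ?ltW//.
    by rewrite [_%:A]mulr1 mulr_natl mulr2n.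
  apply: (near_eq_is_derive _ h).
  near=> s; rewrite /pos max_l//; apply/ltW.
  by near: s; exact: lt_nbhsr.
- have p00 : pos 0 = 0 by rewrite /pos maxxx.
  rewrite p00 mulr0.
  (* The difference quotient at 0 is exactly [pos h]: it is h for h > 0 and 0 for h < 0. *)
  have L : (fun h : R => h^-1 *: (((fun t => pos t ^+ 2) \o shift 0) (h *: 1) - pos 0 ^+ 2))
      @ 0^' --> (0 : R).
    have p0 : pos x @[x --> (0 : R)^'] --> (0 : R).
      have := @continuous_pos 0; rewrite /continuous_at p00 => h; apply: cvg_trans h.
      by apply: cvg_app; exact: nbhs_dnbhs.
    apply: cvg_trans p0; apply: near_eq_cvg; near=> h.
    have h0 : h != 0 by near: h; exact: nbhs_dnbhs_neq.
    rewrite /= [h%:A]mulr1 addr0 p00 expr0n subr0 /pos.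
    have [hp|hn] := leP h 0; first by rewrite expr0n scaler0.
    by rewrite expr2 [RHS]mulrA mulVf// mul1r.
  by split; [apply/cvg_ex; exists 0; exact: L|exact: (cvg_lim _ L)].
Unshelve. all: by end_near. Qed.

(** A C^1 function that vanishes for t <= 0 and has values in [0, 1[, written rationally so that its
    derivative is explicit. Its dilations tend pointwise to the indicator of the open half-line t >
    0, the value at 0 staying 0. *)
Definition smooth_step t : R := 1 - (1 + pos t ^+ 2)^-1.

Definition dsmooth_step t : R := 2 * pos t / (1 + pos t ^+ 2) ^+ 2.

Let den_neq0 t : 1 + pos t ^+ 2 != 0.
Proof. by rewrite gt_eqF// ltr_wpDr// sqr_ge0. Qed.

Lemma is_derive_smooth_step t :
  is_derive t (1 : R) smooth_step (dsmooth_step t).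
Proof.
have h1 : is_derive t (1 : R) (fun s => 1 + pos s ^+ 2) (2 * pos t).
  have := is_deriveD (is_derive_cst (1 : R) t (1 : R)) (is_derive_sqpos t).
  by rewrite add0r.
have h2 : is_derive t (1 : R) (fun s => (1 + pos s ^+ 2)^-1)
    (- (1 + pos t ^+ 2) ^- 2 *: (2 * pos t)).
  split; first by apply: derivableV; [exact: den_neq0|exact: ex_derive].
  by rewrite deriveV ?den_neq0 ?derive_val//; exact: ex_derive.
have E : 0 - - (1 + pos t ^+ 2) ^- 2 *: (2 * pos t) = dsmooth_step t.
  by rewrite sub0r scaleNr opprK /dsmooth_step [RHS]mulrC.
by have := is_deriveB (is_derive_cst (1 : R) t (1 : R)) h2; rewrite E.
Qed.

Lemma continuous_dsmooth_step : continuous dsmooth_step.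
Proof.
move=> t; apply: cvgM.
  by apply: cvgM; [exact: cvg_cst|exact: continuous_pos].
apply: cvgV; first by rewrite expf_neq0.
have h : 1 + pos x ^+ 2 @[x --> t] --> 1 + pos t ^+ 2.
  by apply: cvgD; [exact: cvg_cst|apply: cvgM; exact: continuous_pos].
by apply: cvgM; exact: h.
Qed.

Lemma smooth_step_le0 t : t <= 0 -> smooth_step t = 0.
Proof. by move=> t0; rewrite /smooth_step /pos max_r// expr0n addr0 invr1 subrr. Qed.

Lemma smooth_step_le1 t : `|smooth_step t| <= 1.
Proof.
have h : 0 <= (1 + pos t ^+ 2)^-1 <= 1.
  by rewrite invr_ge0 invf_le1 ?lerDl ?sqr_ge0 ?addr_ge0 ?ltr_wpDr ?sqr_ge0.
by rewrite /smooth_step ger0_norm; lra.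
Qed.

Lemma cvg_smooth_step t :
  smooth_step (m.+1%:R * t) @[m --> \oo] --> (\1_`]0, +oo[ t : R).
Proof.
rewrite indicE; have [t0|t0] := ltP 0 t; last first.
  rewrite memNset; last by rewrite /= in_itv/= andbT ltNge t0.
  rewrite (_ : (fun m => _) = cst 0); first exact: cvg_cst.
  by apply/funext => m; rewrite smooth_step_le0// mulr_ge0_le0.
rewrite mem_set; last by rewrite /= in_itv/= andbT.
rewrite -[X in _ --> X]subr0; apply: cvgB; first exact: cvg_cst.
have ub : (t ^+ 2)^-1 * harmonic m @[m --> \oo] --> (0 : R).
  by rewrite -[X in _ --> X](mulr0 (t ^+ 2)^-1); apply: cvgMr; exact: cvg_harmonic.
apply: (squeeze_cvgr _ (cvg_cst 0) ub); apply: nearW => m.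
rewrite /pos max_l ?mulr_ge0 ?(ltW t0)//.
have m1 : 1 <= m.+1%:R :> R by rewrite ler1n.
rewrite invr_ge0 addr_ge0 ?sqr_ge0//= /harmonic -invfM lef_pV2 ?posrE.
- by rewrite exprMn mulrC ler_wpDl// ler_wpM2r ?sqr_ge0// expr2 ler_peMl// ler0n.
- by rewrite ltr_wpDr ?sqr_ge0.
- by rewrite mulr_gt0 ?exprn_gt0.
Qed.

End smooth_step.

(** * Integration by parts against measurable radial weights *)

Section radial_ibp.
Context (R : realType) (n : nat).
Local Notation mu := (lebesgue_rV R n).
Implicit Types (x : 'rV[R]_n) (u v G : 'rV[R]_n -> R) (i j : 'I_n).
Implicit Types (psi : R -> R) (c M : R).

(** Weights are evaluated at |x|^2. They carry no regularity, because they will absorb truncations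
    of the radial factors of the generators of H_k. *)
Definition radial_weight psi := [/\ measurable_fun setT psi,
  exists M, forall t, `|psi t| <= M & exists c, forall t, c < t -> psi t = 0].

Lemma measurable_nsq : measurable_fun setT (@nsq R n).
Proof. exact: (continuous_measurable_rV (Ck_continuous (Ck_nsq R n 0))). Qed.

Lemma integrable_radial psi G : radial_weight psi -> continuous G ->
  mu.-integrable setT (EFin \o (fun x => psi (nsq x) * G x)).
Proof.
move=> [mpsi [M psiM] [c psic]] cG.
have M0 : 0 <= M by exact: le_trans (normr_ge0 _) (psiM 0).
have [K K0 GK] := continuous_bounded_on_cube (c + 1) cG.
apply: (@integrable_bounded_support _ _ _ (M * K)).
- apply: measurable_funM; last exact: continuous_measurable_rV.
  exact: measurableT_comp mpsi measurable_nsq.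
- move=> x; have [xc|cx] := leP (nsq x) c; last by rewrite psic// mul0r normr0 mulr_ge0// ltW.
  by rewrite normrM ler_pM// GK//; exact: nsq_le_cube.
- exact: bounded_support_nsq psic.
Qed.

Lemma radial_weight_indic c : radial_weight (\1_`]-oo, c[ : R -> R).
Proof.
split; first exact: measurable_indic.
  by exists 1 => t; rewrite indicE; case: (_ \in _); rewrite ?normr1 ?normr0.
exists c => t ct; rewrite indicE memNset//= in_itv/=.
by apply/negP; rewrite -leNgt ltW.
Qed.

(** No derivative of the weight occurs in the identity, so it survives limits of weights: C^1 steps
    give half-lines, and half-lines give all bounded measurable functions of |x|^2. *)
Lemma ibp_radial u j psi : is_Ck 1 u -> radial_weight psi ->
  \int[mu]_x (psi (nsq x) * (Nop j u x - (n%:R - 1) * x ord0 j * u x)) = 0.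
Proof.
move=> cu wpsi; have [mpsi [M psiM] [c psic]] := wpsi.
pose G x := Nop j u x - (n%:R - 1) * x ord0 j * u x.
have cG : continuous G.
  apply: (@Ck_continuous _ _ 0); apply: Ck_add; first exact: Ck_Nop.
  apply: Ck_opp; apply: Ck_mul; last exact: (Ck_weaken cu).
  by apply: Ck_mul; [exact: Ck_cst|exact: Ck_coord].
(* The indicator of t < b is the limit of the C^1 weights smooth_step((m + 1)(b - t)), all supported
   in t <= b. *)
have key (b : R) : \int[mu]_x (\1_`]-oo, b[ (nsq x) * G x) = 0.
  apply: (@Rintegral_lim_eq0 _ _ _ mu
    (fun m x => smooth_step (m.+1%:R * (b - nsq x)) * G x) _
    (fun x => \1_`]-oo, b[ (nsq x) * `|G x|)).
  - move=> m; apply: measurable_funM; last exact: continuous_measurable_rV.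
    apply: (measurableT_comp (f := @smooth_step R)).
      apply: continuous_measurable_fun => t; apply: differentiable_continuous.
      by apply/derivable1_diffP; have := is_derive_smooth_step t; case.
    apply: measurable_funM => //; apply: measurable_funB => //; exact: measurable_nsq.
  - move=> x; apply: cvgMl; rewrite (_ : \1_ _ _ = \1_`]0, +oo[ (b - nsq x)).
      exact: cvg_smooth_step.
    rewrite !indicE; congr (_%:R); congr nat_of_bool.
    by apply/idP/idP => /set_mem; rewrite /= in_itv/= => h; apply/mem_set; rewrite /= in_itv/=; lra.
  - apply: integrable_radial; first exact: radial_weight_indic.
    by move=> x; apply: continuous_comp; [exact: cG|exact: norm_continuous].
  - move=> m x; rewrite normrM ler_wpM2r// indicE.
    have [xb|bx] := ltP (nsq x) b.
      by rewrite mem_set ?smooth_step_le1//= in_itv.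
    by rewrite smooth_step_le0 ?normr0// mulr_ge0_le0// subr_le0.
  - move=> m; apply: (@ibp_C1 _ _ _ _ (fun t => smooth_step (m.+1%:R * (b - t)))
      (fun t => - m.+1%:R * dsmooth_step (m.+1%:R * (b - t))) b cu).
    + move=> t.
      have h0 : is_derive t (1 : R) (fun t : R => m.+1%:R * (b - t)) (- m.+1%:R).
        have E : m.+1%:R *: (0 - 1 : R) = - m.+1%:R by rewrite sub0r scalerN [_%:A]mulr1.
        have := is_deriveZ (m.+1%:R) 
           (is_deriveB (is_derive_cst b t (1 : R)) (is_derive_id t (1 : R))).
         by rewrite E.
      rewrite mulrC.
      exact: (is_derive_comp_scalar h0 (is_derive_smooth_step _)).
    + move=> t; apply: cvgM; first exact: cvg_cst.
      apply: (@continuous_comp _ _ _ (fun t : R => m.+1%:R * (b - t)) (@dsmooth_step R));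
         last exact: continuous_dsmooth_step.
      by apply: cvgM; [exact: cvg_cst|apply: cvgB; [exact: cvg_cst|exact: cvg_id]].
    + by move=> t bt; rewrite smooth_step_le0// mulr_ge0_le0// subr_le0 ltW.
(* G itself need not be integrable. Cutting it off at |x|^2 < c + 1 makes it so and does not change
   its product with psi, which vanishes beyond c. *)
have iH : mu.-integrable setT (EFin \o (fun x => \1_`]-oo, c + 1[ (nsq x) * G x)).
  by apply: integrable_radial => //; exact: radial_weight_indic.
rewrite -[RHS](@integral_bounded_comp_eq0 _ _ _ mu _ _ measurable_nsq iH _ psi M mpsi psiM).
  apply: eq_Rintegral => x _; rewrite mulrA; congr (_ * _).
  have [xc|/psic->] := leP (nsq x) c; last by rewrite mul0r.
  by rewrite indicE mem_set ?mulr1//= in_itv/=; lra.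
(* The product of two half-line indicators is the indicator of the smaller half-line, to which [key]
   applies. *)
move=> b; rewrite -[RHS](key (Num.min b (c + 1))).
apply: eq_Rintegral => x _; rewrite mulrA; congr (_ * _).
rewrite !indicE -natrM mulnb; congr (_%:R); congr nat_of_bool.
apply/idP/idP.
  move=> /andP[/set_mem + /set_mem]; rewrite /= !in_itv/= => h1 h2.
  by apply/mem_set; rewrite /= in_itv/= lt_min h1.
by move=> /set_mem; rewrite /= in_itv/= lt_min => /andP[h1 h2]; apply/andP; split;
  apply/mem_set; rewrite /= in_itv.
Qed.

(** Apply [ibp_radial] to each product (N_j u) v, with N_j a derivation, and sum over j: the
    zero-order terms cancel by [sum_coord_Nop]. *)
Lemma Wop_ibp u v psi : is_Ck 2 u -> is_Ck 1 v -> radial_weight psi ->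
  \int[mu]_x (psi (nsq x) * (Wop u x * v x)) =
  - \int[mu]_x (psi (nsq x) * \sum_(j < n) Nop j u x * Nop j v x).
Proof.
move=> cu cv wpsi.
have cN j : is_Ck 1 (Nop j u) := Ck_Nop j cu.
have cNv j : is_Ck 1 (fun x => Nop j u x * v x) := Ck_mul (cN j) cv.
pose F j x := psi (nsq x) * (Nop j (fun x => Nop j u x * v x) x
   - (n%:R - 1) * x ord0 j * (Nop j u x * v x)).
have iF j : mu.-integrable setT (EFin \o F j).
  apply: integrable_radial => //; apply: (@Ck_continuous _ _ 0).
  apply: Ck_add; first exact: Ck_Nop.
  apply: Ck_opp; apply: Ck_mul; last exact: (Ck_weaken (cNv j)).
  by apply: Ck_mul; [exact: Ck_cst|exact: Ck_coord].
have iW : mu.-integrable setT (EFin \o (fun x => psi (nsq x) * (Wop u x * v x))).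
  apply: integrable_radial => //; apply: (@Ck_continuous _ _ 0).
  by apply: Ck_mul; [exact: Ck_Wop|exact: (Ck_weaken cv)].
have iS : mu.-integrable setT
    (EFin \o (fun x => psi (nsq x) * \sum_(j < n) Nop j u x * Nop j v x)).
  apply: integrable_radial => //; apply: (@Ck_continuous _ _ 0).
  by apply: Ck_sum => j; apply: Ck_mul; [exact: (Ck_weaken (cN j))|exact: Ck_Nop].
have [_ sF] := Rintegral_sum (index_enum 'I_n) iF.
apply/eqP; rewrite -subr_eq0 opprK -RintegralD//.
  rewrite -[X in _ == X](_ : \int[mu]_x (\sum_(j < n) F j x) = 0).
  apply/eqP; apply: eq_Rintegral => x _.
  rewrite /F -mulr_sumr -mulrDr; congr (_ * _).
  rewrite sumrB (_ : \sum_(j < n) _ * _ * _ = 0); last first.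
    under eq_bigr do rewrite -mulrA (mulrA (_ ord0 _)) (mulrC _ (v x)) mulrCA.
    by rewrite -mulr_sumr -mulr_sumr sum_coord_Nop !mulr0.
  rewrite subr0 /Wop mulr_suml -big_split/=; apply: eq_bigr => j _.
  by rewrite (Nop_mul j x (cN j) cv) addrC; congr (_ + _); exact: mulrC.
by rewrite sF big1// => j _; exact: ibp_radial.
Qed.

Lemma Wop_sym u v psi : is_Ck 2 u -> is_Ck 2 v -> radial_weight psi ->
  \int[mu]_x (psi (nsq x) * (Wop u x * v x)) =
  \int[mu]_x (psi (nsq x) * (u x * Wop v x)).
Proof.
move=> cu cv wpsi; rewrite (Wop_ibp cu (Ck_weaken cv) wpsi).
have := Wop_ibp cv (Ck_weaken cu) wpsi.
under eq_Rintegral do rewrite (mulrC (Wop _ _)).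
move=> E; rewrite E; apply/eqP; rewrite eqr_opp; apply/eqP.
apply: eq_Rintegral => x _; congr (psi _ * _).
by apply: eq_bigr => j _; exact: mulrC.
Qed.

End radial_ibp.

(** * Harmonic polynomials *)

Section harmonic_polynomials.
Context (n : nat) (K : numFieldType).
Local Notation poly := (mpoly.mpoly n K).
Local Notation D := (@mpoly.mderiv n K).
Local Notation X := (fun i : 'I_n => mpoly.mpolyX K (mpoly.mnm1 i)).
Implicit Types (p q h : poly) (i j : 'I_n) (k d m : nat).

Definition peuler p : poly := \sum_(i < n) X i * D i p.
Definition plap p : poly := \sum_(i < n) D i (D i p).
Definition pnsq : poly := \sum_(i < n) X i ^+ 2.

Lemma pderivX i j : D i (X j) = (i == j)%:R.
Proof.
rewrite mpoly.mderivX mpoly.mnm1E eq_sym; have [->|_] := eqVneq i j; last by rewrite scale0r.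
rewrite scale1r (_ : mpoly.mnm_sub _ _ = mpoly.mnm0); last first.
  by apply/mpoly.mnmP => l; rewrite mpoly.mnmBE subnn mpoly.mnm0E.
exact: mpoly.mpolyX0.
Qed.

Lemma pderivMn i k : D i (k%:R) = 0.
Proof. by rewrite -mpoly.mpolyC1 -mpoly.mpolyCMn mpoly.mderivC. Qed.

Lemma pderiv_sum i (I : Type) (r : seq I) (F : I -> poly) :
  D i (\sum_(a <- r) F a) = \sum_(a <- r) D i (F a).
Proof. exact: (raddf_sum (D i)). Qed.

Lemma pderiv_nsq i : D i pnsq = 2 * X i.
Proof.
rewrite pderiv_sum (bigD1 i)//= big1 => [|j /negbTE ji].
  by rewrite addr0 expr2 mpoly.mderivM pderivX eqxx mulr1 mul1r; ring.
by rewrite expr2 mpoly.mderivM pderivX eq_sym ji mul0r mulr0 addr0.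
Qed.

Lemma peulerD p q : peuler (p + q) = peuler p + peuler q.
Proof.
by rewrite /peuler -big_split/=; apply: eq_bigr => i _; rewrite mpoly.mderivD mulrDr.
Qed.

Lemma peulerM p q : peuler (p * q) = peuler p * q + p * peuler q.
Proof.
rewrite /peuler mulr_suml mulr_sumr -big_split/=; apply: eq_bigr => i _.
by rewrite mpoly.mderivM; ring.
Qed.

Lemma peulerZ c p : peuler (c *: p) = c *: peuler p.
Proof.
by rewrite /peuler scaler_sumr; apply: eq_bigr => i _; rewrite mpoly.mderivZ scalerAr.
Qed.

Lemma peuler_X i : peuler (X i) = X i.
Proof.
rewrite /peuler (bigD1 i)//= pderivX eqxx mulr1 big1 ?addr0// => j /negbTE ji.
by rewrite pderivX ji mulr0.
Qed.

Lemma peuler_nsq : peuler pnsq = 2 * pnsq.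
Proof.
rewrite /peuler mulr_sumr; apply: eq_bigr => i _; rewrite pderiv_nsq; ring.
Qed.

Lemma peuler_deriv j p : peuler (D j p) = D j (peuler p) - D j p.
Proof.
have -> : D j (peuler p) = D j p + peuler (D j p); last by ring.
rewrite /peuler pderiv_sum (eq_bigr (fun i => (j == i)%:R * D i p + X i * D i (D j p))).
  rewrite big_split/= (bigD1 j)//= eqxx mul1r big1 ?addr0//.
  by move=> i /negbTE ij; rewrite eq_sym ij mul0r.
by move=> i _; rewrite mpoly.mderivM pderivX mpoly.mderiv_comm.
Qed.

Lemma peuler_mpolyX (m : mpoly.multinom n) :
  peuler (mpoly.mpolyX K m) = (mpoly.mdeg m)%:R *: mpoly.mpolyX K m.
Proof.
rewrite /peuler mpoly.mdegE natr_sum scaler_suml; apply: eq_bigr => i _.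
rewrite mpoly.mderivX -scalerAr -mpoly.mpolyXD.
have [->|mi] := eqVneq (m i) 0%N; first by rewrite !scale0r.
congr (_ *: mpoly.mpolyX K _); apply/mpoly.mnmP => l.
rewrite mpoly.mnmDE mpoly.mnmBE mpoly.mnm1E; have [<-|_] := eqVneq i l.
  by rewrite subnKC// lt0n.
by rewrite add0n subn0.
Qed.

Lemma mcoeff_peuler (m : mpoly.multinom n) p :
  mpoly.mcoeff m (peuler p) = (mpoly.mdeg m)%:R * mpoly.mcoeff m p.
Proof.
elim/mpoly.mpolyind: p => [|c m' p _ _ IH].
  rewrite (_ : peuler 0 = 0) ?mpoly.mcoeff0 ?mulr0//.
  by rewrite /peuler big1// => i _; rewrite mpoly.mderiv0 mulr0.
rewrite peulerD !mpoly.mcoeffD IH mulrDr; congr (_ + _).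
rewrite peulerZ peuler_mpolyX !mpoly.mcoeffZ mpoly.mcoeffX.
by have [->|_] := eqVneq m' m; rewrite ?mulr1 ?mulr0// mulrC.
Qed.

Lemma mcoeff_natM (m : mpoly.multinom n) k p :
  mpoly.mcoeff m (k%:R * p) = k%:R * mpoly.mcoeff m p.
Proof. by rewrite !mulr_natl mpoly.mcoeffMn. Qed.

(** Euler's identity: the operator multiplies each monomial by its degree, so in characteristic 0
    the equation leaves only monomials of degree k. Homogeneity thus becomes an equation that can be
    manipulated by [ring]. *)
Lemma homog_peulerP k p :
  all [pred m | mpoly.mdeg m == k] (mpoly.msupp p) <-> peuler p = k%:R * p.
Proof.
split=> [/allP h|E].
  apply/mpoly.mpolyP => m; rewrite mcoeff_peuler mcoeff_natM.
  have [/h/eqP ->//|] := boolP (m \in mpoly.msupp p).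
  by rewrite -mpoly.mcoeff_eq0 => /eqP ->; rewrite !mulr0.
apply/allP => m; rewrite mpoly.mcoeff_msupp /= => pm.
have := congr1 (mpoly.mcoeff m) E; rewrite mcoeff_peuler mcoeff_natM => /(mulIf pm)/eqP.
by rewrite eqr_nat.
Qed.

Lemma plapD p q : plap (p + q) = plap p + plap q.
Proof. by rewrite /plap -big_split/=; apply: eq_bigr => i _; rewrite !mpoly.mderivD. Qed.

Lemma plapZ c p : plap (c *: p) = c *: plap p.
Proof. by rewrite /plap scaler_sumr; apply: eq_bigr => i _; rewrite !mpoly.mderivZ. Qed.

Lemma plap_nsqM p : plap (pnsq * p) = (2 * n)%:R * p + 4 * peuler p + pnsq * plap p.
Proof.
rewrite /plap (eq_bigr (fun i => 2 * p + 4 * (X i * D i p) + pnsq * D i (D i p))).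
  rewrite !big_split/= -!mulr_sumr sumr_const card_ord natrM; congr (_ + _ + _).
  by rewrite -mulr_natl; ring.
move=> i _; rewrite mpoly.mderivM pderiv_nsq mpoly.mderivD !mpoly.mderivM pderiv_nsq.
by rewrite pderivX eqxx pderivMn mul0r add0r mulr1; ring.
Qed.

Lemma peuler_plap k p : peuler p = k%:R * p -> peuler (plap p) = k%:R * plap p - 2 * plap p.
Proof.
move=> E; have -> : peuler (plap p) = \sum_(i < n) (k%:R * D i (D i p) - 2 * D i (D i p)).
  rewrite {1}/plap; elim/big_rec2 : _ => [|i y1 y2 _ <-].
    by rewrite /peuler big1// => i _; rewrite mpoly.mderiv0 mulr0.
  rewrite peulerD; congr (_ + _).
  rewrite peuler_deriv peuler_deriv E mpoly.mderivB !mpoly.mderivM !pderivMn.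
  by rewrite !mul0r !add0r; rewrite mpoly.mderivM pderivMn; ring.
by rewrite sumrB -!mulr_sumr.
Qed.

Definition pharmonic k p := peuler p = k%:R * p /\ plap p = 0.

Lemma pharmonicZ k c p : pharmonic k p -> pharmonic k (c *: p).
Proof.
by move=> [E L]; split; rewrite ?peulerZ ?plapZ ?E ?L ?scaler0// scalerAr.
Qed.

Lemma peuler_nsqX (j : nat) p k : peuler p = k%:R * p ->
  peuler (pnsq ^+ j * p) = (2 * j + k)%:R * (pnsq ^+ j * p).
Proof.
move=> E; elim: j => [|j IH]; first by rewrite expr0 mul1r muln0 add0n.
rewrite exprS -mulrA peulerM IH peuler_nsq mulnS !natrD; ring.
Qed.

(** The factor is 2 (j + 1) (n + 2 k + 2 j). Only its positivity is kept: it allows |X|^(2 j) p to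
    be lifted through the Laplacian. *)
Lemma plap_nsqX (j : nat) p k : (0 < n)%N -> pharmonic k p ->
  exists2 a : nat, (0 < a)%N & plap (pnsq ^+ j.+1 * p) = a%:R *: (pnsq ^+ j * p).
Proof.
move=> n0 [E L]; elim: j => [|j [a a0 IH]].
  exists (2 * n + 4 * k)%N; first by rewrite addn_gt0 muln_gt0 n0.
  rewrite expr1 expr0 mul1r plap_nsqM E L mulr0 addr0 scaler_nat -[RHS]mulr_natl.
  by rewrite !(natrD, natrM); ring.
exists (2 * n + 4 * (2 * j.+1 + k) + a)%N; first by rewrite !addn_gt0 muln_gt0 n0.
rewrite exprS -mulrA plap_nsqM IH (peuler_nsqX j.+1 E) !scaler_nat.
rewrite -[RHS]mulr_natl -[in LHS](mulr_natl _ a) exprS !(natrD, natrM); ring.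
Qed.

Lemma peulerB p q : peuler (p - q) = peuler p - peuler q.
Proof. by rewrite -scaleN1r peulerD peulerZ scaleN1r. Qed.

Lemma plapB p q : plap (p - q) = plap p - plap q.
Proof. by rewrite -scaleN1r plapD plapZ scaleN1r. Qed.

Lemma peuler0 : peuler 0 = 0.
Proof. by rewrite /peuler big1// => i _; rewrite mpoly.mderiv0 mulr0. Qed.

Lemma plap0 : plap 0 = 0.
Proof. by rewrite /plap big1// => i _; rewrite !mpoly.mderiv0. Qed.

(** The Laplacian of p would be homogeneous of degree d - 2 < 0: a coefficient of degree e is killed
    by the factor e + 2 - d, which is nonzero. *)
Lemma plap_homog_small d p : (d < 2)%N -> peuler p = d%:R * p -> plap p = 0.
Proof.
move=> d2 E; apply/mpoly.mpolyP => m; rewrite mpoly.mcoeff0.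
have := congr1 (mpoly.mcoeff m) (peuler_plap E).
rewrite mcoeff_peuler mpoly.mcoeffB (mcoeff_natM m d) (mcoeff_natM m 2) => /eqP.
rewrite -mulrBl -subr_eq0 -mulrBl mulf_eq0 => /orP[|/eqP//].
rewrite opprB addrA -natrD subr_eq0 eqr_nat => /eqP md.
by move: d2; rewrite -md addn2.
Qed.

(** The Fischer decomposition in degree d, as a finite list of terms |X|^(2 j) h with h harmonic.
    Only existence is recorded: terms may repeat a degree. *)
Inductive fischer d : poly -> Prop :=
| fischer_nil : fischer d 0
| fischer_cons (j m : nat) h p : pharmonic m h -> (2 * j + m)%N = d ->
    fischer d p -> fischer d (pnsq ^+ j * h + p).

(** Surjectivity of the Laplacian, term by term: |X|^(2 j) h is the Laplacian of |X|^(2 j + 2) h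
    divided by the factor of [plap_nsqX]. *)
Lemma fischer_plap d q : (0 < n)%N -> fischer d q ->
  exists s, [/\ fischer d.+2 s, peuler s = d.+2%:R * s & plap s = q].
Proof.
move=> n0; elim=> [|j m h p hh jm _ [s [fs Es Ls]]].
  by exists 0; split; [exact: fischer_nil|rewrite peuler0 mulr0|exact: plap0].
have [a a0 aE] := plap_nsqX j n0 hh.
have hh' := pharmonicZ (a%:R)^-1 hh.
have jm' : (2 * j.+1 + m = d.+2)%N by rewrite mulnS -jm.
exists (pnsq ^+ j.+1 * (a%:R^-1 *: h) + s); split.
- exact: (fischer_cons hh' jm' fs).
- by rewrite peulerD Es (peuler_nsqX j.+1 hh'.1) jm' mulrDr.
- rewrite plapD Ls -scalerAr plapZ aE scalerA mulVf ?scale1r//.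
  by rewrite pnatr_eq0 -lt0n.
Qed.

(** Strong induction on the degree: the Laplacian of p has degree d - 2, so it is decomposable and
    is the Laplacian of some decomposable s of degree d. Then p - s is harmonic. *)
Lemma fischer_homog d p : (0 < n)%N -> peuler p = d%:R * p -> fischer d p.
Proof.
move=> n0; elim/ltn_ind : d p => d IH p E.
have [d2|d2] := ltnP d 2.
  rewrite -[p]addr0 -[p]mul1r -(expr0 pnsq); apply: (@fischer_cons _ _ d).
  - by split => //; exact: plap_homog_small E.
  - by [].
  - exact: fischer_nil.
have [d' dE] : exists d', d = d'.+2 by exists (d - 2)%N; rewrite -addn2 subnK.
have Lp : peuler (plap p) = d'%:R * plap p.
  by rewrite (peuler_plap E) dE -addn2 natrD; ring.
have [//|s [fs Es Ls]] := @fischer_plap d' (plap p) n0 (IH _ _ _ Lp).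
  by rewrite dE.
rewrite -dE in fs Es.
have -> : p = pnsq ^+ 0 * (p - s) + s by rewrite expr0 mul1r subrK.
apply: (@fischer_cons _ _ d) => //; split; first by rewrite peulerB E Es mulrBr.
by rewrite plapB Ls subrr.
Qed.

(** Each monomial is homogeneous, so it can be replaced by its Fischer decomposition. The terms
    become the steps of an induction on polynomials. *)
Lemma fischer_ind_all (Q : poly -> Prop) : (0 < n)%N -> Q 0 ->
  (forall (j m : nat) h p, pharmonic m h -> Q p -> Q (pnsq ^+ j * h + p)) ->
  forall p, Q p.
Proof.
move=> n0 Q0 QD; elim/mpoly.mpolyind => [//|c m p _ _ Qp].
have : fischer (mpoly.mdeg m) (c *: mpoly.mpolyX K m).
  apply: fischer_homog => //.
  by rewrite peulerZ peuler_mpolyX mulr_natl scaler_nat scalerMnr.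
move: (c *: _) => r; elim=> [|j k h q hh _ _ IH]; first by rewrite add0r.
by rewrite -addrA; exact: (QD _ _ _ _ hh IH).
Qed.

(* |X|^2 times the derivative L_j, on polynomials *)
Definition pNop j p : poly := pnsq * D j p - X j * peuler p.

(** Each N_j p has degree k + 1, so N_j N_j p = |X|^2 D_j N_j p - (k + 1) X_j N_j p. The second
    terms sum to 0 by tangency ([S0]), and the divergence of the N_j p is (2 k - n k - k^2) p
    ([S1]), harmonicity removing the second-order part. *)
Lemma pWop_harmonic k p : (2 <= n)%N -> pharmonic k p ->
  \sum_(j < n) pNop j (pNop j p) = - ((k * (k + n - 2))%:R * (pnsq * p)).
Proof.
move=> n2 [E L].
have NE j : pNop j p = pnsq * D j p - k%:R * (X j * p) by rewrite /pNop E; ring.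
have EN j : peuler (pNop j p) = (k%:R + 1) * pNop j p.
  rewrite NE peulerB peulerM peuler_nsq peuler_deriv E peulerM peulerM peuler_X E.
  rewrite mpoly.mderivM pderivMn (_ : peuler k%:R = 0); first by ring.
  by rewrite /peuler big1// => i _; rewrite pderivMn mulr0.
have DN j : D j (pNop j p) = 2 * (X j * D j p) + pnsq * D j (D j p)
    - k%:R * p - k%:R * (X j * D j p).
  rewrite NE mpoly.mderivB !mpoly.mderivM pderivMn pderiv_nsq pderivX eqxx mul1r; ring.
have S0 : \sum_(j < n) X j * pNop j p = 0.
  rewrite (eq_bigr (fun j => pnsq * (X j * D j p) - (X j ^+ 2) * (k%:R * p))).
    by rewrite sumrB -mulr_sumr -mulr_suml -/(peuler p) E -/pnsq subrr.
  by move=> j _; rewrite NE; ring.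
have S1 : \sum_(j < n) D j (pNop j p) =
    2 * (k%:R * p) - n%:R * (k%:R * p) - k%:R * (k%:R * p).
  under eq_bigr do rewrite DN.
  rewrite !sumrB big_split/= -!mulr_sumr -/(peuler p) -/(plap p) E L mulr0 addr0.
  by rewrite sumr_const card_ord -[p *+ n]mulr_natl; ring.
rewrite (eq_bigr (fun j => pnsq * D j (pNop j p) - (k%:R + 1) * (X j * pNop j p))).
  (* The subtraction in k + n - 2 is truncated; n >= 2 makes it the true one. *)
  rewrite sumrB -!mulr_sumr S0 S1 mulr0 subr0 natrM natrB ?natrD;
    last exact: leq_trans (leq_addl _ _).
  by ring.
by move=> j _; rewrite {1}/pNop EN; ring.
Qed.

End harmonic_polynomials.

Local Open Scope complex_scope.
Local Notation Re := complex.Re.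
Local Notation Im := complex.Im.

(** * Complex polynomials as functions on R^n *)

Section evaluation.
Context (R : realType) (n : nat).
Local Notation poly := (mpoly.mpoly n R[i]).
Local Notation D := (@mpoly.mderiv n R[i]).
Local Notation X := (fun i : 'I_n => mpoly.mpolyX R[i] (mpoly.mnm1 i)).
Implicit Types (x : 'rV[R]_n) (p q : poly) (i j : 'I_n) (k : nat).

Lemma ReM (a b : R[i]) : Re (a * b) = Re a * Re b - Im a * Im b.
Proof. by case: a; case: b. Qed.

Lemma ImM (a b : R[i]) : Im (a * b) = Re a * Im b + Im a * Re b.
Proof. by case: a => a1 a2; case: b => b1 b2 /=; rewrite (mulrC a2). Qed.

Lemma ReD (a b : R[i]) : Re (a + b) = Re a + Re b.
Proof. by case: a; case: b. Qed.

Lemma ImD (a b : R[i]) : Im (a + b) = Im a + Im b.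
Proof. by case: a; case: b. Qed.

Lemma ReN (a : R[i]) : Re (- a) = - Re a.
Proof. by case: a. Qed.

Lemma ImN (a : R[i]) : Im (- a) = - Im a.
Proof. by case: a. Qed.

Lemma Re_sum (I : Type) (r : seq I) (F : I -> R[i]) :
  Re (\sum_(a <- r) F a) = \sum_(a <- r) Re (F a).
Proof. by elim: r => [|a r IH]; rewrite ?big_nil// !big_cons ReD IH. Qed.

Lemma Im_sum (I : Type) (r : seq I) (F : I -> R[i]) :
  Im (\sum_(a <- r) F a) = \sum_(a <- r) Im (F a).
Proof. by elim: r => [|a r IH]; rewrite ?big_nil// !big_cons ImD IH. Qed.

Lemma RecM (a : R) (b : R[i]) : Re (a%:C * b) = a * Re b.
Proof. by rewrite ReM /= mul0r subr0. Qed.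

Lemma ImcM (a : R) (b : R[i]) : Im (a%:C * b) = a * Im b.
Proof. by rewrite ImM /= mul0r addr0. Qed.

Lemma complex_eqP (a b : R[i]) : Re a = Re b -> Im a = Im b -> a = b.
Proof. by case: a => a1 a2; case: b => b1 b2 /= -> ->. Qed.

Definition peval p x : R[i] := mpoly.meval (fun i => (x ord0 i)%:C) p.

Lemma pevalD p q x : peval (p + q) x = peval p x + peval q x.
Proof. exact: mpoly.mevalD. Qed.

Lemma pevalN p x : peval (- p) x = - peval p x.
Proof. exact: mpoly.mevalN. Qed.

Lemma pevalM p q x : peval (p * q) x = peval p x * peval q x.
Proof. exact: mpoly.mevalM. Qed.

Lemma pevalXU i x : peval (X i) x = (x ord0 i)%:C.
Proof. exact: mpoly.mevalXU. Qed.

Lemma pevalZ c p x : peval (c *: p) x = c * peval p x.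
Proof. exact: mpoly.mevalZ. Qed.

Lemma peval0 x : peval 0 x = 0.
Proof. exact: mpoly.meval0. Qed.

Lemma peval_nat k x : peval k%:R x = k%:R.
Proof. exact: (rmorph_nat (mpoly.meval (fun i => (x ord0 i)%:C)) k). Qed.

Lemma peval_sum (I : Type) (r : seq I) (F : I -> poly) x :
  peval (\sum_(a <- r) F a) x = \sum_(a <- r) peval (F a) x.
Proof. exact: (raddf_sum (mpoly.meval (fun i => (x ord0 i)%:C))). Qed.

Lemma pevalX p k x : peval (p ^+ k) x = peval p x ^+ k.
Proof. exact: (rmorphXn (mpoly.meval (fun i => (x ord0 i)%:C)) k). Qed.

(** Regularity and agreement with the formal derivative are bundled so that one induction on p
    carries both, the product rule using them together. *)
Definition is_smooth_poly p := (forall k, is_Ck k (fun x => Re (peval p x))) /\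
  (forall k, is_Ck k (fun x => Im (peval p x))) /\
  forall j x, dpart j (fun x => Re (peval p x)) x = Re (peval (D j p) x) /\
    dpart j (fun x => Im (peval p x)) x = Im (peval (D j p) x).

Lemma peval_smoothC c : is_smooth_poly (mpoly.mpolyC n c).
Proof.
have E : peval (mpoly.mpolyC n c) = fun=> c by apply/funext => x; exact: mpoly.mevalC.
rewrite /is_smooth_poly E; split; [|split] => [k|k|j x]; try exact: Ck_cst.
rewrite !dpart_cst mpoly.mderivC.
by rewrite /peval mpoly.meval0.
Qed.

Lemma peval_smoothX i : is_smooth_poly (X i).
Proof.
have E x : peval (X i) x = (x ord0 i)%:C by exact: mpoly.mevalXU.
rewrite /is_smooth_poly.
have -> : (fun x => Re (peval (X i) x)) = (fun x : 'rV[R]_n => x ord0 i).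
  by apply/funext => x; rewrite E.
have -> : (fun x => Im (peval (X i) x)) = (fun x : 'rV[R]_n => 0).
  by apply/funext => x; rewrite E.
split; [|split] => [k|k|j x]; [exact: Ck_coord|exact: Ck_cst|].
rewrite dpart_cst dpart_coord pderivX eq_sym.
by rewrite peval_nat; case: (j == i).
Qed.

Lemma peval_smoothD p q : is_smooth_poly p -> is_smooth_poly q ->
  is_smooth_poly (p + q).
Proof.
move=> [p1 [p2 p3]] [q1 [q2 q3]]; rewrite /is_smooth_poly.
have E : peval (p + q) = fun x => peval p x + peval q x.
  by apply/funext => x; exact: mpoly.mevalD.
have -> : (fun x => Re (peval (p + q) x)) = (fun x => Re (peval p x) + Re (peval q x)).
  by apply/funext => x; rewrite E ReD.
have -> : (fun x => Im (peval (p + q) x)) = (fun x => Im (peval p x) + Im (peval q x)).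
  by apply/funext => x; rewrite E ImD.
split; [|split] => [k|k|j x]; [exact: Ck_add|exact: Ck_add|].
rewrite (dpart_add j x (p1 1%N) (q1 1%N)) (dpart_add j x (p2 1%N) (q2 1%N)).
rewrite mpoly.mderivD pevalD ReD ImD.
by rewrite (p3 j x).1 (p3 j x).2 (q3 j x).1 (q3 j x).2.
Qed.

Lemma peval_smoothM p q : is_smooth_poly p -> is_smooth_poly q ->
  is_smooth_poly (p * q).
Proof.
move=> [p1 [p2 p3]] [q1 [q2 q3]]; rewrite /is_smooth_poly.
have E : peval (p * q) = fun x => peval p x * peval q x.
  by apply/funext => x; exact: mpoly.mevalM.
have -> : (fun x => Re (peval (p * q) x)) =
    (fun x => Re (peval p x) * Re (peval q x) + - (Im (peval p x) * Im (peval q x))).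
  by apply/funext => x; rewrite E ReM.
have -> : (fun x => Im (peval (p * q) x)) =
    (fun x => Re (peval p x) * Im (peval q x) + Im (peval p x) * Re (peval q x)).
  by apply/funext => x; rewrite E ImM.
have m11 k := Ck_mul (p1 k) (q1 k).
have m22 k := Ck_mul (p2 k) (q2 k).
have m12 k := Ck_mul (p1 k) (q2 k).
have m21 k := Ck_mul (p2 k) (q1 k).
split; [|split] => [k|k|j x].
- by apply: (Ck_add (m11 k)); exact: (Ck_opp (m22 k)).
- exact: (Ck_add (m12 k) (m21 k)).
rewrite (dpart_add j x (m11 1%N) (Ck_opp (m22 1%N))) (dpart_opp j x (m22 1%N)).
rewrite (dpart_add j x (m12 1%N) (m21 1%N)).
rewrite (dpart_mul j x (p1 1%N) (q1 1%N)) (dpart_mul j x (p2 1%N) (q2 1%N)).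
rewrite (dpart_mul j x (p1 1%N) (q2 1%N)) (dpart_mul j x (p2 1%N) (q1 1%N)).
rewrite !(p3 j x).1 !(p3 j x).2 !(q3 j x).1 !(q3 j x).2.
rewrite mpoly.mderivM pevalD !pevalM.
move: (peval p x) (peval q x) (peval (D j p) x) (peval (D j q) x).
by move=> [a1 a2] [b1 b2] [c1 c2] [d1 d2] /=; split; ring.
Qed.

Lemma peval_smooth p : is_smooth_poly p.
Proof.
have s0 : is_smooth_poly 0 by rewrite -(mpoly.mpolyC0 n R[i]); exact: peval_smoothC.
have s1 : is_smooth_poly 1 by rewrite -(mpoly.mpolyC1 n R[i]); exact: peval_smoothC.
elim/mpoly.mpolyind: p => [|c m p _ _ IH]; first exact: s0.
apply: peval_smoothD; last exact: IH.
rewrite -mpoly.mul_mpolyC; apply: peval_smoothM; first exact: peval_smoothC.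
rewrite mpoly.mpolyXE_id; elim/big_ind : _; [exact: s1|exact: peval_smoothM|].
move=> i _; elim: (m i) => [|k IHk]; first by rewrite expr0; exact: s1.
by rewrite exprS; apply: peval_smoothM; [exact: peval_smoothX|exact: IHk].
Qed.

Lemma Ck_Re_peval k p : is_Ck k (fun x => Re (peval p x)).
Proof. exact: (peval_smooth p).1. Qed.

Lemma Ck_Im_peval k p : is_Ck k (fun x => Im (peval p x)).
Proof. exact: (peval_smooth p).2.1. Qed.

(** Since -i p is harmonic whenever p is, facts about imaginary parts reduce to those about real
    parts. *)
Lemma Im_peval p x : Im (peval p x) = Re (peval (- 'i *: p) x).
Proof. by rewrite pevalZ; case: (peval p x) => a b /=; ring. Qed.

Lemma peval_nsq x : peval (pnsq n R[i]) x = (nsq x)%:C.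
Proof.
rewrite /pnsq peval_sum /nsq rmorph_sum.
by apply: eq_bigr => i _; rewrite pevalX pevalXU rmorphXn.
Qed.

Lemma Nop_Re_peval j p x :
  Nop j (fun x => Re (peval p x)) x = Re (peval (pNop j p) x).
Proof.
rewrite /Nop ((peval_smooth p).2.2 j x).1.
have -> : euler (fun x => Re (peval p x)) x = Re (peval (peuler p) x).
  rewrite /euler /peuler peval_sum Re_sum.
  apply: eq_bigr => i _; rewrite ((peval_smooth p).2.2 i x).1.
  by rewrite pevalM pevalXU RecM.
by rewrite /pNop pevalD pevalN !pevalM pevalXU peval_nsq ReD ReN !RecM.
Qed.

Lemma Wop_Re_harmonic k p x : (2 <= n)%N -> pharmonic k p ->
  Wop (fun x => Re (peval p x)) x = - (mu_sph R n k * nsq x * Re (peval p x)).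
Proof.
move=> n2 hp; rewrite /Wop.
transitivity (\sum_(j < n) Re (peval (pNop j (pNop j p)) x)).
  apply: eq_bigr => j _; rewrite -Nop_Re_peval; congr (Nop j _ x).
  by apply/funext => y; rewrite Nop_Re_peval.
rewrite -Re_sum -peval_sum (pWop_harmonic n2 hp) pevalN ReN !pevalM peval_nsq.
rewrite peval_nat (_ : _%:R = (mu_sph R n k)%:C); last by rewrite rmorph_nat.
by rewrite RecM RecM mulrA.
Qed.

Lemma Wop_Im_harmonic k p x : (2 <= n)%N -> pharmonic k p ->
  Wop (fun x => Im (peval p x)) x = - (mu_sph R n k * nsq x * Im (peval p x)).
Proof.
move=> n2 hp; under eq_fun do rewrite Im_peval.
by rewrite (Wop_Re_harmonic x n2 (pharmonicZ _ hp)) Im_peval.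
Qed.

Lemma solid_harmonicP k p : solid_harmonic k p <-> pharmonic k p.
Proof.
by split=> [[/homog_peulerP hp L]|[/homog_peulerP hp L]].
Qed.

Lemma peval_homog k p (c : R) x : solid_harmonic k p ->
  peval p (c *: x) = (c ^+ k)%:C * peval p x.
Proof.
move=> [/allP hp _]; rewrite /peval !mpoly.mevalE mulr_sumr.
apply: eq_big_seq => m mp; rewrite mulrCA; congr (_ * _).
under eq_bigr do rewrite rVZE rmorphM/= exprMn.
rewrite big_split/=; congr (_ * _).
rewrite -(eqP (hp m mp)) mpoly.mdegE rmorphXn/= expr_sum.
by apply: eq_bigr.
Qed.

Lemma enormE x : enorm x = Num.sqrt (nsq x). Proof. by []. Qed.

Lemma enorm_sqr x : enorm x ^+ 2 = nsq x.
Proof. by rewrite enormE sqr_sqrtr// nsq_ge0. Qed.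

Lemma enorm_gt0 x : x != 0 -> 0 < enorm x.
Proof. by move=> x0; rewrite enormE sqrtr_gt0 nsq_gt0. Qed.

Lemma nsqZ (c : R) x : nsq (c *: x) = c ^+ 2 * nsq x.
Proof. by rewrite /nsq mulr_sumr; apply: eq_bigr => i _; rewrite rVZE exprMn. Qed.

Lemma meval_div_enorm p x :
  mpoly.meval (fun i => (x ord0 i / enorm x)%:C) p = peval p ((enorm x)^-1 *: x).
Proof. by apply: mpoly.meval_eq => i; rewrite rVZE mulrC. Qed.

End evaluation.

(** * The spaces of spherical harmonics times radial functions *)

Section L2_theory.
Context (R : realType) (n : nat).
Local Notation mu := (lebesgue_rV R n).
Implicit Types (x : 'rV[R]_n) (u v w : 'rV[R]_n -> R[i]) (f g : 'rV[R]_n -> R).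

Lemma Lfun2P f : f \in Lfun mu 2%:E <->
  measurable_fun setT f /\ mu.-integrable setT (EFin \o (fun x => f x ^+ 2)).
Proof.
split=> [h|[mf /integrableP[mi ilt]]].
  split; last exact: Lfun2_integrable_sqr.
  by move: h; rewrite inE => /andP[]; rewrite inE.
rewrite inE; apply/andP; split; rewrite inE//= /finite_norm unlock.
apply: poweR_lty; apply: le_lt_trans ilt; apply: ge0_le_integral => //.
- by move=> x _; exact: poweR_ge0.
- apply/(measurable_EFinP _ (fun x => `|f x| `^ 2)).
  by apply: (@measurableT_comp _ _ _ _ _ _ (fun x : R => x `^ 2)) => //; exact: measurableT_comp.
- by apply: measurableT_comp.
- by move=> x _ /=; rewrite lee_fin normrX powR_mulrn.
Qed.

Lemma L2P u : L2 u <-> [/\ measurable_fun setT (fun x => Re (u x)),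
  measurable_fun setT (fun x => Im (u x)),
  mu.-integrable setT (EFin \o (fun x => Re (u x) ^+ 2)) &
  mu.-integrable setT (EFin \o (fun x => Im (u x) ^+ 2))].
Proof.
by rewrite /L2; split=> [[/Lfun2P[? ?] /Lfun2P[? ?]]//|[? ? ? ?]]; split; apply/Lfun2P.
Qed.

(** The real part of [L2dot]. It has the same norm, and orthogonality for [L2dot] implies it for
    [rdot], so sums, limits and Cauchy-Schwarz can stay in the reals. *)
Definition rdot u v : R := \int[mu]_x (Re (u x) * Re (v x) + Im (u x) * Im (v x)).

Lemma Re_L2dot u v : Re (L2dot u v) = rdot u v.
Proof.
rewrite /L2dot /rdot; apply: eq_Rintegral => x _.
by case: (u x) => a b; case: (v x) => c d /=; rewrite mulrN opprK.
Qed.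

Lemma integrable_L2M u v : L2 u -> L2 v -> mu.-integrable setT
  (EFin \o (fun x => Re (u x) * Re (v x) + Im (u x) * Im (v x))).
Proof.
move=> [u1 u2] [v1 v2].
have i1 := (Lfun1_integrable _ _).1 (Lfun2_mul_Lfun1 u1 v1).
have i2 := (Lfun1_integrable _ _).1 (Lfun2_mul_Lfun1 u2 v2).
exact: (integrableD measurableT i1 i2).
Qed.

Lemma L2D u v : L2 u -> L2 v -> L2 (fun x => u x + v x).
Proof.
have h (f g : 'rV[R]_n -> R) : f \in Lfun mu 2%:E -> g \in Lfun mu 2%:E ->
    (fun x => f x + g x) \in Lfun mu 2%:E.
  by move=> hf hg; have := Lfun_addr_closed mu (lee1n 2); case=> _; apply.
move=> [u1 u2] [v1 v2]; split.
  by under eq_fun do rewrite ReD; exact: h.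
by under eq_fun do rewrite ImD; exact: h.
Qed.

Lemma L2_mulr (w : 'rV[R]_n -> R) (M : R) u : measurable_fun setT w ->
  (forall x, `|w x| <= M) -> L2 u -> L2 (fun x => (w x)%:C * u x).
Proof.
move=> mw wM /L2P[m1 m2 i1 i2].
have h (f : 'rV[R]_n -> R) : measurable_fun setT f ->
    mu.-integrable setT (EFin \o (fun x => f x ^+ 2)) ->
    mu.-integrable setT (EFin \o (fun x => (w x * f x) ^+ 2)).
  move=> mf i; rewrite (_ : (fun x => _ ^+ 2) = (fun x => w x ^+ 2 * f x ^+ 2)).
    apply: (integrable_bounded_mul i (M := M ^+ 2)); first exact: measurable_funX.
    by move=> x; rewrite normrX lerXn2r// nnegrE (le_trans _ (wM x)).
  by apply/funext => x; rewrite exprMn.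
apply/L2P; split.
- by under eq_fun do rewrite RecM; exact: measurable_funM.
- by under eq_fun do rewrite ImcM; exact: measurable_funM.
- rewrite (_ : (fun x => _ ^+ 2) = (fun x => (w x * Re (u x)) ^+ 2)); [exact: h|].
  by apply/funext => x; rewrite RecM.
- rewrite (_ : (fun x => _ ^+ 2) = (fun x => (w x * Im (u x)) ^+ 2)); [exact: h|].
  by apply/funext => x; rewrite ImcM.
Qed.

Lemma L2_ext u v : u =1 v -> L2 u -> L2 v.
Proof. by move=> /funext ->. Qed.

Lemma L2_realZ (c : R) u : L2 u -> L2 (fun x => c%:C * u x).
Proof. by move=> hu; apply: (@L2_mulr (cst c) `|c|). Qed.

Lemma L2_iZ u : L2 u -> L2 (fun x => 'i * u x).
Proof.
move=> /L2P[m1 m2 i1 i2].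
have E1 : (fun x => Re ('i * u x)) = (fun x => - Im (u x)).
  by apply/funext => x; case: (u x) => a b /=; ring.
have E2 : (fun x => Im ('i * u x)) = (fun x => Re (u x)).
  by apply/funext => x; case: (u x) => a b /=; ring.
apply/L2P; split; rewrite ?E1 ?E2//.
- exact: measurableT_comp.
- rewrite (_ : (fun x => _ ^+ 2) = (fun x => Im (u x) ^+ 2))//.
  by apply/funext => x; case: (u x) => a b /=; ring.
- rewrite (_ : (fun x => _ ^+ 2) = (fun x => Re (u x) ^+ 2))//.
  by apply/funext => x; case: (u x) => a b /=; ring.
Qed.

Lemma L2Z (c : R[i]) u : L2 u -> L2 (fun x => c * u x).
Proof.
move=> hu; apply: L2_ext (L2D (L2_realZ (Re c) hu) (L2_realZ (Im c) (L2_iZ hu))).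
by move=> x /=; case: c => a b; case: (u x) => c d; apply: complex_eqP => /=; ring.
Qed.

Lemma L2N u : L2 u -> L2 (fun x => - u x).
Proof. by move=> hu; apply: L2_ext (L2Z (-1) hu) => x; rewrite mulN1r. Qed.

Lemma L2B u v : L2 u -> L2 v -> L2 (fun x => u x - v x).
Proof. by move=> hu /L2N; exact: L2D. Qed.

Lemma L2_0 : L2 (fun _ : 'rV[R]_n => 0 : R[i]).
Proof.
apply/L2P; split => //=; rewrite (_ : EFin \o _ = cst 0%E); try exact: integrable0;
  by apply/funext => x /=; rewrite expr0n.
Qed.

Lemma L2_sum (I : Type) (r : seq I) (F : I -> 'rV[R]_n -> R[i]) :
  (forall a, L2 (F a)) -> L2 (fun x => \sum_(a <- r) F a x).
Proof.
move=> hF; elim: r => [|a r IH].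
  by apply: L2_ext L2_0 => x; rewrite big_nil.
by apply: L2_ext (L2D (hF a) IH) => x; rewrite big_cons.
Qed.

Lemma rdotC u v : rdot u v = rdot v u.
Proof. by apply: eq_Rintegral => x _; ring. Qed.

Lemma rdotDl u v w : L2 u -> L2 v -> L2 w ->
  rdot (fun x => u x + v x) w = rdot u w + rdot v w.
Proof.
move=> hu hv hw; rewrite /rdot -RintegralD//; [|exact: integrable_L2M|exact: integrable_L2M].
by apply: eq_Rintegral => x _; rewrite ReD ImD; ring.
Qed.

Lemma rdotZl (c : R) u v : L2 u -> L2 v ->
  rdot (fun x => c%:C * u x) v = c * rdot u v.
Proof.
move=> hu hv; rewrite /rdot -RintegralZl//; last exact: integrable_L2M.
by apply: eq_Rintegral => x _; rewrite RecM ImcM; ring.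
Qed.

Lemma rdotNl u v : L2 u -> L2 v -> rdot (fun x => - u x) v = - rdot u v.
Proof.
move=> hu hv; rewrite -mulN1r -rdotZl//; congr (rdot _ v); apply/funext => x.
by rewrite rmorphN1 mulN1r.
Qed.

Lemma rdotBl u v w : L2 u -> L2 v -> L2 w ->
  rdot (fun x => u x - v x) w = rdot u w - rdot v w.
Proof. by move=> hu hv hw; rewrite rdotDl ?rdotNl//; exact: L2N. Qed.

Lemma rdot_ge0 u : 0 <= rdot u u.
Proof. by apply: Rintegral_ge0 => x _; rewrite -!expr2 addr_ge0 ?sqr_ge0. Qed.

Lemma rdot0l u : rdot (fun=> 0) u = 0.
Proof.
rewrite /rdot; under eq_Rintegral do rewrite /= !mul0r addr0.
by rewrite Rintegral_cst ?mul0r.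
Qed.

Lemma rdot_mulr (w : 'rV[R]_n -> R) u v :
  rdot (fun x => (w x)%:C * u x) v = rdot u (fun x => (w x)%:C * v x).
Proof. by apply: eq_Rintegral => x _; rewrite !RecM !ImcM; ring. Qed.

(** The form is only positive semidefinite, since functions are not identified almost everywhere;
    the usual quadratic in t is therefore treated separately when its leading coefficient is 0. *)
Lemma rdot_CS u v : L2 u -> L2 v -> rdot u v ^+ 2 <= rdot u u * rdot v v.
Proof.
move=> hu hv; set a := rdot u u; set b := rdot u v; set c := rdot v v.
have q t : 0 <= a - 2 * t * b + t ^+ 2 * c.
  have htv := L2_realZ t hv; have := rdot_ge0 (fun x => u x - t%:C * v x).
  rewrite rdotBl//; last exact: L2B.
  rewrite (rdotC u) (rdotC (fun x => t%:C * v x)) !rdotBl// !rdotZl//.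
  rewrite (rdotC v u) (rdotC u (fun x => t%:C * v x)) (rdotC v (fun x => t%:C * v x)) !rdotZl//.
  by rewrite -/a -/c (rdotC v u) -/b => h; nra.
have c0 : 0 <= c by exact: rdot_ge0.
have a0 : 0 <= a by exact: rdot_ge0.
have [cE|cN] := eqVneq c 0.
  have [bE|bN] := eqVneq b 0; first by rewrite bE cE mulr0 expr0n.
  (* With c = 0 the quadratic is affine in t, and this t gives it the value -1. *)
  have := q ((a + 1) / (2 * b)); rewrite cE mulr0 addr0.
  rewrite (_ : 2 * _ * b = a + 1); last by field.
  by lra.
have cp : 0 < c by rewrite lt0r cN.
have := q (b / c); rewrite (_ : _ + _ = a - b ^+ 2 / c); last by field.
by rewrite subr_ge0 ler_pdivrMr.
Qed.

Lemma rdot_CS_sqrt u v : L2 u -> L2 v ->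
  `|rdot u v| <= Num.sqrt (rdot u u) * Num.sqrt (rdot v v).
Proof.
move=> hu hv; rewrite -sqrtrM ?rdot_ge0// -sqrtr_sqr ler_wsqrtr//.
exact: rdot_CS.
Qed.

Lemma normc_sqr (z : R[i]) : Normc.normc z ^+ 2 = Re z ^+ 2 + Im z ^+ 2.
Proof. by case: z => a b /=; rewrite sqr_sqrtr// addr_ge0 ?sqr_ge0. Qed.

Lemma normc_ge0 (z : R[i]) : 0 <= Normc.normc z.
Proof. by case: z => a b; exact: sqrtr_ge0. Qed.

Lemma L2normE u :
  L2norm u = ((\int[mu]_x (Re (u x) ^+ 2 + Im (u x) ^+ 2)%:E) `^ (2^-1))%E.
Proof.
rewrite /L2norm unlock; congr (_ `^ _)%E; apply: eq_integral => x _ /=.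
by rewrite ger0_norm ?normc_ge0// powR_mulrn ?normc_ge0// normc_sqr.
Qed.

Lemma L2norm_rdot u : L2 u -> L2norm u = (Num.sqrt (rdot u u))%:E.
Proof.
move=> hu; rewrite L2normE -powR12_sqrt ?rdot_ge0// -poweR_EFin; congr (_ `^ _)%E.
rewrite /rdot /Rintegral fineK.
  by apply: eq_integral => x _; rewrite !expr2.
by apply: integrable_fin_num => //; exact: integrable_L2M.
Qed.

Lemma L2norm_sqr u : L2 u -> (L2norm u ^+ 2 = (rdot u u)%:E)%E.
Proof.
by move=> hu; rewrite L2norm_rdot// -EFin_expe sqr_sqrtr// rdot_ge0.
Qed.

Lemma L2norm_lt u (e : R) : 0 < e -> L2 u ->
  (L2norm u < e%:E)%E = (rdot u u < e ^+ 2).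
Proof.
move=> e0 hu; rewrite L2norm_rdot// lte_fin.
by rewrite -[X in _ < X](ger0_norm (ltW e0)) -sqrtr_sqr ltr_sqrt// exprn_gt0.
Qed.

End L2_theory.

(** * Generators of H_k and their orthogonality *)

Section generators.
Context (R : realType) (n : nat).
Local Notation mu := (lebesgue_rV R n).
Local Notation poly := (mpoly.mpoly n R[i]).
Implicit Types (x : 'rV[R]_n) (u v w h F : 'rV[R]_n -> R[i]) (p : poly) (k l : nat).
Implicit Types (psi alpha beta : R -> R).

Lemma powR_sqrt_half (t : R) k : 0 < t ->
  t `^ (- (k%:R / 2)) = (Num.sqrt t)^-1 ^+ k.
Proof.
move=> t0; rewrite powRN (mulrC k%:R) powRrM powR12_sqrt ?ltW//.
by rewrite powR_mulrn ?sqrtr_ge0// exprVn.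
Qed.

(* The radial factor of a generator is recovered, up to a constant, by
   restricting it to a ray on which the harmonic factor does not vanish. *)
Lemma generator_form k h : harmonic_times_radial k h -> L2 h ->
  exists p alpha beta, [/\ solid_harmonic k p, measurable_fun setT alpha,
    measurable_fun setT beta & forall x, x != 0 ->
      h x = (alpha (nsq x) +i* beta (nsq x)) * peval p x].
Proof.
move=> [p [g [sp hE]]] /L2P[mRe mIm _ _].
have {}hE x : h x = g (enorm x) * peval p ((enorm x)^-1 *: x).
  by rewrite hE meval_div_enorm.
(* If p vanishes at every nonzero point, so does h, and zero radial factors will do. *)
have [[w [w0 pw]]|np] := pselect (exists w : 'rV[R]_n, w != 0 /\ peval p w != 0); last first.
  exists p, (cst 0), (cst 0); split; [exact: sp|exact: measurable_cst|exact: measurable_cst|].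
  move=> x x0; rewrite hE (peval_homog _ _ sp).
  have [->|px] := eqVneq (peval p x) 0; first by rewrite !mulr0.
  by exfalso; apply: np; exists x.
pose o := (enorm w)^-1 *: w.
have o1 : nsq o = 1.
  by rewrite nsqZ -enorm_sqr -exprMn mulVf ?expr1n// gt_eqF// enorm_gt0.
have po : peval p o != 0.
  rewrite (peval_homog _ _ sp) mulf_neq0// fmorph_eq0 expf_neq0// invr_neq0//.
  by rewrite gt_eqF// enorm_gt0.
pose q := (peval p o)^-1.
pose ray (t : R) : 'rV[R]_n := Num.sqrt t *: o.
(* This is |x|^-k at t = |x|^2, the factor that leads from p(x) to p(x / |x|). As [h (ray t)] is
   g(sqrt t) p(o), the function [c] below is g(sqrt t) t^(-k/2) for t > 0, and it is measurable
   because h is. *)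
pose s (t : R) := t `^ (- (k%:R / 2)).
pose c t := h (ray t) * ((s t)%:C * q).
have mray : measurable_fun setT ray.
  apply: measurable_fun_rVP => i.
  rewrite [X in measurable_fun _ X](_ : _ = fun t => Num.sqrt t * o ord0 i).
    apply: measurable_funM => //; apply: continuous_measurable_fun; exact: sqrt_continuous.
  by apply/funext => t; rewrite /= /rV_coord rVZE.
have ms : measurable_fun setT s by exact: measurable_powR.
have mR := measurableT_comp mRe mray; have mI := measurableT_comp mIm mray.
exists p, (fun t => Re (c t)), (fun t => Im (c t)); split; first exact: sp.
- rewrite (_ : (fun t => _) = (fun t =>
    Re (h (ray t)) * (s t * Re q) - Im (h (ray t)) * (s t * Im q))).
    by apply: measurable_funB; apply: measurable_funM => //; exact: measurable_funM.
  by apply/funext => t; rewrite /c ReM RecM ImcM.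
- rewrite (_ : (fun t => _) = (fun t =>
    Re (h (ray t)) * (s t * Im q) + Im (h (ray t)) * (s t * Re q))).
    by apply: measurable_funD; apply: measurable_funM => //; exact: measurable_funM.
  by apply/funext => t; rewrite /c ImM RecM ImcM.
move=> x x0; have r0 := enorm_gt0 x0.
have enr : enorm (ray (nsq x)) = enorm x.
  by rewrite /ray -enormE [LHS]enormE nsqZ o1 mulr1 sqrtr_sqr ger0_norm// ltW.
have cE : c (nsq x) = g (enorm x) * ((enorm x)^-1 ^+ k)%:C.
  rewrite /c hE enr {1}/ray -enormE scalerA mulVf ?gt_eqF// scale1r.
  rewrite /s powR_sqrt_half ?nsq_gt0// -enormE -mulrA; congr (_ * _).
  by rewrite mulrCA /q divff ?mulr1.
rewrite (_ : _ +i* _ = c (nsq x)); last by case: (c _).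
by rewrite cE hE (peval_homog _ _ sp) mulrA.
Qed.

(** Vanishing near 0 keeps the weight bounded after division by |x|^2. *)
Definition annular_weight psi :=
  radial_weight psi /\ exists2 e : R, 0 < e & forall t, t < e -> psi t = 0.

Lemma radial_weight_inv psi : annular_weight psi ->
  radial_weight (fun t => psi t * t `^ (-1)).
Proof.
move=> [[mpsi [M psiM] [c psic]] [e e0 psie]]; split.
- by apply: measurable_funM => //; exact: measurable_powR.
- exists (M * e^-1) => t; have [te|et] := ltP t e.
    have M0 : 0 <= M := le_trans (normr_ge0 _) (psiM 0).
    by rewrite psie// mul0r normr0 mulr_ge0// invr_ge0 ltW.
  have t0 := lt_le_trans e0 et.
  rewrite normrM ler_pM// powR_inv1 ?(ltW t0)// ger0_norm ?invr_ge0 ?(ltW t0)//.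
  by rewrite lef_pV2.
- by exists c => t /psic ->; rewrite mul0r.
Qed.

Lemma annular_weight_inv psi : annular_weight psi ->
  annular_weight (fun t => psi t * t `^ (-1)).
Proof.
move=> h; split; first exact: radial_weight_inv.
by case: h => _ [e e0 psie]; exists e => // t /psie ->; rewrite mul0r.
Qed.

Lemma annular_weight_nsqV psi x : annular_weight psi ->
  psi (nsq x) * nsq x `^ (-1) * nsq x = psi (nsq x).
Proof.
move=> [_ [e e0 psie]]; have [x0|x0] := eqVneq x 0.
  have n0 : nsq x = 0 by apply/eqP; rewrite nsq_eq0 x0.
  by rewrite n0 psie// !mul0r.
by rewrite powR_inv1 ?nsq_ge0// mulfVK// nsq_eq0.
Qed.

Lemma lebesgue_rV_set0 : (0 < n)%N -> mu [set 0] = 0%E.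
Proof. by case: n => // m _; exact: lebesgue_rV0. Qed.

Lemma measurable_rV_set1 : measurable [set 0 : 'rV[R]_n].
Proof.
rewrite (_ : [set 0] = cube 0); first exact: measurable_cube.
apply/seteqP; split=> [x -> i|x h]; first by rewrite mxE normr0.
by apply/rowP => i; apply/eqP; rewrite mxE -normr_le0.
Qed.

Lemma Rintegral_off0 (F G : 'rV[R]_n -> R) : (0 < n)%N ->
  measurable_fun setT F -> measurable_fun setT G ->
  (forall x, x != 0 -> F x = G x) -> \int[mu]_x F x = \int[mu]_x G x.
Proof.
move=> n0 mF mG FG; rewrite /Rintegral; congr fine.
apply: ae_eq_integral => //; [exact/measurable_EFinP|exact/measurable_EFinP|].
exists [set 0]; split; [exact: measurable_rV_set1|exact: lebesgue_rV_set0|].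
move=> x /= h; apply: contrapT => x0; apply: h => _.
by rewrite FG//; apply/eqP.
Qed.

(** The factors g1 and g2 are unbounded, and the two summands of G need not be integrable
    separately. On [A m], where 1/(m + 1) <= |x|^2 <= m + 1 and both factors are at most m + 1 in
    absolute value, they become annular weights; |G| then dominates the truncations as m grows. *)
Lemma radial_sum_integral0 (a1 a2 G : 'rV[R]_n -> R) (g1 g2 : R -> R) : (0 < n)%N ->
  continuous a1 -> continuous a2 -> measurable_fun setT g1 -> measurable_fun setT g2 ->
  (forall psi, annular_weight psi -> \int[mu]_x (psi (nsq x) * a1 x) = 0) ->
  (forall psi, annular_weight psi -> \int[mu]_x (psi (nsq x) * a2 x) = 0) ->
  mu.-integrable setT (EFin \o G) ->
  (forall x, x != 0 -> G x = g1 (nsq x) * a1 x + g2 (nsq x) * a2 x) ->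
  \int[mu]_x G x = 0.
Proof.
move=> n0 ca1 ca2 mg1 mg2 h1 h2 iG GE.
have mG := (measurable_EFinP _ G).1 (measurable_int _ iG).
have mN := @measurable_nsq R n.
pose A (m : nat) : set R := `[m.+1%:R^-1, m.+1%:R] `&`
  (g1 @^-1` `[- m.+1%:R, m.+1%:R] `&` g2 @^-1` `[- m.+1%:R, m.+1%:R]).
have mA m : measurable (A m).
  apply: measurableI => //; apply: measurableI.
    by rewrite -[X in measurable X]setTI; exact: mg1.
  by rewrite -[X in measurable X]setTI; exact: mg2.
have mI m : measurable_fun setT (fun x => \1_(A m) (nsq x) : R).
  by apply: measurableT_comp mN; exact: measurable_indic.
have I1 m t : `|\1_(A m) t : R| <= 1.
  by rewrite indicE; case: (_ \in _); rewrite ?normr1 ?normr0.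
have A0 m t : t < m.+1%:R^-1 -> \1_(A m) t = 0 :> R.
  move=> tm; rewrite indicE memNset// => -[+ _]; rewrite /= in_itv/= => /andP[mt _].
  by move: tm; rewrite ltNge mt.
have aw m (g : R -> R) : (g = g1 \/ g = g2) -> measurable_fun setT g ->
    annular_weight (fun t => \1_(A m) t * g t).
  move=> gE mg; split; last first.
    by exists m.+1%:R^-1 => [|t tm]; [rewrite invr_gt0|rewrite A0// mul0r].
  split.
  - by apply: measurable_funM => //; exact: measurable_indic.
  - exists m.+1%:R => t; rewrite indicE.
    have [tA|_] := boolP (t \in A m); last by rewrite mul0r normr0.
    rewrite mul1r ler_norml; have [_ []] := set_mem tA; rewrite /= !in_itv/=.
    by case: gE => ->.
  - exists m.+1%:R => t mt; rewrite indicE memNset ?mul0r// => -[+ _].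
    by rewrite /= in_itv/= => /andP[_]; rewrite leNgt mt.
(* No [A m] contains 0, so the truncations tend to G only off the origin; [G'] is their pointwise
   limit everywhere. *)
pose G' x := (x != 0)%:R * G x.
have mx0 : measurable_fun setT (fun x : 'rV[R]_n => (x != 0)%:R : R).
  rewrite (_ : (fun x => _) = \1_(~` [set 0])); last first.
    apply/funext => x; rewrite indicE; congr (_%:R); congr nat_of_bool.
    by apply/idP/idP => [/eqP x0|/set_mem x0]; [exact/mem_set|exact/eqP].
  by apply: measurable_indic; apply: measurableC; exact: measurable_rV_set1.
rewrite (@Rintegral_off0 G G')//; [|exact: measurable_funM|by move=> x x0; rewrite /G' x0 mul1r].
apply: (@Rintegral_lim_eq0 _ _ _ mu (fun m x => \1_(A m) (nsq x) * G x) _ (fun x => `|G x|)).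
- by move=> m; exact: measurable_funM.
- move=> x; apply: cvgMl; have [->|x0] := eqVneq x 0.
    rewrite (_ : (fun m => _) = cst 0); first exact: cvg_cst.
    apply/funext => m; rewrite A0// (_ : nsq 0 = 0) ?invr_gt0//.
    by apply/eqP; rewrite nsq_eq0.
  have t0 : 0 < nsq x by rewrite nsq_gt0.
  (* As soon as m + 1 exceeds this bound, |x|^2 belongs to [A m]. *)
  pose b := Num.max (Num.max (nsq x)^-1 (nsq x)) (Num.max `|g1 (nsq x)| `|g2 (nsq x)|).
  apply: cvg_near_cst; exists (Num.trunc b) => // m /= bm.
  have {bm}bm : b <= m.+1%:R.
    by rewrite (le_trans (ltW (truncnS_gt _)))// ler_nat ltnS.
  move: bm; rewrite !ge_max => /andP[/andP[b1 b2] /andP[b3 b4]].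
  rewrite indicE mem_set//; split; last by split; rewrite /= in_itv/= -ler_norml.
  rewrite /= in_itv/= b2 andbT -[leRHS]invrK lef_pV2// posrE ?invr_gt0//.
- by have := integrable_abse iG.
- by move=> m x; rewrite normrM ler_piMl.
- move=> m.
  have w1 := aw m g1 (or_introl erefl) mg1; have w2 := aw m g2 (or_intror erefl) mg2.
  rewrite (_ : (fun x => _) = (fun x => (\1_(A m) (nsq x) * g1 (nsq x)) * a1 x +
      (\1_(A m) (nsq x) * g2 (nsq x)) * a2 x)).
    rewrite RintegralD//; first by rewrite (h1 _ w1) (h2 _ w2) addr0.
      exact: integrable_radial w1.1 ca1.
    exact: integrable_radial w2.1 ca2.
  apply/funext => x; have [->|x0] := eqVneq x 0; last by rewrite GE//; ring.
  by rewrite A0 ?mul0r ?addr0// (_ : nsq 0 = 0) ?invr_gt0//; apply/eqP; rewrite nsq_eq0.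
Qed.

(** With h = (alpha + i beta) p, the real product of G1 + i G2 and h is alpha (G1 Re p + G2 Im p) +
    beta (G2 Re p - G1 Im p). The two hypotheses are thus the real and imaginary parts of the
    pairing with p under a radial weight. *)
Lemma rdot_generator0 k h F (G1 G2 : 'rV[R]_n -> R) (phi : R -> R) : (0 < n)%N ->
  harmonic_times_radial k h -> L2 h -> L2 F -> measurable_fun setT phi ->
  continuous G1 -> continuous G2 ->
  (forall x, x != 0 -> F x = (phi (nsq x))%:C * (G1 x +i* G2 x)) ->
  (forall p psi, solid_harmonic k p -> annular_weight psi ->
    \int[mu]_x (psi (nsq x) * (G1 x * Re (peval p x) + G2 x * Im (peval p x))) = 0 /\
    \int[mu]_x (psi (nsq x) * (G2 x * Re (peval p x) - G1 x * Im (peval p x))) = 0) ->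
  rdot F h = 0.
Proof.
move=> n0 gh Lh LF mphi cG1 cG2 FE orth.
have [p [alpha [beta [sp ma mb hE]]]] := generator_form gh Lh.
have cR := Ck_continuous (Ck_Re_peval 0 p); have cI := Ck_continuous (Ck_Im_peval 0 p).
apply: (@radial_sum_integral0 (fun x => G1 x * Re (peval p x) + G2 x * Im (peval p x))
  (fun x => G2 x * Re (peval p x) + - (G1 x * Im (peval p x))) _
  (fun t => phi t * alpha t) (fun t => phi t * beta t)) => //.
- by apply: continuous_rV_add; exact: continuous_rV_mul.
- apply: continuous_rV_add; first exact: continuous_rV_mul.
  apply: (@Ck_continuous _ _ 0); apply: Ck_opp; exact: continuous_rV_mul.
- exact: measurable_funM.
- exact: measurable_funM.
- by move=> psi wpsi; exact: (orth p psi sp wpsi).1.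
- by move=> psi wpsi; exact: (orth p psi sp wpsi).2.
- exact: integrable_L2M.
- move=> x x0; rewrite FE// hE// RecM ImcM ReM ImM /=; ring.
Qed.

Lemma mu_sph_lt k l : (2 <= n)%N -> (k < l)%N -> mu_sph R n k < mu_sph R n l.
Proof.
move=> n2 kl; rewrite /mu_sph ltr_nat; apply: leq_ltn_trans (_ : k * (l + n - 2) < _)%N.
  by rewrite leq_mul2l leq_sub2r ?orbT// leq_add2r ltnW.
have l0 : (0 < l)%N := leq_ltn_trans (leq0n k) kl.
have ln : (0 < l + n - 2)%N by rewrite subn_gt0; exact: leq_add l0 n2.
by rewrite ltn_pmul2r.
Qed.

(** Symmetry of W is used with the weight psi(t) / t, which absorbs the |x|^2 of the eigenvalue
    equation and yields (a - b) int psi u v = 0. *)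
Lemma eigen_orth (u v : 'rV[R]_n -> R) (a b : R) psi : is_Ck 2 u -> is_Ck 2 v ->
  (forall x, Wop u x = - (a * nsq x * u x)) -> (forall x, Wop v x = - (b * nsq x * v x)) ->
  a != b -> annular_weight psi -> \int[mu]_x (psi (nsq x) * (u x * v x)) = 0.
Proof.
move=> cu cv uE vE ab wpsi; have wpsi' := radial_weight_inv wpsi.
have c_uv : continuous (fun x => u x * v x).
  exact: continuous_rV_mul (Ck_continuous cu) (Ck_continuous cv).
have i := integrable_radial wpsi.1 c_uv.
have := Wop_sym cu cv wpsi'.
rewrite (@eq_Rintegral _ _ _ mu setT (fun x => - a * (psi (nsq x) * (u x * v x)))); last first.
  by move=> x _; rewrite uE -[in RHS](annular_weight_nsqV x wpsi); ring.
rewrite [in RHS](@eq_Rintegral _ _ _ mu setT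
    (fun x => - b * (psi (nsq x) * (u x * v x)))); last first.
  by move=> x _; rewrite vE -[in RHS](annular_weight_nsqV x wpsi); ring.
rewrite !RintegralZl// => /eqP; rewrite -subr_eq0 -mulrBl mulf_eq0 => /orP[|/eqP//].
by rewrite opprK addrC subr_eq0 => /eqP E; rewrite E eqxx in ab.
Qed.

(** For n >= 2 the eigenvalues increase strictly with the degree. Real and imaginary parts of p and
    q are eigenfunctions, so all four of their products integrate to 0 against annular weights. *)
Lemma generators_orth k l g h : (2 <= n)%N -> k != l ->
  harmonic_times_radial k g -> L2 g -> harmonic_times_radial l h -> L2 h ->
  rdot g h = 0.
Proof.
move=> n2 kl gg Lg gh Lh; have n0 : (0 < n)%N by exact: leq_trans n2.
have [p [a [b [sp ma mb gE]]]] := generator_form gg Lg.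
have [q [c [d [sq mc md hE]]]] := generator_form gh Lh.
have mukl : mu_sph R n k != mu_sph R n l.
  have [lt|lt|E] := ltngtP k l; last by rewrite E eqxx in kl.
    by rewrite lt_eqF// mu_sph_lt.
  by rewrite gt_eqF// mu_sph_lt.
have hp := (solid_harmonicP k p).1 sp; have hq := (solid_harmonicP l q).1 sq.
have cRp := Ck_Re_peval 2 p; have cIp := Ck_Im_peval 2 p.
have cRq := Ck_Re_peval 2 q; have cIq := Ck_Im_peval 2 q.
have eRp x := Wop_Re_harmonic x n2 hp; have eIp x := Wop_Im_harmonic x n2 hp.
have eRq x := Wop_Re_harmonic x n2 hq; have eIq x := Wop_Im_harmonic x n2 hq.
have c_ (u v : 'rV[R]_n -> R) : is_Ck 2 u -> is_Ck 2 v -> continuous (fun x => u x * v x).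
  by move=> cu cv; exact: continuous_rV_mul (Ck_continuous cu) (Ck_continuous cv).
have two (u1 v1 u2 v2 : 'rV[R]_n -> R) (s : R) psi : annular_weight psi ->
   continuous (fun x => u1 x * v1 x) -> continuous (fun x => u2 x * v2 x) ->
   \int[mu]_x (psi (nsq x) * (u1 x * v1 x)) = 0 ->
   \int[mu]_x (psi (nsq x) * (u2 x * v2 x)) = 0 ->
   \int[mu]_x (psi (nsq x) * (u1 x * v1 x + s * (u2 x * v2 x))) = 0.
  move=> wpsi c1 c2 h1 h2; have i1 := integrable_radial wpsi.1 c1.
  have i2 := integrable_radial wpsi.1 c2.
  rewrite (@eq_Rintegral _ _ _ mu setT (fun x =>
    psi (nsq x) * (u1 x * v1 x) + s * (psi (nsq x) * (u2 x * v2 x)))).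
    rewrite RintegralD// ?RintegralZl// ?h1 ?h2 ?mulr0 ?addr0//.
    by have := @integrableZl _ _ _ mu setT measurableT s _ i2.
  by move=> x _; ring.
apply: (@radial_sum_integral0
  (fun x => Re (peval p x) * Re (peval q x) + 1 * (Im (peval p x) * Im (peval q x)))
  (fun x => Im (peval p x) * Re (peval q x) + -1 * (Re (peval p x) * Im (peval q x))) _
  (fun t => a t * c t + b t * d t) (fun t => a t * d t - b t * c t)) => //.
- apply: continuous_rV_add; first exact: c_.
  by apply: continuous_rV_mul; [exact: (Ck_continuous (Ck_cst _ 0 _))|exact: c_].
- apply: continuous_rV_add; first exact: c_.
  by apply: continuous_rV_mul; [exact: (Ck_continuous (Ck_cst _ 0 _))|exact: c_].
- by apply: measurable_funD; exact: measurable_funM.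
- by apply: measurable_funB; exact: measurable_funM.
- move=> psi wpsi; apply: two => //; [exact: c_|exact: c_| |].
    exact: (eigen_orth cRp cRq eRp eRq mukl wpsi).
  exact: (eigen_orth cIp cIq eIp eIq mukl wpsi).
- move=> psi wpsi; apply: two => //; [exact: c_|exact: c_| |].
    exact: (eigen_orth cIp cRq eIp eRq mukl wpsi).
  exact: (eigen_orth cRp cIq eRp eIq mukl wpsi).
- exact: integrable_L2M.
- by move=> x x0; rewrite gE// hE// !ReM !ImM /=; ring.
Qed.

End generators.

(** * The closed spaces H_k: radial multipliers, orthogonality, projections *)

Section harmonic_space_theory.
Context (R : realType) (n : nat).
Local Notation mu := (lebesgue_rV R n).
Implicit Types (x : 'rV[R]_n) (u v w h F : 'rV[R]_n -> R[i]) (k l : nat).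

Lemma harmonic_times_radialZ k (c : R[i]) h :
  harmonic_times_radial k h -> harmonic_times_radial k (fun x => c * h x).
Proof.
move=> [p [g [sp ->]]]; exists p, (fun r => c * g r); split; first exact: sp.
by apply/funext => x; rewrite mulrA.
Qed.

Lemma harmonic_times_radialM k (w : R -> R) h :
  harmonic_times_radial k h ->
  harmonic_times_radial k (fun x => (w (nsq x))%:C * h x).
Proof.
move=> [p [g [sp ->]]]; exists p, (fun r => (w (r ^+ 2))%:C * g r); split; first exact: sp.
by apply/funext => x; rewrite mulrA enorm_sqr.
Qed.

Lemma harmonic_space_gen k h : harmonic_times_radial k h -> L2 h -> harmonic_space k h.
Proof.
move=> gh Lh; split => // e e0; exists h; last first.
  rewrite (_ : (fun x => _) = (fun=> 0)); last by apply/funext => x; rewrite subrr.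
  by rewrite L2norm_lt ?rdot0l ?exprn_gt0//; exact: L2_0.
exists 1%N, (fun=> 1), (fun=> h); split => //.
by apply/funext => x; rewrite big_ord1 mul1r.
Qed.

Lemma rdot_sumr (I : Type) (r : seq I) F (G : I -> 'rV[R]_n -> R[i]) :
  L2 F -> (forall a, L2 (G a)) ->
  rdot F (fun x => \sum_(a <- r) G a x) = \sum_(a <- r) rdot F (G a).
Proof.
move=> LF LG; elim: r => [|a r IH].
  rewrite big_nil rdotC (_ : (fun x => _) = (fun=> 0)) ?rdot0l//.
  by apply/funext => x; rewrite big_nil.
rewrite big_cons -IH (_ : (fun x => _) = (fun x => G a x + \sum_(a <- r) G a x)).
  rewrite rdotC rdotDl//; first by rewrite !(rdotC F).
  exact: L2_sum.
by apply/funext => x; rewrite big_cons.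
Qed.

Lemma harmonic_span_L2 k h :
  linear_span (harmonic_times_radial k `&` @L2 R n) h -> L2 h.
Proof.
by move=> [m [c [u [hu ->]]]]; apply: L2_sum => i; apply: L2Z; exact: (hu i).2.
Qed.

(** Orthogonality extends to finite sums by linearity, then to the closure by Cauchy-Schwarz. *)
Lemma harmonic_space_orth k F v : L2 F ->
  (forall h, harmonic_times_radial k h -> L2 h -> rdot F h = 0) ->
  harmonic_space k v -> rdot F v = 0.
Proof.
move=> LF Fh [Lv vcl]; apply/eqP; apply: contrapT => /negP b0.
set N := Num.sqrt (rdot F F); have N0 : 0 <= N by exact: sqrtr_ge0.
have b1 : 0 < `|rdot F v| by rewrite normr_gt0.
(* Approximation of v to this accuracy gives |<F, v>| <= N |<F, v>| / (N + 1), a contradiction; the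
   1 covers N = 0. *)
have e0 : 0 < `|rdot F v| / (N + 1) by rewrite divr_gt0// ltr_wpDl.
have [h sh hlt] := vcl _ e0; have Lh := harmonic_span_L2 sh.
have Lvh := L2B Lv Lh.
have Fh0 : rdot F h = 0.
  move: sh => [m [c [u [hu ->]]]]; rewrite rdot_sumr//; last first.
    by move=> i; apply: L2Z; exact: (hu i).2.
  rewrite big1// => i _; apply: Fh; first exact/harmonic_times_radialZ/(hu i).1.
  by apply: L2Z; exact: (hu i).2.
have E : rdot F v = rdot F (fun x => v x - h x).
  by rewrite !(rdotC F) rdotBl// (rdotC h) Fh0 subr0.
have := rdot_CS_sqrt LF Lvh; rewrite -E leNgt => /negP; apply.
rewrite L2norm_rdot// lte_fin ltr_pdivlMr in hlt; last by rewrite ltr_wpDl.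
set D := Num.sqrt (rdot (fun x => v x - h x) _) in hlt *.
rewrite -/N; have D0 : 0 <= D by exact: sqrtr_ge0.
by nra.
Qed.

(** A radial multiplier only changes the radial factor of a generator, and multiplication by it is
    continuous on L^2 because w is bounded. *)
Lemma harmonic_spaceM k (w : R -> R) (M : R) v : measurable_fun setT w ->
  (forall t, `|w t| <= M) -> harmonic_space k v ->
  harmonic_space k (fun x => (w (nsq x))%:C * v x).
Proof.
move=> mw wM [Lv vcl].
have mwn : measurable_fun setT (fun x : 'rV[R]_n => w (nsq x)).
  exact: measurableT_comp mw (@measurable_nsq R n).
have M0 : 0 <= M by exact: le_trans (normr_ge0 _) (wM 0).
split; first by apply: (@L2_mulr _ _ (fun x => w (nsq x)) M).
move=> e e0; have d0 : 0 < e / (M + 1) by rewrite divr_gt0// ltr_wpDl.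
have [h sh hlt] := vcl _ d0; have Lh := harmonic_span_L2 sh.
have Lvh := L2B Lv Lh.
exists (fun x => (w (nsq x))%:C * h x).
  move: sh => [m [c [u [hu ->]]]].
  exists m, c, (fun i x => (w (nsq x))%:C * u i x); split.
    move=> i; split; first exact/harmonic_times_radialM/(hu i).1.
    by apply: (@L2_mulr _ _ (fun x => w (nsq x)) M) => //; exact: (hu i).2.
  by apply/funext => x; rewrite mulr_sumr; apply: eq_bigr => i _; rewrite mulrCA.
rewrite (_ : (fun x => _) = (fun x => (w (nsq x))%:C * (v x - h x))); last first.
  by apply/funext => x; rewrite mulrBr.
have Lw : L2 (fun x => (w (nsq x))%:C * (v x - h x)).
  by apply: (@L2_mulr _ _ (fun x => w (nsq x)) M).
rewrite L2norm_lt//; rewrite L2norm_lt// in hlt.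
apply: (@le_lt_trans _ _ (M ^+ 2 * rdot (fun x => v x - h x) (fun x => v x - h x))).
  rewrite /rdot -RintegralZl//; last exact: integrable_L2M.
  apply: le_Rintegral => //; [exact: integrable_L2M| |].
    have := @integrableZl _ _ _ mu setT measurableT (M ^+ 2) _ (integrable_L2M Lvh Lvh).
    by [].
  move=> x _; rewrite !RecM !ImcM; set a := Re _; set b := Im _.
  have w2 : w (nsq x) ^+ 2 <= M ^+ 2.
    by rewrite -real_normK ?num_real// lerXn2r// nnegrE.
  rewrite (_ : _ + _ = w (nsq x) ^+ 2 * (a ^+ 2 + b ^+ 2)); last by ring.
  by rewrite -!expr2 ler_wpM2r// addr_ge0 ?sqr_ge0.
apply: le_lt_trans (_ : (M + 1) ^+ 2 * rdot (fun x => v x - h x) (fun x => v x - h x) < _).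
  by rewrite ler_wpM2r ?rdot_ge0// lerXn2r ?nnegrE ?addr_ge0// lerDl.
by rewrite mulrC -ltr_pdivlMr ?exprn_gt0 ?ltr_wpDl// -expr_div_n.
Qed.

Lemma harmonic_space_perp k l u v : (2 <= n)%N -> k != l ->
  harmonic_space k u -> harmonic_space l v -> rdot u v = 0.
Proof.
move=> n2 kl hu hv; apply: (harmonic_space_orth hu.1 _ hv) => h gh Lh.
rewrite rdotC; apply: (harmonic_space_orth Lh _ hu) => g gg Lg.
by rewrite rdotC; exact: (generators_orth n2 kl).
Qed.

(** The function w = (1 - chi) Pf belongs to H_k and may serve as test vector: <f, w> = 0 since f
    lives where chi = 1, so 0 = <Pf, w> = <w, w>. Hence a projection of f vanishes almost everywhere
    off the annulus that carries f. *)
Lemma projection_off_annulus k (chi : R -> R) (f Pf : 'rV[R]_n -> R[i]) :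
  measurable_fun setT chi -> (forall t, chi t = 0 \/ chi t = 1) -> L2 f ->
  (forall x, f x = (chi (nsq x))%:C * f x) -> harmonic_space k Pf ->
  (forall h, harmonic_space k h -> rdot (fun x => f x - Pf x) h = 0) ->
  let w := fun x => (1 - chi (nsq x))%:C * Pf x in rdot w w = 0.
Proof.
move=> mchi chi01 Lf fE hP orth /=.
have hw : harmonic_space k (fun x => (1 - chi (nsq x))%:C * Pf x).
  apply: (@harmonic_spaceM k (fun t => 1 - chi t) 1) => //.
    exact: measurable_funB.
  by move=> t; have [->|->] := chi01 t; rewrite ?subr0 ?subrr ?normr1 ?normr0.
have := orth _ hw; rewrite rdotBl//; [|exact: hP.1|exact: hw.1].
rewrite [X in X - _](_ : _ = 0).
  move/eqP; rewrite sub0r oppr_eq0 => /eqP E; rewrite -[RHS]E.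
  rewrite (rdot_mulr (fun x => 1 - chi (nsq x))); apply: eq_Rintegral => x _.
  by rewrite !RecM !ImcM; have [->|->] := chi01 (nsq x); ring.
rewrite /rdot -[RHS](rdot0l Pf); apply: eq_Rintegral => x _.
by rewrite fE !RecM !ImcM /=; have [->|->] := chi01 (nsq x); ring.
Qed.

Lemma eigen_pairing (g u : 'rV[R]_n -> R) (a : R) psi : is_Ck 2 g -> is_Ck 2 u ->
  (forall x, Wop u x = - (a * nsq x * u x)) -> radial_weight psi ->
  \int[mu]_x (psi (nsq x) * ((Wop g x + a * nsq x * g x) * u x)) = 0.
Proof.
move=> cg cu uE wpsi.
have ngu : continuous (fun x => a * nsq x * g x * u x).
  apply: continuous_rV_mul (Ck_continuous cu); apply: continuous_rV_mul (Ck_continuous cg).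
  apply: continuous_rV_mul (Ck_continuous (Ck_nsq R n 0)); exact: (Ck_continuous (Ck_cst n 0 a)).
have wgu : continuous (fun x => Wop g x * u x).
  by apply: continuous_rV_mul (Ck_continuous cu); exact: (Ck_continuous (Ck_Wop (k := 0) cg)).
have i1 := integrable_radial wpsi wgu; have i2 := integrable_radial wpsi ngu.
transitivity (\int[mu]_x (psi (nsq x) * (Wop g x * u x) + psi (nsq x) * (a * nsq x * g x * u x))).
  by apply: eq_Rintegral => x _; ring.
rewrite RintegralD// (Wop_sym cg cu wpsi) -RintegralD//.
  transitivity (\int[mu]_x (0 : R)); last by rewrite Rintegral_cst ?mul0r.
  by apply: eq_Rintegral => x _; rewrite uE; ring.
apply: integrable_radial => //.
by apply: continuous_rV_mul (Ck_continuous cg) _; exact: (Ck_continuous (Ck_Wop (k := 0) cu)).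
Qed.

(** W + mu_k |x|^2 annihilates the harmonics of degree k and is symmetric, so its image is
    orthogonal to them under every radial weight. The coefficient -mu_k of the projection originates
    here. *)
Lemma laplacian_generator_orth k h (g1 g2 : 'rV[R]_n -> R) (phi : R -> R) : (2 <= n)%N ->
  is_Ck 2 g1 -> is_Ck 2 g2 -> harmonic_times_radial k h -> L2 h -> measurable_fun setT phi ->
  let F x := (phi (nsq x))%:C * ((Wop g1 x + mu_sph R n k * nsq x * g1 x) +i*
    (Wop g2 x + mu_sph R n k * nsq x * g2 x)) in
  L2 F -> rdot F h = 0.
Proof.
move=> n2 c1 c2 gh Lh mphi F LF; set a := mu_sph R n k in F LF *.
have cG (g : 'rV[R]_n -> R) : is_Ck 2 g -> continuous (fun x => Wop g x + a * nsq x * g x).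
  move=> cg; apply: continuous_rV_add; first exact: (Ck_continuous (Ck_Wop (k := 0) cg)).
  apply: continuous_rV_mul (Ck_continuous cg).
  apply: continuous_rV_mul (Ck_continuous (Ck_nsq R n 0)); exact: (Ck_continuous (Ck_cst n 0 a)).
apply: (@rdot_generator0 _ _ k h F (fun x => Wop g1 x + a * nsq x * g1 x)
  (fun x => Wop g2 x + a * nsq x * g2 x) phi) => //; [exact: leq_trans n2|exact: cG|exact: cG|].
move=> p psi sp wpsi; have hp := (solid_harmonicP k p).1 sp.
have cR := Ck_Re_peval 2 p; have cI := Ck_Im_peval 2 p.
have eR x := Wop_Re_harmonic x n2 hp; have eI x := Wop_Im_harmonic x n2 hp.
have i (g u : 'rV[R]_n -> R) : is_Ck 2 g -> is_Ck 2 u -> mu.-integrable setT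
    (EFin \o (fun x => psi (nsq x) * ((Wop g x + a * nsq x * g x) * u x))).
  move=> cg cu; apply: integrable_radial wpsi.1 _.
  exact: continuous_rV_mul (cG _ cg) (Ck_continuous cu).
split.
  under eq_Rintegral do rewrite mulrDr.
  rewrite RintegralD//; [|exact: i|exact: i].
  by rewrite (eigen_pairing c1 cR eR wpsi.1) (eigen_pairing c2 cI eI wpsi.1) addr0.
under eq_Rintegral do rewrite mulrBr.
rewrite RintegralB//; [|exact: i|exact: i].
by rewrite (eigen_pairing c2 cR eR wpsi.1) (eigen_pairing c1 cI eI wpsi.1) subr0.
Qed.

End harmonic_space_theory.

(** * Density of polynomials *)

Section weierstrass.
Context (R : realType) (n : nat).
Local Notation poly := (mpoly.mpoly n R[i]).
Implicit Types (x y : 'rV[R]_n) (F G : 'rV[R]_n -> R) (t : 'I_n -> R) (s : seq 'I_n).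

(* Expectation of [F] at the end point of the walk from [y] which, for each [i]
   in [s] in turn, makes the step [h e_i] with probability [t i]. *)
Fixpoint walk F (h : R) t s y : R :=
  if s is i :: s' then
    t i * walk F h t s' (y + h *: delta_mx ord0 i) + (1 - t i) * walk F h t s' y
  else F y.

Lemma le_walk F G h t s y : (forall i, 0 <= t i <= 1) ->
  (forall z, F z <= G z) -> walk F h t s y <= walk G h t s y.
Proof.
move=> t01 FG; elim: s y => [//|i s IH] y /=.
by have /andP[t0 t1] := t01 i; apply: lerD; apply: ler_wpM2l => //; rewrite subr_ge0.
Qed.

Lemma walkD F G h t s y :
  walk (fun z => F z + G z) h t s y = walk F h t s y + walk G h t s y.
Proof. by elim: s y => [//|i s IH] y /=; rewrite !IH; ring. Qed.

Lemma walkZ c F h t s y : walk (fun z => c * F z) h t s y = c * walk F h t s y.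
Proof. by elim: s y => [//|i s IH] y /=; rewrite !IH; ring. Qed.

Lemma walk_cst c h t s y : walk (fun=> c) h t s y = c.
Proof. by elim: s y => [//|i s IH] y /=; rewrite !IH; ring. Qed.

Lemma walk_sum (I : Type) (r : seq I) (F : I -> 'rV[R]_n -> R) h t s y :
  walk (fun z => \sum_(a <- r) F a z) h t s y = \sum_(a <- r) walk (F a) h t s y.
Proof.
elim: r => [|a r IH].
  by rewrite big_nil -[RHS](walk_cst 0 h t s y); congr walk; apply/funext => z; rewrite big_nil.
rewrite big_cons -IH -walkD; congr walk; apply/funext => z; by rewrite big_cons.
Qed.

(** Squared bias plus variance of a binomial variable: among the steps in s only those in direction
    j move the coordinate j. *)
Lemma walk_sqr j (c : R) h t s y :
  walk (fun z => (z ord0 j - c) ^+ 2) h t s y =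
  (y ord0 j + h * (count_mem j s)%:R * t j - c) ^+ 2 +
  h ^+ 2 * (count_mem j s)%:R * (t j * (1 - t j)).
Proof.
elim: s y => [|i s IH] y /=; first by rewrite !(mulr0, mul0r) !addr0.
rewrite !IH rVDE rVZE rV_deltaE natrD (eq_sym j i); have [->|_] := eqVneq i j.
  by rewrite (_ : true%:R = 1)//; ring.
by rewrite (_ : false%:R = 0)//; ring.
Qed.

(** The start and the steps do not depend on x, so the expectation is a polynomial in the
    probabilities, which are affine in x. *)
Lemma walk_poly F h (B : R) s y : exists p : poly,
  forall x, peval p x = (walk F h (fun i => (x ord0 i + B) / (2 * B)) s y)%:C.
Proof.
elim: s y => [|i s IH] y /=.
  by exists (mpoly.mpolyC n (F y)%:C) => x; exact: mpoly.mevalC.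
have [p1 p1E] := IH (y + h *: delta_mx ord0 i); have [p2 p2E] := IH y.
pose T : poly := ((2 * B)^-1)%:C *: (mpoly.mpolyX R[i] (mpoly.mnm1 i) + mpoly.mpolyC n B%:C).
have TE x : peval T x = ((x ord0 i + B) / (2 * B))%:C.
  rewrite pevalZ pevalD pevalXU [X in _ + X](_ : _ = B%:C); last exact: mpoly.mevalC.
  by rewrite -rmorphD -rmorphM mulrC.
exists (T * p1 + (1 - T) * p2) => x.
rewrite pevalD !pevalM pevalD pevalN TE p1E p2E.
rewrite [X in X - _](_ : _ = 1%:C); last exact: (peval_nat 1).
by rewrite -rmorphB -!rmorphM -rmorphD.
Qed.

(** Only x is confined to the cube, because [le_walk] compares functions at all points of R^n. *)
Lemma uniform_continuity_cube F (B e : R) : continuous F -> 0 < e ->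
  exists2 d : R, 0 < d & forall x y, cube B x ->
    (forall i, `|x ord0 i - y ord0 i| < d) -> `|F x - F y| < e.
Proof.
move=> cF e0.
have /compact_near_coveringP := @compact_cube R n B.
move=> /(_ R (0 : R)^'+ (fun d x => forall y,
  (forall i, `|x ord0 i - y ord0 i| < d) -> `|F x - F y| < e) _) H.
have H' : \forall d \near (0 : R)^'+, cube B `<=`
    (fun x => forall y, (forall i, `|x ord0 i - y ord0 i| < d) -> `|F x - F y| < e).
  apply: H => x xB.
  have e20 : 0 < e / 2 by rewrite divr_gt0.
  have /cF/nbhs_ballP[r /= r0 rF] : nbhs (F x) (ball (F x) (e / 2)) by exact: nbhsx_ballx.
  near=> x' d => y /= yd.
  have xx' : ball x (r / 2) x' by near: x'; apply: nbhsx_ballx; rewrite divr_gt0.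
  have dr : d < r / 2 by near: d; apply: nbhs_right_lt; rewrite divr_gt0.
  have x'y : ball x' (r / 2) y.
    split; first by rewrite divr_gt0.
    by move=> i j; rewrite (ord1 i) /ball/= (lt_trans (yd j)).
  have xy : ball x r y by rewrite (splitr r); exact: ball_triangle xx' x'y.
  have xx : ball x r x'.
    by rewrite (splitr r); apply: ball_triangle xx' _; apply: ballxx; rewrite divr_gt0.
  have h1 : `|F x - F x'| < e / 2 := rF _ xx.
  have h2 : `|F x - F y| < e / 2 := rF _ xy.
  rewrite (splitr e); apply: le_lt_trans (ler_distD (F x) _ _) _.
  by rewrite distrC; exact: ltrD.
near (0 : R)^'+ => d; exists d; first by near: d; exact: nbhs_right_gt.
have hd : cube B `<=`
    (fun x => forall y, (forall i, `|x ord0 i - y ord0 i| < d) -> `|F x - F y| < e).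
  by near: d.
by move=> x y xB; exact: hd.
Unshelve. all: by end_near. Qed.

(* Bernstein polynomials, by the method of Bernstein and Chebyshev: starting from
   the corner (-B, ..., -B), N steps of length 2B/N in each direction with
   probabilities t_i = (x_i + B) / (2B) lead to a point of mean x and of variance
   at most (2B)^2 / N in each coordinate. *)
Theorem weierstrass_cube F (B e : R) : 0 < B -> continuous F -> bounded_support F ->
  0 < e -> exists p : poly, forall x, cube B x ->
    `|F x - Re (peval p x)| <= e /\ Im (peval p x) = 0.
Proof.
move=> B0 cF [B' sF] e0.
have [M M0 FM'] := continuous_bounded_on_cube B' cF.
have FM x : `|F x| <= M.
  by have [->|/sF/FM'//] := eqVneq (F x) 0; rewrite normr0 ltW.
have e20 : 0 < e / 2 by rewrite divr_gt0.
have [d d0 dF] := uniform_continuity_cube B cF e20.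
pose K := 2 * M / d ^+ 2.
have K0 : 0 < K by rewrite divr_gt0 ?mulr_gt0 ?exprn_gt0.
(* Chebyshev's device: K d^2 = 2 M, so the quadratic term dominates the trivial bound as soon as one
   coordinate differs by at least d. *)
have FK x y : cube B x -> `|F y - F x| <= e / 2 + K * \sum_(j < n) (y ord0 j - x ord0 j) ^+ 2.
  move=> xB; have S0 : 0 <= \sum_(j < n) (y ord0 j - x ord0 j) ^+ 2.
    by apply: sumr_ge0 => j _; exact: sqr_ge0.
  have [near|/existsNP[j /negP]] := pselect (forall i, `|x ord0 i - y ord0 i| < d).
    rewrite distrC; apply: le_trans (ltW (dF _ _ xB near)) _.
    by rewrite lerDl mulr_ge0// ltW.
  rewrite -leNgt => dj; rewrite (le_trans (ler_normB _ _))//.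
  apply: (@le_trans _ _ (K * d ^+ 2)).
    by rewrite /K divfK ?expf_neq0 ?gt_eqF// mulr_natl mulr2n lerD.
  rewrite -[leLHS]add0r; apply: lerD; first exact: ltW.
  apply: ler_wpM2l; first exact: ltW.
  rewrite (bigD1 j)//=.
  rewrite -[leLHS]addr0 lerD//; last by apply: sumr_ge0 => i _; exact: sqr_ge0.
  rewrite -[leRHS]real_normK ?num_real// lerXn2r ?nnegrE//; first exact: ltW.
  by rewrite distrC.
pose c := K * (n%:R * (2 * B) ^+ 2).
have c0 : 0 <= c.
  by rewrite /c; apply: mulr_ge0; [exact: ltW|apply: mulr_ge0 => //; exact: sqr_ge0].
(* Chosen so that c / N <= e / 2, where c / N bounds K times the sum of the n variances. *)
pose N := (Num.trunc (c / (e / 2))).+1.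
have N0 : 0 < N%:R :> R by rewrite ltr0n.
have NcE : c / N%:R <= e / 2.
  by rewrite ler_pdivrMr// mulrC -ler_pdivrMr// ltW// truncnS_gt.
pose h := 2 * B / N%:R; pose s := flatten [seq nseq N i | i <- enum 'I_n].
have sN j : count_mem j s = N.
  rewrite /s count_flatten -map_comp (eq_map (g := fun i => N * (i == j)))%N; last first.
    by move=> i /=; rewrite count_nseq mulnC.
  rewrite sumnE big_map big_enum/= (bigD1 j)//= eqxx muln1 big1 ?addn0// => i /negbTE ->.
  by rewrite muln0.
have [p pE] := walk_poly F h B s (const_mx (- B)).
exists p => x xB; rewrite pE; split => //=.
set t := fun i => _; set W := walk _ _ _ _ _.
have t01 i : 0 <= t i <= 1.
  have := xB i; rewrite ler_norml => /andP[l r].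
  have B20 : 0 < 2 * B by rewrite mulr_gt0.
  rewrite /t ler_pdivrMr//; apply/andP; split; last by lra.
  by apply: divr_ge0; [lra|exact: ltW].
pose q (z : 'rV[R]_n) := e / 2 + K * \sum_(j < n) (z ord0 j - x ord0 j) ^+ 2.
have Q : walk q h t s (const_mx (- B)) <= e.
  rewrite walkD walk_cst walkZ walk_sum [leRHS]splitr lerD2l (le_trans _ NcE)//.
  rewrite /c -mulrA; apply: ler_wpM2l; first exact: ltW.
  rewrite (_ : _ / _ = \sum_(j < n) ((2 * B) ^+ 2 / N%:R)); last first.
    by rewrite sumr_const card_ord -[RHS]mulr_natl mulrA.
  apply: ler_sum => j _; rewrite walk_sqr sN mxE.
  rewrite (_ : - B + _ - _ = 0); last by rewrite /h /t; field; rewrite !gt_eqF.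
  rewrite expr0n add0r /h; have /andP[l r] := t01 j.
  rewrite (_ : _ * _ * _ = (2 * B) ^+ 2 / N%:R * (t j * (1 - t j))); last first.
    by field; rewrite gt_eqF.
  apply: ler_piMr; last by nra.
  by apply: divr_ge0; [exact: sqr_ge0|exact: ltW].
have up : W <= F x + e.
  apply: le_trans (_ : walk (fun z => F x + q z) h t s (const_mx (- B)) <= _).
    by apply: le_walk => // z; have := FK x z xB; rewrite -/(q z) ler_norml => /andP[_]; lra.
  by rewrite walkD walk_cst lerD2l.
have lo : F x - e <= W.
  apply: le_trans (_ : walk (fun z => F x + (-1) * q z) h t s (const_mx (- B)) <= _).
    by rewrite walkD walk_cst walkZ mulN1r lerD2l lerN2.
  by apply: le_walk => // z; have := FK x z xB; rewrite -/(q z) ler_norml => /andP[+ _]; lra.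
by rewrite ler_norml; apply/andP; split; lra.
Qed.

End weierstrass.

(** * The operators L_j *)

Section spherical.
Context (R : realType) (n : nat).
Implicit Types (x : 'rV[R]_n) (f : 'rV[R]_n -> R[i]) (g u v : 'rV[R]_n -> R) (j : 'I_n).

Definition annular_support (a b : R) g := forall x, g x != 0 -> a <= nsq x <= b.

(** The sup-norm ball about 0 that avoids the support contains the Euclidean ball of the same radius
    r, whence a = r^2. A sup-norm bound c on the support gives |x|^2 <= n c^2. *)
Lemma test_function_annulus f : test_function_off0 f ->
  exists a b : R, [/\ 0 < a, annular_support a b (fun x => Re (f x)) &
    annular_support a b (fun x => Im (f x))].
Proof.
move=> [_ cK K0].
have : nbhs (0 : 'rV[R]_n) (~` support_of f).
  by apply: open_nbhs_nbhs; split => //; apply: closed_openC; exact: closed_closure.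
move=> /nbhs_ballP[r /= r0 rK].
have [M [_ HM]] := compact_bounded cK.
(* Boundedness yields |x| <= |M| + 1 in the sup norm; one unit more makes the inequality strict, for
   membership in an open ball. *)
pose c := `|M| + 2; have c0 : 0 <= c by rewrite addr_ge0.
have nf x : f x != 0 -> r ^+ 2 <= nsq x <= n%:R * c ^+ 2.
  move=> fx; have Kx : support_of f x by exact: subset_closure.
  apply/andP; split.
    rewrite leNgt; apply/negP => xr; apply: (rK x) => //.
    split => // i j; rewrite (ord1 i) /ball/= mxE sub0r normrN.
    rewrite -(ltr_pXn2r (n := 2))// ?nnegrE ?ltW// real_normK ?num_real//.
    exact: le_lt_trans (sqr_le_nsq _ _) xr.
  have xM : `|x| <= `|M| + 1 by apply: HM => //; rewrite ltr_pwDr// ler_norm.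
  have xc : ball 0 c x.
    by rewrite mx_norm_ball /ball_/= sub0r normrN (le_lt_trans xM)// ltrD2l ltr1n.
  rewrite /nsq (_ : _ * _ = \sum_(i < n) c ^+ 2); last first.
    by rewrite sumr_const card_ord mulr_natl.
  apply: ler_sum => i _; rewrite -[leLHS]real_normK ?num_real//.
  rewrite lerXn2r ?nnegrE//; have := xc.2 ord0 i.
  by rewrite /ball/= mxE sub0r normrN => /ltW.
exists (r ^+ 2), (n%:R * c ^+ 2); split; first exact: exprn_gt0.
  by move=> x hx; apply: nf; apply: contra_neq hx => ->.
by move=> x hx; apply: nf; apply: contra_neq hx => ->.
Qed.

Lemma annular_support_near a b g x : annular_support a b g ->
  ~~ (a <= nsq x <= b) -> \forall y \near x, g y = 0.
Proof.
move=> sg hx; have cn : {for x, continuous (@nsq R n)}.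
  exact: (Ck_continuous (Ck_nsq R n 0)).
have : \forall y \near x, ~~ (a <= nsq y <= b).
  move: hx; rewrite negb_and -!ltNge => /orP[h|h].
    near=> y; rewrite negb_and -!ltNge; apply/orP; left; near: y.
    exact: (cvgr_lt _ cn).
  near=> y; rewrite negb_and -!ltNge; apply/orP; right; near: y.
  exact: (cvgr_gt _ cn).
apply: filterS => y hy; apply/eqP; apply: contraNT hy; exact: sg.
Unshelve. all: by end_near. Qed.

Lemma annular_support_dpart a b g j : annular_support a b g ->
  annular_support a b (dpart j g).
Proof.
move=> sg x; apply: contraNT => hx; apply/eqP; apply: near0_derive.
exact: annular_support_near hx.
Qed.

Lemma annular_support_Nop a b g j : annular_support a b g ->
  annular_support a b (Nop j g).
Proof.
move=> sg x; apply: contraNT => hx.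
have d0 i : dpart i g x = 0.
  by apply/eqP; apply: contraNT hx; exact: annular_support_dpart.
by rewrite /Nop /euler d0 big1 ?mulr0 ?subr0// => i _; rewrite d0 mulr0.
Qed.

Lemma annular_support_Wop a b g : annular_support a b g ->
  annular_support a b (Wop g).
Proof.
move=> sg x; apply: contraNT => hx; rewrite /Wop big1// => j _.
apply/eqP; apply: contraNT hx.
by do 2 apply: annular_support_Nop.
Qed.

Lemma Nop0 g j : Nop j g 0 = 0.
Proof.
rewrite /Nop mxE mul0r subr0 (_ : nsq 0 = 0) ?mul0r//.
by apply/eqP; rewrite nsq_eq0.
Qed.

(** N_j annihilates the radial function |x|^-2. At the origin this function is singular, but both
    sides vanish there with the coefficients of N_j. *)
Lemma Nop_nsqV u j x : is_Ck 1 u ->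
  Nop j (fun y => (nsq y)^-1 * u y) x = (nsq x)^-1 * Nop j u x.
Proof.
move=> cu; have [->|x0] := eqVneq x 0; first by rewrite !Nop0 mulr0.
have nx : nsq x != 0 by rewrite nsq_eq0.
have dE i : dpart i (fun y => (nsq y)^-1 * u y) x =
    (nsq x)^-1 * dpart i u x - 2 * x ord0 i * (nsq x)^-1 ^+ 2 * u x.
  have dV : is_derive x (delta_mx ord0 i) (fun y : 'rV[R]_n => (nsq y)^-1)
      (- (nsq x) ^- 2 * (2 * x ord0 i)).
    apply: (is_derive_comp_scalar (psi := fun t : R => t^-1)); first exact: is_derive_nsq.
    rewrite -[X in is_derive _ _ _ X]mulr1.
    exact: (@is_deriveV R id (nsq x) 1 1 nx (is_derive_id _ _)).
  have dM := is_deriveM dV (Ck_is_derive x i cu).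
  rewrite (dpart_val dM) /GRing.scale/= exprVn; ring.
rewrite /Nop /euler dE; under eq_bigr do rewrite dE mulrBr.
rewrite sumrB (_ : \sum_(i < n) x ord0 i * (2 * _ * _ * _) = 2 * (nsq x)^-1 * u x).
  rewrite (_ : \sum_(i < n) _ = (nsq x)^-1 * \sum_(i < n) x ord0 i * dpart i u x).
    by field.
  by rewrite mulr_sumr; apply: eq_bigr => i _; rewrite mulrCA.
rewrite (_ : _ * u x = nsq x * (2 * (nsq x)^-1 ^+ 2 * u x)); last by field.
by rewrite [in RHS]/nsq mulr_suml; apply: eq_bigr => i _; ring.
Qed.

Definition Sop j g x := dpart j g x -
  x ord0 j / enorm x * \sum_(i < n) x ord0 i / enorm x * dpart i g x.

Lemma spherical_derivativeE f j : spherical_derivative j f =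
  (fun x => Sop j (fun y => Re (f y)) x +i* Sop j (fun y => Im (f y)) x).
Proof.
apply/funext => x; rewrite /spherical_derivative /radial_derivative /partial.
apply: complex_eqP.
  rewrite ReD ReN RecM Re_sum; under eq_bigr do rewrite RecM.
  by [].
rewrite ImD ImN ImcM Im_sum; under eq_bigr do rewrite ImcM.
by [].
Qed.

Lemma SopE a b g j : 0 < a -> annular_support a b g ->
  Sop j g = (fun x => (nsq x)^-1 * Nop j g x).
Proof.
move=> a0 sg; apply/funext => x; have [->|x0] := eqVneq x 0.
  (* At the origin x_j / |x| is 0 by convention, so the partial derivative alone remains; it
     vanishes because a > 0 keeps the support away. *)
  rewrite Nop0 mulr0 /Sop mxE !mul0r subr0; apply/eqP.
  have n0 : nsq (0 : 'rV[R]_n) = 0 by apply/eqP; rewrite nsq_eq0.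
  apply: contraTT (a0); rewrite -leNgt => /(annular_support_dpart sg).
  by rewrite n0 => /andP[].
have nx : nsq x != 0 by rewrite nsq_eq0.
have ex := enorm_gt0 x0; rewrite /Sop /Nop /euler -enorm_sqr.
rewrite (_ : \sum_(i < n) x ord0 i / enorm x * _ =
  (enorm x)^-1 * \sum_(i < n) x ord0 i * dpart i g x); last first.
  by rewrite mulr_sumr; apply: eq_bigr => i _; ring.
by field; rewrite gt_eqF.
Qed.

Lemma Sop_SopE a b g j x : 0 < a -> annular_support a b g -> is_Ck 2 g ->
  Sop j (Sop j g) x = (nsq x)^-1 ^+ 2 * Nop j (Nop j g) x.
Proof.
move=> a0 sg cg; have sS : annular_support a b (Sop j g).
  move=> y; rewrite (SopE _ a0 sg) mulf_eq0 negb_or => /andP[_].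
  exact: annular_support_Nop.
rewrite (SopE _ a0 sS) (SopE _ a0 sg) Nop_nsqV; last exact: Ck_Nop.
by rewrite mulrA.
Qed.

Lemma sum_Sop_SopE a b g x : 0 < a -> annular_support a b g -> is_Ck 2 g ->
  \sum_(j < n) Sop j (Sop j g) x = (nsq x)^-1 ^+ 2 * Wop g x.
Proof.
move=> a0 sg cg; rewrite /Wop mulr_sumr; apply: eq_bigr => j _.
exact: (Sop_SopE _ _ a0 sg).
Qed.

End spherical.

(** * Parseval's identity *)

Section parseval.
Context (R : realType) (n : nat).
Local Notation mu := (lebesgue_rV R n).
Local Notation poly := (mpoly.mpoly n R[i]).
Implicit Types (x : 'rV[R]_n) (u v w h F G W : 'rV[R]_n -> R[i]) (k l K : nat).

Definition perp_below K v :=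
  forall k h, (k < K)%N -> harmonic_space k h -> rdot v h = 0.

(* A finite sum of elements of the harmonic spaces, as seen by the inner product. *)
Definition finite_degree W := L2 W /\
  exists K, forall v, L2 v -> perp_below K v -> rdot v W = 0.

Lemma finite_degree0 : finite_degree (fun=> 0).
Proof. by split; [exact: L2_0|exists 0%N => v _ _; rewrite rdotC rdot0l]. Qed.

Lemma finite_degreeD u w :
  finite_degree u -> finite_degree w -> finite_degree (fun x => u x + w x).
Proof.
move=> [Lu [K uK]] [Lw [L wL]]; split; first exact: L2D.
exists (maxn K L) => v Lv vKL; rewrite rdotC rdotDl// !(rdotC _ v) uK ?wL ?addr0//.
  by move=> k h kL; apply: vKL; rewrite leq_max kL orbT.
by move=> k h kL; apply: vKL; rewrite leq_max kL.
Qed.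

Lemma finite_degree_gen k h :
  harmonic_times_radial k h -> L2 h -> finite_degree h.
Proof.
move=> gh Lh; split=> //; exists k.+1 => v _; apply; first exact: ltnSn.
exact: harmonic_space_gen.
Qed.

Lemma rdot_pythagoras u w : L2 u -> L2 w -> rdot u w = 0 ->
  rdot (fun x => u x + w x) (fun x => u x + w x) = rdot u u + rdot w w.
Proof.
move=> Lu Lw uw; have LD := L2D Lu Lw.
by rewrite rdotDl// !(rdotC _ (fun x => _ + _)) !rdotDl// (rdotC w) uw addr0 add0r.
Qed.

(** The remainder E_K = F - S_K is orthogonal to H_k for k < K, hence to S_K and, for large K, to an
    approximant W. So its norm is at most that of F - W. The error of the partial sum is exactly
    <E_K, G>, which Cauchy-Schwarz makes small. *)
Lemma parseval F G (Fk Gk : nat -> 'rV[R]_n -> R[i]) : (2 <= n)%N ->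
  L2 F -> L2 G ->
  (forall k, harmonic_space k (Fk k) /\
     forall h, harmonic_space k h -> rdot (fun x => F x - Fk k x) h = 0) ->
  (forall k, harmonic_space k (Gk k) /\
     forall h, harmonic_space k h -> rdot (fun x => G x - Gk k x) h = 0) ->
  (forall e : R, 0 < e -> exists2 W, finite_degree W &
     rdot (fun x => F x - W x) (fun x => F x - W x) < e) ->
  (\sum_(0 <= k < K) rdot (Fk k) (Gk k)) @[K --> \oo] --> rdot F G.
Proof.
move=> n2 LF LG hF hG dense.
have LFk k : L2 (Fk k) by have [[]] := hF k.
have LGk k : L2 (Gk k) by have [[]] := hG k.
pose S K x := \sum_(0 <= k < K) Fk k x.
have LS K : L2 (S K) by exact: L2_sum.
pose E K x := F x - S K x.
have LE K : L2 (E K) by exact: L2B.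
have EK K : perp_below K (E K).
  move=> k h kK hh; rewrite /E rdotBl ?hh.1//; last exact: hh.1.
  rewrite (rdotC (S K)) rdot_sumr//; last exact: hh.1.
  rewrite (bigD1_seq k) ?iota_uniq ?mem_index_iota//= big1 ?addr0.
    by rewrite (rdotC h) -rdotBl//; [exact: (hF k).2|exact: hh.1].
  by move=> l lk; rewrite rdotC; apply: (harmonic_space_perp n2 lk) => //; exact: (hF l).1.
have ES K : rdot (E K) (S K) = 0.
  rewrite rdot_sumr// big_seq big1// => k; rewrite mem_index_iota => /andP[_ kK].
  by apply: EK kK _; exact: (hF k).1.
have sumE K : rdot F G - \sum_(0 <= k < K) rdot (Fk k) (Gk k) = rdot (E K) G.
  rewrite rdotBl// (rdotC (S K)) rdot_sumr//; congr (_ - _).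
  apply: eq_bigr => k _; have := (hG k).2 _ (hF k).1.
  by rewrite rdotBl// => /eqP; rewrite subr_eq0 => /eqP ->; rewrite rdotC.
apply/cvgrPdist_lt => e e0.
set N := rdot G G; have N0 : 0 <= N by exact: rdot_ge0.
have d0 : 0 < e ^+ 2 / (N + 1) by rewrite divr_gt0 ?exprn_gt0// ltr_wpDl.
have [W [LW [K0 WK]] Wd] := dense _ d0.
near=> K; rewrite sumE.
have K0K : (K0 <= K)%N by near: K; exact: nbhs_infty_ge.
have EW : rdot (E K) W = 0.
  by apply: WK => // k h kK0; apply: EK; exact: leq_trans kK0 K0K.
have LSW := L2B (LS K) LW.
have Ed : rdot (E K) (E K) < e ^+ 2 / (N + 1).
  (* F - W = E_K + (S_K - W) with orthogonal terms, so Pythagoras bounds E_K. *)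
  apply: le_lt_trans Wd; rewrite (_ : (fun x => F x - W x) =
      (fun x => E K x + (S K x - W x))); last first.
    by apply/funext => x; rewrite /E addrA subrK.
  rewrite rdot_pythagoras ?lerDl ?rdot_ge0//.
  by rewrite rdotC rdotBl// !(rdotC _ (E K)) ES EW subrr.
have D0 : 0 <= rdot (E K) (E K) by exact: rdot_ge0.
rewrite -(ltr_pXn2r (n := 2))// ?nnegrE ?ltW// real_normK ?num_real//.
apply: le_lt_trans (rdot_CS (LE K) LG) _; rewrite -/N.
rewrite ltr_pdivlMr in Ed; last by rewrite ltr_wpDl.
by nra.
Unshelve. all: by end_near. Qed.

Lemma radial_weightM (w1 w2 : R -> R) : radial_weight w1 -> radial_weight w2 ->
  radial_weight (fun t => w1 t * w2 t).
Proof.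
move=> [m1 [M1 b1] [c z1]] [m2 [M2 b2] _]; split; first exact: measurable_funM.
  by exists (M1 * M2) => t; rewrite normrM ler_pM.
by exists c => t ct; rewrite z1// mul0r.
Qed.

Lemma L2_radial (w : R -> R) (G1 G2 : 'rV[R]_n -> R) : radial_weight w ->
  continuous G1 -> continuous G2 ->
  L2 (fun x => (w (nsq x))%:C * (G1 x +i* G2 x)).
Proof.
move=> rw c1 c2; apply/L2P.
have mw : measurable_fun setT (fun x : 'rV[R]_n => w (nsq x)).
  by case: rw => mw _ _; exact: measurableT_comp mw (@measurable_nsq R n).
have H (g : 'rV[R]_n -> R) : continuous g ->
    measurable_fun setT (fun x => w (nsq x) * g x) /\
    mu.-integrable setT (EFin \o (fun x => (w (nsq x) * g x) ^+ 2)).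
  move=> cg; split; first exact: measurable_funM mw (continuous_measurable_rV cg).
  rewrite (_ : _ \o _ = EFin \o (fun x => (w (nsq x) * w (nsq x)) * (g x * g x))).
    apply: (@integrable_radial _ _ (fun t => w t * w t) (fun x => g x * g x)).
      exact: radial_weightM.
    exact: continuous_rV_mul.
  by apply/funext => x /=; congr EFin; ring.
have [m1 i1] := H _ c1; have [m2 i2] := H _ c2.
by split; under eq_fun do rewrite ?RecM ?ImcM/=.
Qed.

(** In the Fischer decomposition of q each term |x|^(2 j) h, with h of degree m, equals r^(2 j + m)
    h(x / |x|) for r = |x|, so that times w(r^2) it is a generator of H_m. *)
Lemma finite_degree_poly (w : R -> R) (q : poly) : (0 < n)%N -> radial_weight w ->
  finite_degree (fun x => (w (nsq x))%:C * peval q x).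
Proof.
move=> n0 rw; move: q.
apply: (@fischer_ind_all n R[i] (fun q => finite_degree (fun x => (w (nsq x))%:C * peval q x)) n0).
  rewrite (_ : (fun x => _) = (fun=> 0)); first exact: finite_degree0.
  by apply/funext => x; rewrite peval0 mulr0.
move=> j m h p hh hp.
rewrite (_ : (fun x => _) = (fun x => (w (nsq x))%:C * peval (pnsq n R[i] ^+ j * h) x +
    (w (nsq x))%:C * peval p x)); last by apply/funext => x; rewrite pevalD mulrDr.
apply: finite_degreeD hp; have sh := (solid_harmonicP m h).2 hh.
apply: (@finite_degree_gen m).
  exists h, (fun r => (w (r ^+ 2) * (r ^+ 2) ^+ j * r ^+ m)%:C); split; first exact: sh.
  apply/funext => x; rewrite meval_div_enorm (peval_homog _ _ sh) pevalM pevalX peval_nsq.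
  rewrite -rmorphXn !mulrA -!rmorphM enorm_sqr.
  (* At the origin r^m (r^-1)^m is 0 rather than 1 when m > 0, but then h vanishes there, being
     homogeneous of positive degree. *)
  have [x0|x0] := eqVneq x 0; last first.
    have ex := enorm_gt0 x0; congr (_%:C * _).
    by rewrite -[RHS]mulrA -exprMn divff ?gt_eqF// expr1n mulr1.
  have [m0|m0] := posnP m; first by rewrite m0 !expr0 !mulr1.
  have -> : peval h x = 0.
    have := peval_homog 0 x sh; rewrite scale0r expr0n (gtn_eqF m0) mul0r x0.
    by [].
  by rewrite !mulr0.
rewrite (_ : (fun x => _) = (fun x => (w (nsq x))%:C *
  (Re (peval (pnsq n R[i] ^+ j * h) x) +i* Im (peval (pnsq n R[i] ^+ j * h) x)))).
  apply: L2_radial => //; first exact: (Ck_continuous (Ck_Re_peval 0 _)).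
  exact: (Ck_continuous (Ck_Im_peval 0 _)).
by apply/funext => x; congr (_ * _); case: (peval _ x).
Qed.

(** The weight vanishes off a cube, so polynomials uniformly close to G1 and G2 on that cube give an
    error at most 2 d^2 w^2 pointwise, and w^2 is integrable. *)
Lemma finite_degree_dense (w : R -> R) (G1 G2 : 'rV[R]_n -> R) (e : R) :
  (0 < n)%N -> radial_weight w ->
  continuous G1 -> continuous G2 -> bounded_support G1 -> bounded_support G2 ->
  0 < e -> exists2 W, finite_degree W &
    let D x := (w (nsq x))%:C * (G1 x +i* G2 x) - W x in rdot D D < e.
Proof.
move=> n0 rw c1 c2 s1 s2 e0; have [_ _ [c wc]] := rw.
have rw2 := radial_weightM rw rw.
have iw : mu.-integrable setT (EFin \o (fun x => w (nsq x) * w (nsq x))).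
  have := integrable_radial rw2 (Ck_continuous (Ck_cst n 0 1)).
  by apply: eq_integrable => // x _ /=; rewrite mulr1.
set C := \int[mu]_x (w (nsq x) * w (nsq x)).
have C0 : 0 <= C by apply: Rintegral_ge0 => x _; rewrite -expr2 sqr_ge0.
(* Chosen so that 2 d^2 (C + 1) = e; the 1 makes the final inequality strict and avoids a division
   by 0. *)
pose d := Num.sqrt (e / (2 * (C + 1))).
have C10 : 0 < 2 * (C + 1) by rewrite mulr_gt0// ltr_wpDl.
have d0 : 0 < d by rewrite sqrtr_gt0 divr_gt0.
have dE : d ^+ 2 * (2 * (C + 1)) = e.
  by rewrite sqr_sqrtr ?divr_ge0 ?ltW// divfK ?gt_eqF.
pose B := `|c| + 1; have B0 : 0 < B by rewrite ltr_wpDl.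
have cB x : ~ cube B x -> w (nsq x) = 0.
  move=> xB; apply: wc; rewrite ltNge; apply/negP => h; apply: xB.
  by apply: nsq_le_cube; apply: le_trans h (ler_norm _).
have [p1 p1E] := weierstrass_cube B0 c1 s1 d0.
have [p2 p2E] := weierstrass_cube B0 c2 s2 d0.
pose q := p1 + 'i *: p2.
exists (fun x => (w (nsq x))%:C * peval q x); first exact: finite_degree_poly.
move=> D.
have DE x : Re (D x) * Re (D x) + Im (D x) * Im (D x) <= 2 * d ^+ 2 * (w (nsq x) * w (nsq x)).
  rewrite /D -mulrBr RecM ImcM !ReD !ImD !ReN !ImN /q pevalD pevalZ ReD ImD ReM ImM /=.
  have [xB|/cB ->] := pselect (cube B x); last by rewrite !mul0r addr0 mulr0.
  have [h1 ->] := p1E _ xB; have [h2 ->] := p2E _ xB.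
  have sqd (a : R) : `|a| <= d -> a ^+ 2 <= d ^+ 2.
    by move=> ad; rewrite -real_normK ?num_real// lerXn2r ?nnegrE ?(ltW d0).
  move: h1 h2 => /sqd + /sqd.
  set a1 := G1 x; set a2 := G2 x; set b1 := Re _; set b2 := Re _ => h1 h2.
  rewrite !(mul0r, mul1r, subr0, add0r, addr0).
  have := sqr_ge0 (w (nsq x)); rewrite expr2; set ww := w (nsq x) => hw.
  rewrite (_ : _ + _ = (ww * ww) * ((a1 - b1) ^+ 2 + (a2 - b2) ^+ 2)); last by ring.
  by rewrite mulrC; apply: ler_wpM2r => //; lra.
have LG := L2_radial rw c1 c2.
have LD : L2 D by apply: L2B => //; exact: (finite_degree_poly q n0 rw).1.
apply: (@le_lt_trans _ _ (2 * d ^+ 2 * C)).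
  rewrite /C -RintegralZl//; apply: le_Rintegral => //; first exact: integrable_L2M.
  exact: (@integrableZl _ _ _ mu setT measurableT (2 * d ^+ 2) _ iw).
by rewrite -dE; have := exprn_gt0 2 d0; nra.
Qed.

End parseval.

(** * The inverse of |x|^2 cut off to an annulus *)

Section inverse_weight.
Context (R : realType) (n : nat).
Local Notation mu := (lebesgue_rV R n).
Implicit Types (x : 'rV[R]_n) (g : 'rV[R]_n -> R) (u v : 'rV[R]_n -> R[i]).
Implicit Types (a b t : R).

(** On the annulus this is |x|^-2. For a > 0 the cut-off makes it bounded, so multiplication by it
    preserves L^2 and every H_k. *)
Definition inv_weight a b t : R := \1_`[a, b] t * t `^ (-1).

Lemma indic_itvcc a b t : \1_`[a, b] t = (a <= t <= b)%R%:R :> R.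
Proof. by rewrite indicE mem_setE in_itv/=. Qed.

Lemma annular_weight_itvcc a b : 0 < a -> annular_weight (\1_`[a, b] : R -> R).
Proof.
move=> a0; split; last first.
  exists a => // t ta; rewrite indic_itvcc leNgt ta//.
split; first exact: measurable_indic.
  exists 1 => t; rewrite indic_itvcc; case: (_ <= _ <= _); by rewrite ?normr1 ?normr0.
by exists b => t bt; rewrite indic_itvcc andbC leNgt bt.
Qed.

Lemma annular_weight_inv_weight a b : 0 < a -> annular_weight (inv_weight a b).
Proof. by move=> a0; apply: annular_weight_inv; exact: annular_weight_itvcc. Qed.

Lemma inv_weightE a b t : 0 < a -> inv_weight a b t = \1_`[a, b] t * t^-1.
Proof.
move=> a0; rewrite /inv_weight indic_itvcc; have [/andP[at_ _]|_] := boolP (a <= t <= b).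
  by rewrite powR_inv1// (le_trans _ at_)// ltW.
by rewrite !mul0r.
Qed.

Lemma inv_weight_bounded a b : 0 < a -> exists M, forall t, `|inv_weight a b t| <= M.
Proof. by move=> /(annular_weight_inv_weight b)[[]]. Qed.

Lemma measurable_inv_weight a b : 0 < a -> measurable_fun setT (inv_weight a b).
Proof. by move=> /(annular_weight_inv_weight b)[[]]. Qed.

Lemma inv_weight_mul a b g x : 0 < a -> annular_support a b g ->
  inv_weight a b (nsq x) * g x = (nsq x)^-1 * g x.
Proof.
move=> a0 sg; have [->|/sg abx] := eqVneq (g x) 0; first by rewrite !mulr0.
by rewrite inv_weightE// indic_itvcc abx mul1r.
Qed.

Lemma annular_indic_mul a b g x : annular_support a b g ->
  \1_`[a, b] (nsq x) * g x = g x.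
Proof.
move=> sg; have [->|/sg abx] := eqVneq (g x) 0; first by rewrite mulr0.
by rewrite indic_itvcc abx mul1r.
Qed.

Lemma annular_bounded_support a b g : annular_support a b g -> bounded_support g.
Proof. by move=> sg; exists (b + 1) => x /sg/andP[_]; exact: nsq_le_cube. Qed.

Lemma L2norm_sqr_integral u (c : R) : 0 <= c ->
  (\int[mu]_x (Re (u x) ^+ 2 + Im (u x) ^+ 2)%:E = c%:E)%E -> (L2norm u ^+ 2 = c%:E)%E.
Proof.
move=> c0 H; rewrite L2normE H poweR_EFin -EFin_expe.
by rewrite powR12_sqrt// sqr_sqrtr.
Qed.

(* Modulo a null set, the projection vanishes off the annulus that carries [f]. *)
Lemma L2norm_projection_div a b k u v : 0 < a -> L2 u ->
  (forall x, u x = (\1_`[a, b] (nsq x))%:C * u x) -> harmonic_space k v ->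
  (forall h, harmonic_space k h -> rdot (fun x => u x - v x) h = 0) ->
  let w := fun x => (inv_weight a b (nsq x))%:C * v x in
  (L2norm (fun x => (v x / ((enorm x) ^+ 2)%:C)%R) ^+ 2 = (rdot w w)%:E)%E.
Proof.
move=> a0 Lu uE hv orth w.
have Lv : L2 v by case: hv.
have [M bM] := inv_weight_bounded b a0.
have minv := measurable_inv_weight b a0.
have mn := @measurable_nsq R n.
have mw : measurable_fun setT (fun x : 'rV[R]_n => inv_weight a b (nsq x)).
  exact: measurableT_comp minv mn.
have Lw : L2 w by apply: (@L2_mulr _ _ (fun x => inv_weight a b (nsq x)) M).
have mchi : measurable_fun setT (\1_`[a, b] : R -> R) by exact: measurable_indic.
have chi01 t : \1_`[a, b] t = 0 :> R \/ \1_`[a, b] t = 1 :> R.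
  by rewrite indic_itvcc; case: (_ <= _ <= _); [right|left].
have := projection_off_annulus mchi chi01 Lu uE hv orth.
set o := fun x => _ => o0.
have Lo : L2 o.
  apply: (@L2_mulr _ _ (fun x => 1 - \1_`[a, b] (nsq x)) 1) => //.
    by apply: measurable_funB => //; exact: measurableT_comp mchi mn.
  by move=> x; have [->|->] := chi01 (nsq x); rewrite ?subr0 ?subrr ?normr1 ?normr0.
have sq_EFin (g1 g2 : R) : g1 ^+ 2 + g2 ^+ 2 = g1 * g1 + g2 * g2 by rewrite !expr2.
(* The part [o] of v off the annulus has zero norm, so v vanishes almost everywhere there and the
   cut-off in [inv_weight] changes nothing. *)
have o_ae : ae_eq mu setT (fun x => (Re (o x) * Re (o x) + Im (o x) * Im (o x))%:E) (cst 0%E).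
  have iO := integrable_L2M Lo Lo; have mO := measurable_int _ iO.
  apply/(ae_eq_integral_abs mu measurableT mO).
  transitivity (\int[mu]_x (Re (o x) * Re (o x) + Im (o x) * Im (o x))%:E)%E.
    by apply: eq_integral => x _ /=; rewrite ger0_norm// addr_ge0// -expr2 sqr_ge0.
  have := o0; rewrite /rdot /Rintegral => o0'.
  by rewrite -[LHS]fineK ?o0'//; exact: integrable_fin_num.
apply: L2norm_sqr_integral; first exact: rdot_ge0.
have iw := integrable_L2M Lw Lw.
rewrite /rdot /Rintegral fineK; last exact: integrable_fin_num.
have [mR mI _ _] := (L2P v).1 Lv.
have vE x : Re (v x / ((enorm x) ^+ 2)%:C) = (nsq x)^-1 * Re (v x) /\
            Im (v x / ((enorm x) ^+ 2)%:C) = (nsq x)^-1 * Im (v x).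
  rewrite enorm_sqr mulrC (_ : ((nsq x)%:C)^-1 = ((nsq x)^-1)%:C); last first.
    by rewrite fmorphV.
  by rewrite RecM ImcM.
have mV : measurable_fun setT (fun x : 'rV[R]_n => (nsq x)^-1).
  rewrite (_ : (fun x => _) = (fun x : 'rV[R]_n => nsq x `^ (-1))).
    exact: measurableT_comp (measurable_powR _) mn.
  by apply/funext => x; rewrite powR_inv1 ?nsq_ge0.
apply: ge0_ae_eq_integral => //.
- apply/measurable_EFinP; under eq_fun do rewrite (vE _).1 (vE _).2.
  by apply: measurable_funD; apply: measurable_funX; exact: measurable_funM.
- exact: measurable_int iw.
- by move=> x _; rewrite lee_fin addr_ge0 ?sqr_ge0.
- by move=> x _; rewrite lee_fin addr_ge0// -expr2 sqr_ge0.
apply: filterS o_ae => x /= ox xT; have {}ox := ox xT.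
congr EFin; rewrite (vE x).1 (vE x).2 !expr2.
rewrite /w !RecM !ImcM inv_weightE//; have [z|->] := chi01 (nsq x); last by rewrite mul1r.
move: ox; rewrite /o !RecM !ImcM z subr0 !mul1r => -[] /eqP.
by rewrite paddr_eq0 -?expr2 ?sqr_ge0// !sqrf_eq0 => /andP[/eqP -> /eqP ->]; rewrite !mulr0.
Qed.

End inverse_weight.

(** * Projections of sum_j L_j^2 f and the two norms *)

Section decomposition.
Context (R : realType) (n : nat) (a b : R) (f : 'rV[R]_n -> R[i]) (Pf : nat -> 'rV[R]_n -> R[i]).
Local Notation mu := (lebesgue_rV R n).
Local Notation f1 := (fun x => Re (f x)).
Local Notation f2 := (fun x => Im (f x)).
Local Notation m := (inv_weight a b).
Implicit Types (x : 'rV[R]_n) (h : 'rV[R]_n -> R[i]) (k : nat) (j : 'I_n).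
Hypotheses (n2 : (2 <= n)%N) (a0 : 0 < a).
Hypotheses (sm : smooth f) (s1 : annular_support a b f1) (s2 : annular_support a b f2).
Hypothesis hPf : forall k, harmonic_space k (Pf k) /\
  forall h, harmonic_space k h -> rdot (fun x => f x - Pf k x) h = 0.

Let wm : radial_weight m := (annular_weight_inv_weight b a0).1.
Let wmm : radial_weight (fun t => m t * m t) := radial_weightM wm wm.
Let n0 : (0 < n)%N. Proof. exact: leq_trans n2. Qed.
Let c1 k : is_Ck k f1 := (sm k).1.
Let c2 k : is_Ck k f2 := (sm k).2.
(* On the annulus [Tf] is sum_j L_j^2 f, [w] is f / |x|^2 and [wk k] is
   P_k f / |x|^2; off the annulus they vanish. *)
Let Tf x : R[i] := (m (nsq x) * m (nsq x))%:C * (Wop f1 x +i* Wop f2 x).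
Let w x : R[i] := (m (nsq x))%:C * f x.
Let wk k x : R[i] := (m (nsq x))%:C * Pf k x.

Let fE x : f x = f1 x +i* f2 x. Proof. exact: complex_eqP. Qed.

Let contW g : is_Ck 2 g -> continuous (@Wop R n g).
Proof. by move=> cg; exact: (Ck_continuous (Ck_Wop (k := 0) cg)). Qed.

Lemma L2_test_function : L2 f.
Proof.
have := L2_radial (annular_weight_itvcc b a0).1 (Ck_continuous (c1 0)) (Ck_continuous (c2 0)).
apply: L2_ext => x; apply: complex_eqP; rewrite ?RecM ?ImcM.
  exact: annular_indic_mul s1.
exact: annular_indic_mul s2.
Qed.

Let L2Tf : L2 Tf.
Proof. by apply: (L2_radial wmm); apply: contW. Qed.

Let L2w : L2 w.
Proof.
have := L2_radial wm (Ck_continuous (c1 0)) (Ck_continuous (c2 0)).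
by apply: L2_ext => x; rewrite /w fE.
Qed.

Let mM k h : harmonic_space k h -> harmonic_space k (fun x => (m (nsq x))%:C * h x).
Proof.
have [M bM] := inv_weight_bounded b a0.
by apply: harmonic_spaceM bM; exact: measurable_inv_weight.
Qed.

(** Multiplication by the bounded radial weight m is self-adjoint and maps H_k to itself, so it
    commutes with the projection on H_k. *)
Let wk_orth k h : harmonic_space k h -> rdot (fun x => w x - wk k x) h = 0.
Proof.
move=> hh; rewrite -((hPf k).2 _ (mM hh)) -rdot_mulr.
by congr rdot; apply/funext => x; rewrite mulrBr.
Qed.

Let negmu_mul k h : harmonic_space k h ->
  harmonic_space k (fun x => (- mu_sph R n k)%:C * h x).
Proof.
by apply: (@harmonic_spaceM R n k (fun=> - mu_sph R n k) `|mu_sph R n k|) => // t; rewrite normrN.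
Qed.

(** Write [Tf] + mu_k [wk k] = F - mu_k ([w] - [wk k]), where F is m^2 times (W + mu_k |x|^2) f.
    Then F is orthogonal to H_k by symmetry of W, and [w] - [wk k] because m commutes with the
    projection. *)
Let Tf_orth k h : harmonic_space k h ->
  rdot (fun x => Tf x - (- mu_sph R n k)%:C * wk k x) h = 0.
Proof.
have hQ : harmonic_space k (fun x => (- mu_sph R n k)%:C * wk k x).
  by apply: negmu_mul; apply: mM; exact: (hPf k).1.
apply: harmonic_space_orth; first by apply: L2B => //; exact: hQ.1.
move=> g gg Lg.
have hg := harmonic_space_gen gg Lg.
pose F x := (m (nsq x) * m (nsq x))%:C * ((Wop f1 x + mu_sph R n k * nsq x * f1 x) +i*
    (Wop f2 x + mu_sph R n k * nsq x * f2 x)).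
have cG (u : 'rV[R]_n -> R) : is_Ck 2 u ->
    continuous (fun x => Wop u x + mu_sph R n k * nsq x * u x).
  move=> cu; apply: continuous_rV_add; first exact: contW.
  apply: continuous_rV_mul (Ck_continuous cu).
  apply: continuous_rV_mul (Ck_continuous (Ck_nsq R n 0)); exact: (Ck_continuous (Ck_cst n 0 _)).
have LF : L2 F by apply: (L2_radial wmm); exact: cG.
have mmm : measurable_fun setT (fun t => m t * m t) by case: wmm.
have F0 : rdot F g = 0 := laplacian_generator_orth n2 (c1 2) (c2 2) gg Lg mmm LF.
(* On the annulus m is |x|^-2, so one factor m cancels |x|^2. *)
have mf (u : 'rV[R]_n -> R) x : annular_support a b u ->
    m (nsq x) * m (nsq x) * (nsq x * u x) = m (nsq x) * u x.
  move=> su; have [->|/su/andP[ax _]] := eqVneq (u x) 0; first by rewrite !mulr0.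
  have nx : nsq x != 0 by rewrite gt_eqF// (lt_le_trans a0).
  rewrite -mulrA; congr (_ * _).
  by rewrite mulrCA (inv_weight_mul _ a0 su) mulrA divff// mul1r.
have E x : Tf x - (- mu_sph R n k)%:C * wk k x = F x - (mu_sph R n k)%:C * (w x - wk k x).
  apply: complex_eqP; rewrite /Tf /F /w /wk !(ReD, ImD, ReN, ImN, RecM, ImcM) /=.
    by rewrite -(mf f1) //; ring.
  by rewrite -(mf f2) //; ring.
have Lwk : L2 (wk k) by exact: (mM (hPf k).1).1.
rewrite (_ : (fun x => _) = (fun x => F x - (mu_sph R n k)%:C * (w x - wk k x))); last first.
  by apply/funext => x; exact: E.
rewrite rdotBl//; last by apply: L2_realZ; exact: L2B.
by rewrite rdotZl//; [rewrite F0 wk_orth// mulr0 subr0|exact: L2B].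
Qed.

Let Tf_dense (e : R) : 0 < e -> exists2 W, finite_degree W &
  rdot (fun x => Tf x - W x) (fun x => Tf x - W x) < e.
Proof.
have sW g : annular_support a b g -> bounded_support (@Wop R n g).
  by move=> /annular_support_Wop; exact: annular_bounded_support.
exact: (finite_degree_dense n0 wmm (contW (c1 2)) (contW (c2 2)) (sW _ s1) (sW _ s2)).
Qed.

Lemma laplacian_norm_cvg :
  (\sum_(0 <= k < K) mu_sph R n k ^+ 2 * rdot (wk k) (wk k)) @[K --> \oo] --> rdot Tf Tf.
Proof.
have hT k : harmonic_space k (fun x => (- mu_sph R n k)%:C * wk k x) /\
   forall h, harmonic_space k h -> rdot (fun x => Tf x - (- mu_sph R n k)%:C * wk k x) h = 0.
  by split; [apply: negmu_mul; apply: mM; exact: (hPf k).1|exact: Tf_orth].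
rewrite (_ : (fun K => _) = (fun K => \sum_(0 <= k < K)
    rdot (fun x => (- mu_sph R n k)%:C * wk k x) (fun x => (- mu_sph R n k)%:C * wk k x))).
  exact: (parseval n2 L2Tf L2Tf hT hT Tf_dense).
apply/funext => K; apply: eq_bigr => k _.
have Lwk : L2 (wk k) by exact: (mM (hPf k).1).1.
rewrite rdotZl//; last exact: L2_realZ.
by rewrite rdotC rdotZl// mulrA mulrNN expr2.
Qed.

Lemma laplacian_pairing_cvg :
  (\sum_(0 <= k < K) mu_sph R n k * rdot (wk k) (wk k)) @[K --> \oo] --> - rdot Tf w.
Proof.
have hT k : harmonic_space k (fun x => (- mu_sph R n k)%:C * wk k x) /\
   forall h, harmonic_space k h -> rdot (fun x => Tf x - (- mu_sph R n k)%:C * wk k x) h = 0.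
  by split; [apply: negmu_mul; apply: mM; exact: (hPf k).1|exact: Tf_orth].
have hw k : harmonic_space k (wk k) /\
   forall h, harmonic_space k h -> rdot (fun x => w x - wk k x) h = 0.
  by split; [apply: mM; exact: (hPf k).1|exact: wk_orth].
rewrite (_ : (fun K => _) = (fun K => - \sum_(0 <= k < K)
    rdot (fun x => (- mu_sph R n k)%:C * wk k x) (wk k))).
  exact: cvgN (parseval n2 L2Tf L2w hT hw Tf_dense).
apply/funext => K; rewrite -sumrN; apply: eq_bigr => k _.
have Lwk : L2 (wk k) by exact: (mM (hPf k).1).1.
by rewrite rdotZl// mulNr opprK.
Qed.

Lemma laplacian_norm :
  (L2norm (fun x => (\sum_(j < n) spherical_derivative j (spherical_derivative j f) x)%R) ^+ 2
   = (rdot Tf Tf)%:E)%E.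
Proof.
rewrite -L2norm_sqr//; congr (L2norm _ ^+ 2)%E; apply/funext => x.
under eq_bigr do rewrite !spherical_derivativeE/=.
have E g : annular_support a b g -> is_Ck 2 g ->
    \sum_(j < n) Sop j (Sop j g) x = m (nsq x) * m (nsq x) * Wop g x.
  move=> sg cg; rewrite (sum_Sop_SopE x a0 sg cg) expr2.
  have e := inv_weight_mul x a0 (annular_support_Wop sg).
  by rewrite -[RHS]mulrA e mulrCA e mulrA.
apply: complex_eqP; first by rewrite Re_sum RecM -(E _ s1 (c1 2)).
by rewrite Im_sum ImcM -(E _ s2 (c2 2)).
Qed.

(** On the annulus this is |x|^-6: |x|^-4 from the square of L_j = |x|^-2 N_j and |x|^-2 from the
    division by |x|. The same weight arises in [rdot Tf w], as m^2 from [Tf] times m from [w]. *)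
Let mmm t := m t * m t * m t.
Let wmmm : radial_weight mmm := radial_weightM wmm wm.

Let iN g j : is_Ck 2 g ->
  mu.-integrable setT (EFin \o (fun x => mmm (nsq x) * (Nop j g x * Nop j g x))).
Proof.
move=> cg; apply: integrable_radial => //.
have cN := Ck_continuous (Ck_Nop (k := 1) j cg).
exact: continuous_rV_mul.
Qed.

Lemma gradient_norm j :
  (L2norm (fun x => (spherical_derivative j f x / (enorm x)%:C)%R) ^+ 2 =
  (\int[mu]_x (mmm (nsq x) * (Nop j f1 x * Nop j f1 x)) +
   \int[mu]_x (mmm (nsq x) * (Nop j f2 x * Nop j f2 x)))%R%:E)%E.
Proof.
have i1 := iN j (c1 2); have i2 := iN j (c2 2).
have m0 t : 0 <= m t.
  rewrite /inv_weight mulr_ge0 ?powR_ge0// indic_itvcc; by case: (_ <= _ <= _).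
apply: L2norm_sqr_integral.
  have mmm0 t : 0 <= mmm t by rewrite /mmm; do 2 (apply: mulr_ge0 => //).
  by apply: addr_ge0; apply: Rintegral_ge0 => x _; apply: mulr_ge0; rewrite // -expr2 sqr_ge0.
rewrite -RintegralD// /Rintegral fineK; last first.
  by apply: integrable_fin_num => //; exact: (@integrableD _ _ _ mu setT measurableT _ _ i1 i2).
apply: eq_integral => x _; congr EFin.
rewrite spherical_derivativeE mulrC -fmorphV RecM ImcM /=.
rewrite (SopE _ a0 s1) (SopE _ a0 s2) !exprMn exprVn enorm_sqr.
have E g : annular_support a b g -> mmm (nsq x) * (g x * g x) =
   (nsq x)^-1 * ((nsq x)^-1 ^+ 2 * g x ^+ 2).
  move=> sg; have [->|gx] := eqVneq (g x) 0; first by rewrite expr0n /= !mulr0.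
  rewrite /mmm; have -> : m (nsq x) = (nsq x)^-1.
    by apply: (mulIf gx); exact: (inv_weight_mul _ a0 sg).
  by ring.
rewrite (E _ (annular_support_Nop (j := j) s1)) (E _ (annular_support_Nop (j := j) s2)).
by ring.
Qed.

(** Both sides carry the weight m^3, so this is [Wop_ibp] applied to the real and to the imaginary
    part of f. *)
Lemma gradient_pairing :
  (\sum_(j < n) L2norm (fun x => (spherical_derivative j f x / (enorm x)%:C)%R) ^+ 2 =
   (- rdot Tf w)%:E)%E.
Proof.
under eq_bigr do rewrite gradient_norm.
rewrite sumEFin; congr EFin; rewrite big_split/=.
have ibp g : is_Ck 2 g -> \sum_(j < n) \int[mu]_x (mmm (nsq x) * (Nop j g x * Nop j g x)) =
    - \int[mu]_x (mmm (nsq x) * (Wop g x * g x)).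
  move=> cg; rewrite (Wop_ibp cg (Ck_weaken cg) wmmm) opprK.
  have [_ <-] := Rintegral_sum (index_enum 'I_n) (fun j => iN j cg).
  by apply: eq_Rintegral => x _; rewrite mulr_sumr.
have iW g : is_Ck 2 g ->
    mu.-integrable setT (EFin \o (fun x => mmm (nsq x) * (Wop g x * g x))).
  move=> cg; apply: integrable_radial wmmm _.
  by apply: continuous_rV_mul (Ck_continuous cg); exact: contW.
have -> : rdot Tf w = \int[mu]_x (mmm (nsq x) * (Wop f1 x * f1 x)) +
    \int[mu]_x (mmm (nsq x) * (Wop f2 x * f2 x)).
  rewrite -(RintegralD measurableT (iW _ (c1 2)) (iW _ (c2 2))).
  apply: eq_Rintegral => x _.
  have -> : Re (Tf x) = m (nsq x) * m (nsq x) * Wop f1 x by exact: RecM.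
  have -> : Im (Tf x) = m (nsq x) * m (nsq x) * Wop f2 x by exact: ImcM.
  rewrite /w RecM ImcM /mmm; move: (Wop _ x) (Wop _ x) (m _) (Re _) (Im _) => *.
  by ring.
by rewrite opprD -(ibp _ (c1 2)) -(ibp _ (c2 2)).
Qed.

Lemma projection_norm k :
  (L2norm (fun x => (Pf k x / ((enorm x) ^+ 2)%:C)%R) ^+ 2 = (rdot (wk k) (wk k))%:E)%E.
Proof.
apply: (L2norm_projection_div (u := f) a0 L2_test_function) (hPf k).1 (hPf k).2.
move=> x; apply: complex_eqP; rewrite ?RecM ?ImcM.
  by rewrite (annular_indic_mul _ s1).
by rewrite (annular_indic_mul _ s2).
Qed.

End decomposition.

(** Parseval sums start at degree 0 and the series of the theorem at degree 1; they agree because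
    mu_0 = 0. *)
Lemma nneseries_from1 (R : realType) (u : nat -> R) (l : R) : u 0 = 0 ->
  (\sum_(0 <= k < K) u k) @[K --> \oo] --> l -> (\sum_(1 <= k <oo) (u k)%:E = l%:E)%E.
Proof.
move=> u0 ul; apply: cvg_lim => //.
rewrite (_ : (fun K => _) = EFin \o (fun K => \sum_(0 <= k < K) u k)); last first.
  apply/funext => K /=; rewrite sumEFin.
  suff -> : \sum_(1 <= k < K) u k = \sum_(0 <= k < K) u k by [].
  case: K => [|K]; first by rewrite !big_geq.
  by rewrite [RHS]big_ltn// u0 add0r.
by apply: cvg_EFin => //; exact: nearW.
Qed.

Theorem theorem2 (R : realType) (n : nat) (hn : (2 <= n)%N)
    (P : nat -> ('rV[R]_n -> R[i]) -> ('rV[R]_n -> R[i]))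
    (hP : forall k, orthogonal_projection (@harmonic_space R n k) (P k))
    (f : 'rV[R]_n -> R[i]) (hf : test_function_off0 f) :
  (L2norm (fun x =>
     (\sum_(j < n) spherical_derivative j (spherical_derivative j f) x)%R) ^+ 2 =
   \sum_(1 <= k <oo) ((mu_sph R n k) ^+ 2)%:E *
     L2norm (fun x => (P k f x / ((enorm x) ^+ 2)%:C)%R) ^+ 2)%E /\
  (\sum_(j < n)
     L2norm (fun x => (spherical_derivative j f x / (enorm x)%:C)%R) ^+ 2 =
   \sum_(1 <= k <oo) (mu_sph R n k)%:E *
     L2norm (fun x => (P k f x / ((enorm x) ^+ 2)%:C)%R) ^+ 2)%E.
Proof.
have [a [b [a0 s1 s2]]] := test_function_annulus hf; have [sm _ _] := hf.
have Lf : L2 f by exact: (L2_test_function a0 sm s1 s2).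
have hPf k : harmonic_space k (P k f) /\
    forall h, harmonic_space k h -> rdot (fun x => f x - P k f x) h = 0.
  have [hPk orth] := hP k f Lf; split => // h hh.
  by rewrite -Re_L2dot orth.
have mu0 : mu_sph R n 0 = 0 by rewrite /mu_sph mul0n.
split.
  rewrite (laplacian_norm a0 sm s1 s2); apply/esym.
  under eq_eseriesr do rewrite (projection_norm a0 sm s1 s2 hPf) -EFinM.
  apply: nneseries_from1; first by rewrite mu0 expr0n mul0r.
  exact: (laplacian_norm_cvg hn a0 sm s1 s2 hPf).
rewrite (gradient_pairing a0 sm s1 s2); apply/esym.
under eq_eseriesr do rewrite (projection_norm a0 sm s1 s2 hPf) -EFinM.
apply: nneseries_from1; first by rewrite mu0 mul0r.
exact: (laplacian_pairing_cvg hn a0 sm s1 s2 hPf).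
Qed.
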